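(* Let $\lambda=(\lambda_1,\lambda_2,\lambda_3)\in\mathbb C^3$ with $\lambda_1+\lambda_2+\lambda_3=0$ and with $\mathrm{Re}(\lambda_1-\lambda_2)$, $\mathrm{Re}(\lambda_2-\lambda_3)$ sufficiently large, let $m_1,m_2\in\mathbb Z$, $\psi(n(x,y,z))=e^{2\pi i(m_1x+m_2y)}$, and let $w=\left(\begin{pmatrix}0&1&0\\0&0&-1\\-1&0&0\end{pmatrix},1\right)\in\widetilde G$. Let $f=\begin{pmatrix}f_1\\ f_2\end{pmatrix}\in\widetilde V^\infty_{-\lambda,{}^\intercal\phi^{-1}}$. If $m_2\ne0$, then $\big\langle f(\tilde g),\int_{\Gamma_\infty\backslash N}\tilde E_{w_{\alpha_1}}(n\tilde g)\psi(n)\,dn\big\rangle_{\lambda,\phi}=0$. If $m_2=0$, then $$\Big\langle f(\tilde g),\int_{\Gamma_\infty\backslash N}\tilde E_{w_{\alpha_1}}(n\tilde g)\psi(n)\,dn\Big\rangle_{\lambda,\phi}=\Big(\sum_{B_2\in\mathbb Z_{>0}}(4B_2)^{-1-\lambda_2+\lambda_3}K_1(m_1;4B_2)\Big)\int_{\mathbb R}f_2(n(x,0,0)w)e^{-2\pi im_1x}\,dx.$$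
   Context: **Kloosterman-type sums.** $(\frac{\cdot}{\cdot})$ is the Kronecker symbol. For $c\in\mathbb Z_{>0}$, $K_\kappa(n;4c)=\sum_{d\in\mathbb Z/4c\mathbb Z}\varepsilon_d^{-\kappa}(\frac{4c}{d})e^{2\pi ind/4c}$, where $\varepsilon_d=1$ if $d\equiv1$ mod $4$, $\varepsilon_d=i$ if $d\equiv-1$ mod $4$, and terms with $d$ even are $0$. **Groups.** $G=\mathrm{SL}(3,\mathbb R)$; $B$ is its upper triangular subgroup; $N=\{n(x,y,z)\}$ with $n(x,y,z)=\begin{pmatrix}1&x&z\\0&1&y\\0&0&1\end{pmatrix}$; $A$ is the group of diagonal matrices with positive entries; $\mathrm t(a,b,c)=\mathrm{diag}(a,b,c)$. $w_{\alpha_1}=\begin{pmatrix}0&-1&0\\1&0&0\\0&0&1\end{pmatrix}$, $w_{\alpha_2}=\begin{pmatrix}1&0&0\\0&0&-1\\0&1&0\end{pmatrix}$, $w_\ell=w_{\alpha_1}w_{\alpha_2}w_{\alpha_1}=\begin{pmatrix}0&0&1\\0&-1&0\\1&0&0\end{pmatrix}$. For nonzero reals $(x,y)_{\mathbb R}=-1$ if $x,y<0$ and $1$ otherwise. The Plücker coordinates of a matrix with second row $(d,e,f)$ and third row $(g,h,i)$ are $(A_1',B_1',C_1',A_2',B_2',C_2')=(-g,-h,-i,-(dh-eg),di-fg,-(ei-fh))$. **Double cover.** Let $X_1(g)=\det g$, let $X_2(g)$ be the first nonzero entry of $-A_2',B_2',-C_2'$, let $X_3(g)$ be the first nonzero entry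 of $-A_1',-B_1',-C_1'$, and $\Delta(g)=\mathrm t(X_1/X_2,X_2/X_3,X_3)$. The Banks–Levy–Sepanski cocycle $\sigma:G\times G\to\{\pm1\}$ is computed by: $\sigma(\mathrm t(a_1,a_2,a_3),\mathrm t(b_1,b_2,b_3))=(a_1,b_2)_{\mathbb R}(a_1,b_3)_{\mathbb R}(a_2,b_3)_{\mathbb R}$ (for diagonal matrices of any determinant); $\sigma(a,h)=\sigma(a,\Delta(h))$ for $a$ diagonal; $\sigma(w_\alpha,h)=\sigma(\Delta(w_\alpha h)\Delta(h),-\Delta(h))$ for $w_\alpha\in\{w_{\alpha_1},w_{\alpha_2}\}$; and if $g_1=naw_1\cdots w_kn'$ is the Bruhat decomposition ($n,n'\in N$, $a$ diagonal, $w_1\cdots w_k$ a reduced word in $w_{\alpha_1},w_{\alpha_2}$) then $\sigma(g_1,g_2)=\sigma(a,w_1\cdots w_kn'g_2)\sigma(w_1,w_2\cdots w_kn'g_2)\cdots\sigma(w_k,n'g_2)$. $\widetilde G=G\times\{\pm1\}$ with $(g_1,\epsilon_1)(g_2,\epsilon_2)=(g_1g_2,\epsilon_1\epsilon_2\sigma(g_1,g_2))$. $N$ and $A$ are regarded as subgroups $\widetilde N,\widetilde A$ of $\widetilde G$ via $g\mapsto(g,1)$. $\widetilde N_-=(w_\ell,1)^{-1}\widetilde N(w_\ell,1)$; $\widetilde M=\{(\mathrm t(\epsilon_1,\epsilon_2,\epsilon_1\epsilon_2),\pm1):\epsilon_i=\pm1\}$. **Principal series.** $\phi:\widetilde M\to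 \mathrm{SL}(2,\mathbb C)$ is the representation $\phi((\mathrm t(\epsilon_1,\epsilon_2,\epsilon_1\epsilon_2),\pm1))=\pm\begin{pmatrix}0&-1\\1&0\end{pmatrix}^{(1-\epsilon_1)/2}\begin{pmatrix}-i&0\\0&i\end{pmatrix}^{(1-\epsilon_2)/2}$. $\rho=(1,0,-1)$. For $\mu\in\mathbb C^3$ with coordinate sum $0$ and a two-dimensional representation $\eta$ of $\widetilde M$, $\widetilde V^{\infty}_{\mu,\eta}$ (resp. $\widetilde V^{-\infty}_{\mu,\eta}$) is the space of smooth (resp. distributional) $f:\widetilde G\to\mathbb C^2$ with $f(\tilde g\tilde m an_-)=\prod_i a_i^{-(\mu_i-\rho_i)}\,\eta(\tilde m^{-1})f(\tilde g)$ for $\tilde m\in\widetilde M$, $a=\mathrm t(a_1,a_2,a_3)\in\widetilde A$, $n_-\in\widetilde N_-$; $\widetilde G$ acts by $(\pi(h)f)(g)=f(h^{-1}g)$. The $\widetilde G$-invariant pairing $\widetilde V^\infty_{-\lambda,{}^\intercal\phi^{-1}}\times\widetilde V^{-\infty}_{\lambda,\phi}\to\mathbb C$ is the extension to distributions of $\langle f,h\rangle_{\lambda,\phi}=\int_{N}(f_1h_1+f_2h_2)((w',1)n)\,dn$ ($w'$ any Weyl representative, $dn=dx\,dy\,dz$). $\tilde\tau\in\widetilde V^{-\infty}_{\lambda,\phi}$ is the element whose restriction to $(w_\ell,1)n(x,y,z)$ is $\begin{pmatrix}\delta_{(0,0,0)}(x,y,z)\\0\end{pmatrix}$, i.e. $\langle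 f,\tilde\tau\rangle_{\lambda,\phi}=f_1((w_\ell,1))$; it is left $\widetilde N$-invariant. **Eisenstein distribution, $w_{\alpha_1}$-cell.** $\Gamma=\Gamma_1(4)$ is the group of $\gamma\in\mathrm{SL}(3,\mathbb Z)$ congruent mod $4$ to an upper triangular unipotent matrix; $\Gamma_\infty=N\cap\mathrm{SL}(3,\mathbb Z)$. Elements of $\Gamma\cap Nw_{\alpha_1}B$ have Plücker coordinates $(0,0,-1,0,4B_2,C_2)$ with $B_2\neq0$. $S:\Gamma\to\widetilde G$, $S(\gamma)=(\gamma,s(\gamma))$ is Miller's splitting homomorphism, with $s(\gamma)=(\frac{B_2}{-C_2})$ on $\Gamma\cap Nw_{\alpha_1}B$. $\tilde E_{w_{\alpha_1}}(\tilde g)=\sum_{\gamma\in\Gamma_\infty\backslash(\Gamma\cap Nw_{\alpha_1}B)}\pi(S(\gamma)^{-1})\tilde\tau(\tilde g)\in\widetilde V^{-\infty}_{\lambda,\phi}$, convergent when $\mathrm{Re}(\lambda_1-\lambda_2)$, $\mathrm{Re}(\lambda_2-\lambda_3)$ are sufficiently large. The measure on $\Gamma_\infty\backslash N$ is induced by $dx\,dy\,dz$, and $\tilde E_{w_{\alpha_1}}(n\tilde g)$ means $\pi(n^{-1})\tilde E_{w_{\alpha_1}}$. *)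

(* Defs.v *)
From HB Require Import structures.
From mathcomp Require Import all_boot all_order all_algebra.
From mathcomp Require Import all_classical all_reals all_analysis.
From mathcomp Require Import complex ring.

Set Implicit Arguments.
Unset Strict Implicit.
Unset Printing Implicit Defensive.

Import Order.TTheory GRing.Theory Num.Theory.
Import numFieldNormedType.Exports.

Local Open Scope classical_set_scope.
Local Open Scope ring_scope.

Definition mx3 (T : Type) (a b c d e f g h i : T) : 'M[T]_3 :=
  \matrix_(r, s) nth a [:: a; b; c; d; e; f; g; h; i] (3 * r + s)%N.

Lemma det_mx3 (T : comNzRingType) (a b c d e f g h i : T) :
  \det (mx3 a b c d e f g h i) =
  a * (e * i - f * h) - b * (d * i - f * g) + c * (d * h - e * g).
Proof.
rewrite (expand_det_row _ 0) !big_ord_recl big_ord0 /cofactor.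
rewrite !(expand_det_row _ 0) !big_ord_recl !big_ord0 /cofactor !det_mx11 !mxE /=.
rewrite /bump /= !add0n /=.
by ring.
Qed.

Record SL3 (T : comUnitRingType) :=
  MkSL3 { mat :> 'M[T]_3; det_mat : \det mat == 1 }.

HB.instance Definition _ (T : comUnitRingType) := [isSub for @mat T].
HB.instance Definition _ (T : comUnitRingType) := [Choice of SL3 T by <:].

Section SL3Group.
Context {T : comUnitRingType}.
Implicit Types g h : SL3 T.

Fact SL3_mul_subproof g h : \det (g *m h) == 1.
Proof. by rewrite det_mulmx (eqP (det_mat g)) (eqP (det_mat h)) mulr1. Qed.

Fact SL3_inv_subproof g : \det (invmx g) == 1.
Proof. by rewrite det_inv (eqP (det_mat g)) invr1. Qed.

Fact SL3_one_subproof : \det (1%:M : 'M[T]_3) == 1.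
Proof. by rewrite det1. Qed.

Definition SL3_mul g h : SL3 T := MkSL3 (SL3_mul_subproof g h).
Definition SL3_inv g : SL3 T := MkSL3 (SL3_inv_subproof g).
Definition SL3_one : SL3 T := MkSL3 SL3_one_subproof.

Fact SL3_unitmx g : (g : 'M[T]_3) \in unitmx.
Proof. by rewrite unitmxE (eqP (det_mat g)) unitr1. Qed.

Fact SL3_mulA : associative SL3_mul.
Proof. by move=> g h k; apply: val_inj; exact: mulmxA. Qed.

Fact SL3_mul1 : left_id SL3_one SL3_mul.
Proof. by move=> g; apply: val_inj; exact: mul1mx. Qed.

Fact SL3_mulr1 : right_id SL3_one SL3_mul.
Proof. by move=> g; apply: val_inj; exact: mulmx1. Qed.

Fact SL3_mulV : left_inverse SL3_one SL3_inv SL3_mul.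
Proof. by move=> g; apply: val_inj; exact: (mulVmx (SL3_unitmx g)). Qed.

Fact SL3_mulrV : right_inverse SL3_one SL3_inv SL3_mul.
Proof. by move=> g; apply: val_inj; exact: (mulmxV (SL3_unitmx g)). Qed.
End SL3Group.

HB.instance Definition _ (T : comUnitRingType) :=
  isGroup.Build (SL3 T) SL3_mulA SL3_mul1 SL3_mulr1 SL3_mulV SL3_mulrV.

Fact det_map_SL3 (R : realType) (g : SL3 int) :
  \det (map_mx (intr : int -> R) g) == 1.
Proof. by rewrite det_map_mx (eqP (det_mat g)). Qed.

Definition SL3_intr (R : realType) (g : SL3 int) : SL3 R :=
  MkSL3 (det_map_SL3 R g).

Section Elements.
Context {T : comUnitRingType}.

Fact det_unip (x y z : T) : \det (mx3 1 x z 0 1 y 0 0 1) == 1.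
Proof. by rewrite det_mx3 !(mulr0, mul0r, subr0, mulr1, addr0). Qed.

(** [unip x y z] is the matrix n(x,y,z): note the order of the entries. *)
Definition unip (x y z : T) : SL3 T := MkSL3 (det_unip x y z).

Fact det_w_alpha1 : \det (mx3 0 (-1) 0 1 0 0 0 0 1 : 'M[T]_3) == 1.
Proof.
by rewrite det_mx3 !(mulr0, mul0r, subr0, mulr1, addr0, mul1r, sub0r, opprK).
Qed.
Definition w_alpha1 : SL3 T := MkSL3 det_w_alpha1.

Fact det_w_alpha2 : \det (mx3 1 0 0 0 0 (-1) 0 1 0 : 'M[T]_3) == 1.
Proof.
by rewrite det_mx3 !(mulr0, mul0r, subr0, mulr1, addr0, mul1r, sub0r, opprK).
Qed.
Definition w_alpha2 : SL3 T := MkSL3 det_w_alpha2.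

Definition w_long : SL3 T := (w_alpha1 * w_alpha2 * w_alpha1)%g.

Fact det_w_stat : \det (mx3 0 1 0 0 0 (-1) (-1) 0 0 : 'M[T]_3) == 1.
Proof.
by rewrite det_mx3 !(mulr0, mul0r, subr0, mulr1, addr0, mul1r, sub0r, opprK,
  mulrN, mulr1, add0r).
Qed.
Definition w_stat : SL3 T := MkSL3 det_w_stat.

Definition inN (g : SL3 T) : Prop := exists x y z, g = unip x y z.
Definition inB (g : SL3 T) : Prop := forall i j : 'I_3, (j < i)%N -> g i j = 0.

Definition plA1 (g : 'M[T]_3) : T := - g 2 0.
Definition plB1 (g : 'M[T]_3) : T := - g 2 1.
Definition plC1 (g : 'M[T]_3) : T := - g 2 2.
Definition plA2 (g : 'M[T]_3) : T := - (g 1 0 * g 2 1 - g 1 1 * g 2 0).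
Definition plB2 (g : 'M[T]_3) : T := g 1 0 * g 2 2 - g 1 2 * g 2 0.
Definition plC2 (g : 'M[T]_3) : T := - (g 1 1 * g 2 2 - g 1 2 * g 2 1).
End Elements.

(** The group {±1} is represented by [bool] with [true] standing for -1, so that
    its product is [addb] and the sign of [b] is [(-1) ^+ b]. *)

Definition hilbertR (R : realType) (x y : R) : bool := (x < 0) && (y < 0).

Definition first_nonzero (R : realType) (x y z : R) : R :=
  if x != 0 then x else if y != 0 then y else z.

Definition diag3 (R : realType) (a b c : R) : 'M[R]_3 :=
  mx3 a 0 0 0 b 0 0 0 c.

Definition Delta (R : realType) (g : 'M[R]_3) : 'M[R]_3 :=
  let X1 := \det g in
  let X2 := first_nonzero (- plA2 g) (plB2 g) (- plC2 g) in
  let X3 := first_nonzero (- plA1 g) (- plB1 g) (- plC1 g) in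
  diag3 (X1 / X2) (X2 / X3) X3.

(** The cocycle on diagonal matrices of arbitrary nonzero determinant. *)
Definition sigma_diag (R : realType) (a b : 'M[R]_3) : bool :=
  hilbertR (a 0 0) (b 1 1) (+) hilbertR (a 0 0) (b 2 2)
  (+) hilbertR (a 1 1) (b 2 2).

(** Words in the simple reflections: [false] is w_alpha1, [true] is w_alpha2.
    The reduced ones are the alternating ones of length at most 3. *)
Definition wgen (R : realType) (b : bool) : SL3 R :=
  if b then w_alpha2 else w_alpha1.

Definition word_prod (R : realType) (s : seq bool) : SL3 R :=
  (\prod_(b <- s) wgen R b)%g.

Definition reduced_word (s : seq bool) : bool :=
  (size s <= 3)%N && sorted (fun b c => b != c) s.

Fixpoint sigma_word (R : realType) (sigma : SL3 R -> SL3 R -> bool)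
    (s : seq bool) (h : SL3 R) : bool :=
  if s is b :: s' then
    sigma (wgen R b) (word_prod R s' * h)%g (+) sigma_word sigma s' h
  else false.

(** [sigma] is the Banks-Levy-Sepanski 2-cocycle. By the Bruhat decomposition
    the other rules determine it. *)
Record is_BLS_cocycle (R : realType) (sigma : SL3 R -> SL3 R -> bool) : Prop := {
  BLS_cocycle : forall g1 g2 g3 : SL3 R,
    sigma g1 g2 (+) sigma (g1 * g2)%g g3 = sigma g1 (g2 * g3)%g (+) sigma g2 g3;
  BLS_diag_diag : forall a b : SL3 R, is_diag_mx a -> is_diag_mx b ->
    sigma a b = sigma_diag a b;
  BLS_diag : forall a h : SL3 R, is_diag_mx a ->
    sigma a h = sigma_diag a (Delta h);
  BLS_weyl : forall (b : bool) (h : SL3 R),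
    sigma (wgen R b) h =
    sigma_diag (Delta (wgen R b * h)%g *m Delta h) (- Delta h);
  BLS_bruhat : forall (n a n' g2 : SL3 R) (s : seq bool),
    inN n -> is_diag_mx a -> reduced_word s -> inN n' ->
    sigma (n * a * word_prod R s * n')%g g2 =
    sigma a (word_prod R s * n' * g2)%g (+) sigma_word sigma s (n' * g2)%g
}.

Definition cover (R : realType) : Type := (SL3 R * bool)%type.

Section Cover.
Context {R : realType}.
Variable sigma : SL3 R -> SL3 R -> bool.

Definition cmul (g h : cover R) : cover R :=
  ((g.1 * h.1)%g, g.2 (+) h.2 (+) sigma g.1 h.1).

Definition cinv (g : cover R) : cover R :=
  ((g.1^-1)%g, g.2 (+) sigma g.1 (g.1^-1)%g).

Definition to_cover (g : SL3 R) : cover R := (g, false).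

Definition in_Nt (g : cover R) : Prop := exists2 n, inN n & g = to_cover n.

Definition inA (a : SL3 R) : Prop :=
  is_diag_mx a /\ forall i, 0 < a i i.

Definition in_Nt_minus (g : cover R) : Prop :=
  exists2 n, in_Nt n & g = cmul (cmul (cinv (to_cover w_long)) n) (to_cover w_long).

Definition in_Mt (m : cover R) : Prop :=
  exists e1 e2 : bool,
    m.1 = diag3 ((-1) ^+ e1) ((-1) ^+ e2) ((-1) ^+ e1 * (-1) ^+ e2) :> 'M[R]_3.

End Cover.

Section Complex.
Context {R : realType}.
Local Notation C := R[i].

Definition expi (t : R) : C := (cos t +i* sin t)%C.

(** [cpow a s] is a^s for a > 0 and s complex. *)
Definition cpow (a : R) (s : C) : C :=
  (expR (complex.Re s * ln a))%:C%C * expi (complex.Im s * ln a).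

Definition csummable (I : choiceType) (D : set I) (u : I -> C) : Prop :=
  summable D (fun i => (complex.Re `|u i|)%:E).

(** Sum of a family, the difference of the sums of positive and negative parts. *)
Definition rsum (I : choiceType) (D : set I) (u : I -> R) : R :=
  fine (\esum_(i in D) (Num.max (u i) 0)%:E) -
  fine (\esum_(i in D) (Num.max (- u i) 0)%:E).

Definition csum (I : choiceType) (D : set I) (u : I -> C) : C :=
  (rsum D (fun i => complex.Re (u i)) +i* rsum D (fun i => complex.Im (u i)))%C.

Definition cintegral d (T : measurableType d) (mu : {measure set T -> \bar R})
    (D : set T) (f : T -> C) : C :=
  ((\int[mu]_(x in D) complex.Re (f x)) +i*
   (\int[mu]_(x in D) complex.Im (f x)))%C.

Definition lebesgue3 : {measure set
    (measurableTypeR R * measurableTypeR R * measurableTypeR R) -> \bar R} :=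
  ((@lebesgue_measure R \x @lebesgue_measure R) \x @lebesgue_measure R)%E.

End Complex.

Section PrincipalSeries.
Context {R : realType}.
Local Notation C := R[i].
Variable sigma : SL3 R -> SL3 R -> bool.
Local Notation "g ∙ h" := (cmul sigma g h) (at level 40, left associativity).

(** Functions on the cover with values in column vectors; the components f_1 and
    f_2 of [f g] are [f g 0 0] and [f g 1 0]. *)
Definition section : Type := cover R -> 'cV[C]_2.

Definition pderivs (n : nat) (s : seq 'I_n.+1) (F : 'rV[R]_n.+1 -> R) :
    'rV[R]_n.+1 -> R :=
  foldr (fun i G x => 'D_(delta_mx 0 i) (G : 'rV[R]_n.+1 -> R^o) x) F s.

Definition Cinfty (n : nat) (F : 'rV[R]_n.+1 -> R) : Prop :=
  forall s : seq 'I_n.+1, continuous (pderivs s F) /\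
  forall i x, derivable (pderivs s F : 'rV[R]_n.+1 -> R^o) x (delta_mx 0 i).

Fact det_diag_exp (s t : R) :
  \det (diag3 (expR s) (expR t) (expR (- s - t))) == 1.
Proof.
rewrite det_mx3 !(mulr0, mul0r, subr0, addr0) -!expRD.
by rewrite (_ : s + _ = 0) ?expR0//; ring.
Qed.
Definition diag_exp (s t : R) : SL3 R := MkSL3 (det_diag_exp s t).

(** The cover does not carry the product topology, as [sigma] is not
    continuous. Its manifold structure is given by the translates of the big cell
    N A N_-, on which the lifts of N, A and N_- are smooth: [chart g] is a
    diffeomorphism of R^8 onto an open neighbourhood of [g]. *)
Definition chart (g : cover R) (x : 'rV[R]_8) : cover R :=
  g ∙ to_cover (unip (x 0 0) (x 0 1) (x 0 2))
    ∙ to_cover (diag_exp (x 0 3) (x 0 4))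
    ∙ (cinv sigma (to_cover w_long)
       ∙ to_cover (unip (x 0 5) (x 0 6) (x 0 7))
       ∙ to_cover w_long).

Definition Re_in_chart (f : section) (g : cover R) (j : 'I_2) (x : 'rV[R]_8) : R :=
  complex.Re (f (chart g x) j 0).
Definition Im_in_chart (f : section) (g : cover R) (j : 'I_2) (x : 'rV[R]_8) : R :=
  complex.Im (f (chart g x) j 0).

Definition smooth (f : section) : Prop :=
  forall g j, Cinfty (Re_in_chart f g j) /\ Cinfty (Im_in_chart f g j).

Definition rho : 'rV[C]_3 := \row_(i < 3) (1 - i%:R).

(** A representation of M~ is given as a matrix-valued function on the cover, of
    which only the values on M~ matter. *)
Definition Vsmooth (mu : 'rV[C]_3) (eta : cover R -> 'M[C]_2) (f : section) : Prop :=
  smooth f /\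
  forall (g m : cover R) (a : SL3 R) (n : cover R),
    in_Mt m -> inA a -> in_Nt_minus sigma n ->
    f (g ∙ m ∙ to_cover a ∙ n) =
    (\prod_(i < 3) cpow (a i i) (- (mu 0 i - rho 0 i)))
      *: (eta (cinv sigma m) *m f g).

Definition phi (m : cover R) : 'M[C]_2 :=
  let J : 'M[C]_2 := \matrix_(r, s) nth 0 [:: 0; -1; 1; 0] (2 * r + s)%N in
  let D : 'M[C]_2 := \matrix_(r, s) nth 0 [:: - 'i%C; 0; 0; 'i%C] (2 * r + s)%N in
  (-1) ^+ m.2 *: (J ^+ (m.1 0 0 < 0)%R *m D ^+ (m.1 1 1 < 0)%R).

Definition contragredient (eta : cover R -> 'M[C]_2) (m : cover R) : 'M[C]_2 :=
  (invmx (eta m))^T.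

Definition act (h : cover R) (f : section) : section :=
  fun g => f (cinv sigma h ∙ g).

(** Distribution vectors. The invariant pairing identifies the distributional
    principal series with parameters [lam], [eta] with the continuous dual of the
    smooth principal series with parameters [- lam], [contragredient eta]; the
    vector T is represented by the functional f |-> <f, T>. *)
Definition distr : Type := section -> C.

Definition pairing (f : section) (T : distr) : C := T f.

(** The embedding of smooth vectors that normalises this identification. *)
Definition distr_of_smooth (h : section) : distr := fun f =>
  cintegral lebesgue3 setT (fun p =>
    let g := to_cover w_long ∙ to_cover (unip p.1.1 p.1.2 p.2) in
    f g 0 0 * h g 0 0 + f g 1 0 * h g 1 0).

Definition Vdistr (lam : 'rV[C]_3) (eta : cover R -> 'M[C]_2) (T : distr) : Prop :=
  let V := Vsmooth (- lam) (contragredient eta) in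
  (forall (c : C) (f h : section), V f -> V h ->
     T (fun g => c *: f g + h g) = c * T f + T h) /\
  (exists (K r : R) (k : nat) (gs : seq (cover R)), forall (f : section) (B : R),
     V f -> 0 <= B ->
     (forall g j s x, g \in gs -> (size s <= k)%N -> `|x| <= r ->
        `|pderivs s (Re_in_chart f g j) x| <= B /\
        `|pderivs s (Im_in_chart f g j) x| <= B) ->
     complex.Re `|T f| <= K * B).

(** The contragredient action: <f, pi(h) T> = <pi(h^-1) f, T>. *)
Definition dact (h : cover R) (T : distr) : distr :=
  fun f => T (act (cinv sigma h) f).

Definition tau : distr := fun f => f (to_cover w_long) 0 0.

(** The family [T] is summable in the weak topology on distribution vectors,
    with sum [E]. *)
Definition distr_sum (lam : 'rV[C]_3) (eta : cover R -> 'M[C]_2)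
    (I : choiceType) (D : set I) (T : I -> distr) (E : distr) : Prop :=
  Vdistr lam eta E /\
  forall f, Vsmooth (- lam) (contragredient eta) f ->
    csummable D (fun i => pairing f (T i)) /\
    pairing f E = csum D (fun i => pairing f (T i)).
End PrincipalSeries.

Definition legendre (a : int) (p : nat) : int :=
  if (p %| a)%Z then 0
  else if [exists x : 'I_p, ((x : nat)%:Z ^+ 2 == a %[mod p])%Z] then 1 else -1.

Definition kronecker_prime (a : int) (p : nat) : int :=
  if p == 2%N then
    if (2 %| a)%Z then 0
    else if (a == 1 %[mod 8])%Z || (a == -1 %[mod 8])%Z then 1 else -1
  else legendre a p.

Definition kronecker (a n : int) : int :=
  if n == 0 then (`|a|%N == 1%N)%:R
  else (-1) ^+ ((n < 0) && (a < 0)) *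
       \prod_(p <- primes `|n|%N) kronecker_prime a p ^+ logn p `|n|%N.

Section Kloosterman.
Context {R : realType}.
Local Notation C := R[i].

Definition eps (d : nat) : C := if (d %% 4 == 1)%N then 1 else 'i%C.

(** The sum K_kappa(n; 4c), for c > 0. *)
Definition kloosterman (kappa n : int) (c : nat) : C :=
  \sum_(d < 4 * c | odd d)
    eps d ^ (- kappa) * (kronecker (4 * c)%N%:Z (d : nat)%:Z)%:~R *
    expi (2 * pi * (n%:~R * (d : nat)%:R / (4 * c)%N%:R)).
End Kloosterman.

Section Eisenstein.
Context {R : realType}.
Local Notation C := R[i].
Variable sigma : SL3 R -> SL3 R -> bool.

Definition Gamma1_4 : set (SL3 int) :=
  [set g | forall i j : 'I_3, (j <= i)%N -> (g i j == (i == j)%:R %[mod 4])%Z].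

(** Gamma_oo is the set of matrices [unip a b c] over the integers. *)
Definition Ginf_coset (g : SL3 int) : set (SL3 int) :=
  [set (n * g)%g | n in @inN int].

Definition cell_alpha1 : set (SL3 int) :=
  [set g | Gamma1_4 g /\
     exists n b : SL3 R, [/\ inN n, inB b & SL3_intr R g = (n * w_alpha1 * b)%g]].

(** Miller's splitting on the cell: there the Plücker coordinates are
    (0, 0, -1, 0, 4 B_2, C_2) and s is the Kronecker symbol (B_2 / -C_2). *)
Definition splitting_alpha1 (g : SL3 int) : cover R :=
  (SL3_intr R g, kronecker (plB2 g %/ 4)%Z (- plC2 g) == -1).

Definition eisenstein_term (c : set (SL3 int)) : distr :=
  dact sigma (cinv sigma (splitting_alpha1 (xget 1%g c))) tau.

Definition eisenstein_alpha1 (lam : 'rV[C]_3) : distr :=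
  xget (fun=> 0) [set E | distr_sum sigma lam phi
    [set Ginf_coset g | g in cell_alpha1] eisenstein_term E].

Definition psi (m1 m2 : int) (n : SL3 R) : C :=
  expi (2 * pi * (m1%:~R * n 0 1 + m2%:~R * n 1 2)).

(** The integral over Gamma_oo \ N of E(n g) psi(n), as a weak integral; the unit
    cube is a strict fundamental domain for Gamma_oo in N. *)
Definition fourier_coefficient (m1 m2 : int) (E : distr) : distr := fun f =>
  cintegral lebesgue3
    ([set` `[0, 1[%R] `*` [set` `[0, 1[%R] `*` [set` `[0, 1[%R])
    (fun p => let n := unip p.1.1 p.1.2 p.2 in
       pairing f (dact sigma (cinv sigma (to_cover n)) E) * psi m1 m2 n).
End Eisenstein.

(* Main.v *)
(** The cosets in the cell are determined by the middle row (d, e) = (4 B_2, - C_2) of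
    a representative gamma. Factoring gamma n(x,y,z) n(- x - e/d, 0, 0) w as an element
    of N w_l A M shows that the summand of gamma depends on x only and is a multiple
    of f_2(n(- x - e/d, 0, 0) w). Quadratic reciprocity turns the sign made of the
    Kronecker symbol (B_2 / - C_2), the cocycle and phi into the summand
    eps_r^-1 (4c / r) of the Kloosterman sum, where c = |B_2| and e/d = - r/(4c), while
    A contributes (4c)^(- 1 - lambda_2 + lambda_3). Hence the integrals over y and z
    are those of a character of y, and grouping the r by residues modulo 4c unfolds
    the integral over x in [0, 1[ to one over the line. Everything converges
    absolutely because f_2(n(x,0,0) w) = O(1 / (1 + x^2)), as one sees in the chart -1/x
    of the projective line on which x is a coordinate. *)

From HB Require Import structures.
From mathcomp Require Import all_boot all_order all_fingroup all_algebra.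
From mathcomp Require Import all_solvable all_field.
From mathcomp Require Import all_classical all_reals all_analysis.
From mathcomp Require Import measurable_realfun complex zify ring lra.
Require Import Defs.

Import Order.TTheory GRing.Theory Num.Theory.
Import numFieldNormedType.Exports.
Import Normc.

Local Open Scope classical_set_scope.
Local Open Scope ring_scope.

(** * Quadratic reciprocity and the Kronecker symbol *)

Lemma euler_criterion (F : finFieldType) (y : F) : odd #|F| -> y != 0 ->
  y ^+ (#|F|.-1./2) = if [exists x, x ^+ 2 == y] then 1 else -1.
Proof.
move=> oF y0; set h := (#|F|.-1)./2.
have F1 : (1 < #|F|)%N by exact: finNzRing_gt1.
have hE : (#|F|.-1 = 2 * h)%N.
  by rewrite /h mul2n -[LHS]odd_double_half; move: oF F1; case: #|F| => //= n /negbTE ->.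
have fer (x : F) : x != 0 -> x ^+ #|F|.-1 = 1.
  move=> x0; apply: (mulfI x0); rewrite -exprS prednK ?mulr1 ?expf_card//.
  exact: ltnW.
case: ifPn => [/existsP [x /eqP xy]|].
  rewrite -xy -exprM -hE fer//; apply: contra_neq y0 => x0.
  by rewrite -xy x0 expr0n.
move=> nsq; have /eqP : (y ^+ h) ^+ 2 = 1 by rewrite -exprM mulnC -hE fer.
rewrite sqrf_eq1 => /orP[/eqP yh|/eqP//]; case/negP: nsq.
have Uy : y \is a GRing.unit by rewrite unitfE.
have /cyclicP [g gE] := field_unit_group_cyclic [group of [set: {unit F}]].
have /cycleP [k yk] : FinRing.unit F Uy \in <[g]>%g by rewrite -gE inE.
have og : #[g]%g = #|F|.-1 by rewrite orderE -gE /= card_finField_unit.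
have : (FinRing.unit F Uy ^+ h = 1)%g.
  by apply: val_inj; rewrite FinRing.val_unitX /= yh.
rewrite yk -expgM => /eqP; rewrite -order_dvdn og hE => dv.
have h0 : (0 < h)%N by lia.
move: dv; rewrite dvdn_pmul2r// => /dvdnP [j kj].
apply/existsP; exists (FinRing.uval (g ^+ j)%g); apply/eqP.
rewrite -FinRing.val_unitX -expgM -kj -yk//.
Qed.

Lemma legendreE (a : int) (p : nat) : prime p ->
  legendre a p = if a%:~R == 0 :> 'F_p then 0
    else if [exists x : 'F_p, x ^+ 2 == a%:~R] then 1 else -1.
Proof.
move=> pp; rewrite /legendre (dvdz_pcharf (pchar_Fp pp)).
case: ifP => // _; congr (if _ then _ else _).
apply/existsP/existsP => [[x]|[x]].
  rewrite eqz_mod_dvd (dvdz_pcharf (pchar_Fp pp)) rmorphB rmorphXn/= subr_eq0.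
  by exists (x : nat)%:R.
move=> /eqP xa.
have xp : (x < p)%N by rewrite -[X in (_ < X)%N](Fp_cast pp).
exists (Ordinal xp); rewrite eqz_mod_dvd (dvdz_pcharf (pchar_Fp pp)) rmorphB rmorphXn/=.
by rewrite subr_eq0 -xa -pmulrn natr_Zp.
Qed.

Section Legendre.
Variable (p : nat).
Hypotheses (pp : prime p) (op : odd p).

Let p2 : (2 < p)%N. Proof. by rewrite odd_prime_gt2. Qed.

Lemma legendre_euler (a : int) :
  (legendre a p)%:~R = a%:~R ^+ (p.-1./2) :> 'F_p.
Proof.
rewrite legendreE//; case: eqP => [->|/eqP a0].
  by rewrite expr0n; case: eqP => //; lia.
have := @euler_criterion 'F_p a%:~R; rewrite card_Fp// => ->//.
by case: ifP => _; rewrite ?mulr1z ?mulrN1z.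
Qed.

Lemma sign_inj (F : fieldType) (u v : int) : 2%:R != 0 :> F ->
  u \in [:: 0; 1; -1] -> v \in [:: 0; 1; -1] -> u%:~R = v%:~R :> F -> u = v.
Proof.
move=> t0; have o0 := oner_neq0 F.
have on : (1 : F) <> -1.
  by move=> /eqP; rewrite -subr_eq0 opprK -[1+1]/(2%:R) (negbTE t0).
rewrite !inE => /or3P[] /eqP-> /or3P[] /eqP-> //; rewrite ?mulrN1z ?mulr1z ?mulr0z => /eqP;
  rewrite ?oppr_eq0 ?(negbTE o0) // eq_sym ?oppr_eq0 ?(negbTE o0) // => /eqP; by [|move/esym].
Qed.

Lemma legendre_sign (a : int) : legendre a p \in [:: 0; 1; -1].
Proof. by rewrite /legendre; do 2?case: ifP => _; rewrite !inE. Qed.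

Lemma two_Fp : 2%:R != 0 :> 'F_p.
Proof. by rewrite -(dvdn_pcharf (pchar_Fp pp)); apply/negP => /dvdn_leq; lia. Qed.

Lemma legendre_inj (u v : int) : u \in [:: 0; 1; -1] -> v \in [:: 0; 1; -1] ->
  u%:~R = v%:~R :> 'F_p -> u = v.
Proof. exact: sign_inj two_Fp. Qed.

Lemma signM (u v : int) : u \in [:: 0; 1; -1] -> v \in [:: 0; 1; -1] ->
  u * v \in [:: 0; 1; -1].
Proof. by rewrite !inE => /or3P[] /eqP-> /or3P[] /eqP->. Qed.

Lemma legendreM (a b : int) : legendre (a * b) p = legendre a p * legendre b p.
Proof.
apply: legendre_inj; rewrite ?signM ?legendre_sign//.
by rewrite rmorphM/= !legendre_euler rmorphM/= exprMn.
Qed.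

Lemma legendre_mod (a b : int) : a%:~R = b%:~R :> 'F_p -> legendre a p = legendre b p.
Proof. by move=> ab; rewrite !legendreE// ab. Qed.

Lemma legendre_eq0 (a : int) : (legendre a p == 0) = (p %| a)%Z.
Proof. by rewrite /legendre; case: ifP => //; case: ifP. Qed.

Lemma legendre_sqr (a : int) : ~~ (p %| a)%Z -> legendre a p ^+ 2 = 1.
Proof.
rewrite -legendre_eq0; have := legendre_sign a.
by rewrite !inE => /or3P[] /eqP->.
Qed.

Lemma legendreN1 : legendre (-1) p = (-1) ^+ (p.-1./2).
Proof.
apply: legendre_inj; rewrite ?legendre_sign//.
  by rewrite -signr_odd; case: odd.
by rewrite legendre_euler !rmorphXn/= !rmorphN.
Qed.

Lemma legendre1 : legendre 1 p = 1.
Proof.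
by apply: legendre_inj; rewrite ?legendre_sign// legendre_euler mulr1z expr1n.
Qed.
End Legendre.

Section GaussSum.
Variables (p q : nat).
Hypotheses (pp : prime p) (op : odd p) (pq : prime q) (oq : odd q) (npq : p != q).

(* Comparing the Frobenius with the square of the Gauss sum [tau]:
   tau ^ 2 = (-1/p) p and tau ^ q = (q/p) tau. *)
Lemma legendre_reciprocity : legendre q p = legendre (legendre (-1) p * p%:Z) q.
Proof.
have [K [f _]] := countable_algebraic_closure 'F_q.
have chK : q \in [pchar K] by rewrite (fmorph_pchar f) pchar_Fp.
have [z zS] : exists z : K, \sum_(i < p) z ^+ i = 0.
  have [|z /rootP] := closed_rootP (\poly_(i < p) (1 : K)) _.
    by rewrite size_poly_eq ?oner_eq0//; have := prime_gt1 pp; lia.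
  by rewrite horner_poly => zs; exists z; rewrite -[RHS]zs; apply: eq_bigr => i _; rewrite mul1r.
have z1 : z ^+ p = 1.
  by apply/eqP; rewrite -subr_eq0 subrX1 zS mulr0.
have pK : p%:R != 0 :> K.
  rewrite -(dvdn_pcharf chK) dvdn_prime2// eq_sym //.
have zmod n : z ^+ (n %% p) = z ^+ n.
  by rewrite [in RHS](divn_eq n p) exprD mulnC exprM z1 expr1n mul1r.
pose E (a : 'F_p) : K := z ^+ a.
have EN n : E n%:R = z ^+ n by rewrite /E val_Fp_nat// zmod.
have ED a b : E (a + b) = E a * E b.
  by rewrite -[a in LHS]natr_Zp -[b in LHS]natr_Zp -natrD EN exprD.
have E0 : E 0 = 1 by [].
have ES : \sum_(a : 'F_p) E a = 0.
  rewrite -[RHS]zS (reindex (fun i : 'I_p => (i : nat)%:R : 'F_p)).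
    by apply: eq_bigr => i _; rewrite EN.
  have lt (a : 'F_p) : (a < p)%N by rewrite -[X in (_ < X)%N](Fp_cast pp).
  exists (fun a => Ordinal (lt a)) => [i _|a _].
    by apply: val_inj; rewrite /= val_Fp_nat// modn_small.
  by rewrite /= natr_Zp.
have ESs s : s != 0 -> \sum_(a : 'F_p) E (a * s) = 0.
  move=> s0; rewrite -[RHS]ES [RHS](reindex (fun a => a * s))//.
  by exists (fun a => a / s) => a _; rewrite ?mulfK ?mulfVK.
pose chi (a : 'F_p) : int := legendre (a : nat)%:Z p.
have chi0 : chi 0 = 0 by apply/eqP; rewrite legendre_eq0.
have chiM a b : chi (a * b) = chi a * chi b.
  rewrite /chi -legendreM//; apply: legendre_mod => //.
  by rewrite intrM -!pmulrn !natr_Zp.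
have chi2 a : a != 0 -> chi a ^+ 2 = 1.
  move=> a0; apply: legendre_sqr => //.
  by rewrite (dvdz_pcharf (pchar_Fp pp)) -pmulrn natr_Zp.
have card2 (a : 'F_p) : a != 0 -> 1 = chi a * chi a by move=> /chi2.
pose tau : K := \sum_(a : 'F_p) (chi a)%:~R * E a.
have [g g0 gn] : exists2 g : 'F_p, g != 0 & chi g = -1.
  have [/existsP[g /andP[g0 /eqP]]|noex] :=
    boolP [exists g : 'F_p, (g != 0) && (chi g == -1)]; first by exists g.
  have all1 (a : 'F_p) : a != 0 -> a ^+ (p.-1./2) = 1.
    move=> a0; have := legendre_euler p pp op (a : nat)%:Z.
    rewrite -pmulrn natr_Zp => <-; rewrite -/(chi a).
    have : chi a \in [:: 0; 1; -1] by exact: legendre_sign.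
    rewrite !inE => /or3P[] /eqP c; rewrite c//.
      by have := chi2 a a0; rewrite c.
    by case/existsP: noex; exists a; rewrite a0 c eqxx.
  have h0 : (0 < p.-1./2)%N by have := odd_prime_gt2 op pp; lia.
  have Pn0 : ('X^(p.-1./2) - 1 : {poly 'F_p}) != 0.
    by rewrite -size_poly_eq0 size_XnsubC.
  have := @max_poly_roots _ _ (enum [pred a : 'F_p | a != 0]) Pn0.
  rewrite size_XnsubC// -cardE cardC1 card_Fp// enum_uniq => -/(_ _ isT).
  suff -> : all (root ('X^(p.-1./2) - 1)) (enum [pred a : 'F_p | a != 0]).
    by move/(_ isT); have := odd_prime_gt2 op pp; lia.
  apply/allP => a; rewrite mem_enum inE => a0.
  by rewrite rootE !hornerE all1// subrr.
have chiS : \sum_(a : 'F_p) (chi a)%:~R = 0 :> K.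
  have : \sum_(a : 'F_p) (chi a)%:~R = - \sum_(a : 'F_p) (chi a)%:~R :> K.
    rewrite [LHS](reindex (fun a => g * a)) -?sumrN /=.
      by apply: eq_bigr => a _; rewrite chiM gn mulN1r rmorphN.
    by exists (fun a => g^-1 * a) => a _; rewrite ?mulKf ?mulVKf.
  move=> /eqP; rewrite -subr_eq0 opprK -mulr2n -mulr_natr mulf_eq0.
  case/orP => [/eqP//|]; rewrite -(dvdn_pcharf chK) => /dvdn_leq.
  by have := odd_prime_gt2 oq pq; lia.
have tau2 : tau ^+ 2 = (chi (-1) * p%:Z)%:~R.
  rewrite expr2 {1}/tau mulr_suml (bigD1 0)//= chi0 mul0r mul0r add0r.
  transitivity (\sum_(a | a != 0) \sum_(t : 'F_p) (chi t)%:~R * E (a * (1 + t))).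
    apply: eq_bigr => a a0; rewrite /tau (reindex (fun t => a * t)).
      rewrite mulr_sumr; apply: eq_bigr => t _.
      rewrite mulrDr mulr1 ED chiM rmorphM/=.
      transitivity (((chi a)%:~R * (chi a)%:~R) * ((chi t)%:~R * (E a * E (a * t)))).
        by ring.
      by rewrite -rmorphM/= -card2// mulr1z mul1r.
    by exists (fun t => a^-1 * t) => t _; rewrite ?mulKf ?mulVKf.
  rewrite exchange_big/=.
  transitivity (\sum_(t : 'F_p) (chi t)%:~R * (\sum_a E (a * (1 + t)) - 1)).
    apply: eq_bigr => t _; rewrite -mulr_sumr; congr (_ * _).
    by rewrite [in RHS](bigD1 0)//= mul0r E0 addrAC subrr add0r.
  under eq_bigr do rewrite mulrBr mulr1; rewrite sumrB chiS subr0.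
  rewrite (bigD1 (-1))//= [X in _ + X]big1 => [|t tn].
    rewrite addr0 subrr; under eq_bigr do rewrite mulr0 E0.
    by rewrite sumr_const card_Fp// rmorphM/= -pmulrn.
  by rewrite ESs ?mulr0// addrC addr_eq0.
have tauq : tau ^+ q = (chi q%:R)%:~R * tau.
  rewrite -(pFrobenius_autE chK) rmorph_sum/=.
  transitivity (\sum_a (chi q%:R)%:~R * ((chi (q%:R * a))%:~R * E (q%:R * a))).
    apply: eq_bigr => a _; rewrite rmorphM/= rmorph_int mulrA; congr (_ * _).
      rewrite chiM -rmorphM/= mulrA -card2 ?mul1r//.
      rewrite -(dvdn_pcharf (pchar_Fp pp)) dvdn_prime2//.
    by rewrite pFrobenius_autE [E a]/E -exprM -EN natrM natr_Zp mulrC.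
  rewrite -mulr_sumr; congr (_ * _).
  have q0 : q%:R != 0 :> 'F_p by rewrite -(dvdn_pcharf (pchar_Fp pp)) dvdn_prime2.
  rewrite [RHS](reindex (fun a => q%:R * a))//.
  by exists (fun a => q%:R^-1 * a) => a _; rewrite ?mulKf ?mulVKf.
have c1 : chi (-1) != 0.
  by apply: contra_eq_neq (chi2 (-1) _) => [->|]; rewrite ?oppr_eq0 ?oner_eq0.
have tau0 : tau != 0.
  rewrite -sqrf_eq0 tau2 rmorphM/= mulf_neq0//.
  have := legendre_sign p (nat_of_ord (-1 : 'F_p))%:Z.
  rewrite -/(chi (-1)) !inE (negbTE c1)/= => /orP[] /eqP ->.
    by rewrite mulr1z oner_eq0.
  by rewrite mulrN1z oppr_eq0 oner_eq0.
have chN1 : chi (-1) = legendre (-1) p.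
  by apply: legendre_mod => //; rewrite -pmulrn natr_Zp.
have chq : chi q%:R = legendre q p.
  by apply: legendre_mod => //; rewrite -pmulrn natr_Zp.
have t2K : 2%:R != 0 :> K.
  by rewrite -(dvdn_pcharf chK); apply/negP => /dvdn_leq; have := odd_prime_gt2 oq pq; lia.
apply: (sign_inj _ _ _ t2K); rewrite ?legendre_sign//.
apply: (mulIf tau0); rewrite -chq -tauq -chN1.
have qE : (q = (2 * q.-1./2).+1)%N by have := prime_gt0 pq; lia.
rewrite [X in _ ^+ X]qE exprSr exprM tau2; congr (_ * _).
rewrite -!(rmorph_int f) legendre_euler// rmorphXn/=.
by rewrite chN1.
Qed.
End GaussSum.

Definition chi4 (n : nat) : int := if (n %% 4 == 1)%N then 1 else -1.
Definition chi8 (n : nat) : int :=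
  if (n %% 8 == 1)%N || (n %% 8 == 7)%N then 1 else -1.

Lemma odd_mod4 n : odd n -> (n %% 4 == 1)%N || (n %% 4 == 3)%N.
Proof. by move=> on; lia. Qed.

Lemma chi4M m n : odd m -> odd n -> chi4 (m * n) = chi4 m * chi4 n.
Proof.
move=> om on; rewrite /chi4 -modnMm.
by case/orP: (odd_mod4 m om) => /eqP->; case/orP: (odd_mod4 n on) => /eqP->.
Qed.

Lemma chi8M m n : odd m -> odd n -> chi8 (m * n) = chi8 m * chi8 n.
Proof.
have odd_mod8 k : odd k ->
  [|| (k %% 8 == 1)%N, (k %% 8 == 3)%N, (k %% 8 == 5)%N | (k %% 8 == 7)%N].
  by move=> ok; lia.
move=> om on; rewrite /chi8 -modnMm.
by case/or4P: (odd_mod8 m om) => /eqP->; case/or4P: (odd_mod8 n on) => /eqP->.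
Qed.

Lemma chi4E n : odd n -> chi4 n = (-1) ^+ (n.-1./2).
Proof.
move=> on; rewrite /chi4 -signr_odd.
have -> : odd n.-1./2 = ~~ (n %% 4 == 1)%N by lia.
by case: ifP.
Qed.

(* [z + z^-1] is a square root of 2 when [z] is a primitive 8th root of unity. *)
Lemma legendre2 (q : nat) : prime q -> odd q -> legendre 2 q = chi8 q.
Proof.
move=> pq oq.
have [K [f _]] := countable_algebraic_closure 'F_q.
have chK : q \in [pchar K] by rewrite (fmorph_pchar f) pchar_Fp.
have t2K : 2%:R != 0 :> K.
  by rewrite -(dvdn_pcharf chK); apply/negP => /dvdn_leq; have := odd_prime_gt2 oq pq; lia.
have [z z4] : exists z : K, z ^+ 4 = -1.
  have [|z /rootP] := closed_rootP ('X^4 - (-1)%:P : {poly K}) _.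
    by rewrite size_XnsubC.
  by rewrite !hornerE => /eqP; rewrite subr_eq0 => /eqP; exists z.
have z0 : z != 0.
  by apply: contra_eq_neq z4 => ->; rewrite expr0n /= eq_sym oppr_eq0 oner_eq0.
have z8 : z ^+ 8 = 1 by rewrite (exprM z 4 2) z4 sqrrN expr1n.
have zV : z^-1 = - z ^+ 3.
  by apply: (mulfI z0); rewrite mulfV// mulrN -exprS z4 opprK.
pose t := z - z ^+ 3.
have t2 : t ^+ 2 = 2%:R.
  rewrite /t (_ : _ ^+ 2 = z ^+ 2 * (1 + z ^+ 4) - 2%:R * z ^+ 4); last by ring.
  by rewrite z4; ring.
have t0 : t != 0 by rewrite -sqrf_eq0 t2.
have tq : t ^+ q = (chi8 q)%:~R * t.
  rewrite -(pFrobenius_autE chK) rmorphB rmorphXn/= pFrobenius_autE.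
  have -> : z ^+ q = z ^+ (q %% 8).
    by rewrite {1}(divn_eq q 8) exprD mulnC exprM z8 expr1n mul1r.
  have z5 : z ^+ 5 = - z by rewrite exprS z4 mulrN1.
  have z7 : z ^+ 7 = - z ^+ 3 by rewrite (exprD z 3 4) z4 mulrN1.
  have z9 : z ^+ 9 = z by rewrite exprS z8 mulr1.
  have z15 : z ^+ 15 = - z ^+ 3 by rewrite (exprD z 8 7) z8 mul1r.
  have z21 : z ^+ 21 = - z by rewrite (exprD z 16 5) (exprM z 8 2) z8 expr1n mul1r.
  have : [|| (q %% 8 == 1)%N, (q %% 8 == 3)%N, (q %% 8 == 5)%N | (q %% 8 == 7)%N] by lia.
  rewrite /chi8 => /or4P[] /eqP-> /=; rewrite -?exprM /t ?expr1 /=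
    ?(z5, z7, z9, z15, z21); by ring.
apply: (sign_inj _ _ _ t2K); rewrite ?legendre_sign//.
  by rewrite /chi8; case: ifP.
apply: (mulIf t0); rewrite -tq.
have qE : (q = (2 * q.-1./2).+1)%N by have := prime_gt0 pq; lia.
rewrite [X in _ = _ ^+ X]qE exprSr exprM t2; congr (_ * _).
by rewrite -!(rmorph_int f) legendre_euler// rmorphXn/= rmorph_int.
Qed.

Definition jacobi (a : int) (n : nat) : int :=
  \prod_(p <- primes n) kronecker_prime a p ^+ logn p n.

Lemma jacobi_bound (a : int) (n N : nat) : (0 < n)%N -> (n < N)%N ->
  jacobi a n = \prod_(p < N | prime p) kronecker_prime a p ^+ logn p n.
Proof.
move=> n0 nN; rewrite -(big_mkord prime (fun p => kronecker_prime a p ^+ logn p n)).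
rewrite (bigID (fun p => p %| n))%N/= [X in _ * X]big1 ?mulr1; last first.
  move=> p /andP[pp dv]; rewrite lognE pp n0 (negbTE dv)//.
rewrite -big_filter /jacobi; apply: perm_big; apply: uniq_perm.
- exact: primes_uniq.
- by rewrite filter_uniq// iota_uniq.
move=> p; rewrite mem_primes mem_filter mem_index_iota n0/=.
case: (boolP (prime p)) => //= pp; case: (boolP (p %| n)%N) => //= dv.
by rewrite (leq_ltn_trans (dvdn_leq n0 dv)).
Qed.

Lemma jacobiMr (a : int) (m n : nat) : (0 < m)%N -> (0 < n)%N ->
  jacobi a (m * n) = jacobi a m * jacobi a n.
Proof.
move=> m0 n0; have mn0 : (0 < m * n)%N by rewrite muln_gt0 m0.
have mle : (m <= m * n)%N by rewrite leq_pmulr.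
have nle : (n <= m * n)%N by rewrite leq_pmull.
rewrite !(@jacobi_bound _ _ (m * n).+1)// -big_split/=.
by apply: eq_bigr => p pp; rewrite lognM// exprD.
Qed.

Lemma jacobi1r (a : int) : jacobi a 1 = 1.
Proof. by rewrite /jacobi big_nil. Qed.

Lemma jacobi_prime (a : int) (p : nat) : prime p -> jacobi a p = kronecker_prime a p.
Proof. by move=> pp; rewrite /jacobi primes_prime// big_seq1 logn_prime// eqxx. Qed.

Lemma odd_prime_ind (P : nat -> Prop) : P 1%N ->
  (forall p, prime p -> odd p -> P p) ->
  (forall m n, odd m -> odd n -> P m -> P n -> P (m * n)%N) ->
  forall n, odd n -> P n.
Proof.
move=> P1 Pp PM n; have [k] := ubnP n; elim: k n => // k IH n nk on.
have [n1|n1] := leqP n 1; first by have -> : n = 1%N by lia.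
have pp := pdiv_prime n1; have dv := pdiv_dvd n.
have nE := divnK dv; move: on; rewrite -nE oddM => /andP[odq odp].
apply: PM => //; last exact: Pp.
have lt : (n %/ pdiv n < n)%N by rewrite ltn_Pdiv ?prime_gt1//; lia.
by apply: IH => //; lia.
Qed.

Lemma jacobi_ind (f : nat -> int) (a : int) : f 1%N = 1 ->
  (forall m n, odd m -> odd n -> f (m * n)%N = f m * f n) ->
  (forall p, prime p -> odd p -> legendre a p = f p) ->
  forall n, odd n -> jacobi a n = f n.
Proof.
move=> f1 fM fp; apply: odd_prime_ind.
- by rewrite jacobi1r f1.
- move=> p pp op; rewrite jacobi_prime// /kronecker_prime; case: eqP => [p2|_].
    by move: op; rewrite p2.
  exact: fp.
- by move=> m n om on em en; rewrite jacobiMr ?odd_gt0// em en fM.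
Qed.

Lemma jacobiM (a b : int) (n : nat) : odd n ->
  jacobi (a * b) n = jacobi a n * jacobi b n.
Proof.
apply: (@jacobi_ind (fun n => jacobi a n * jacobi b n)) => [|m k om ok|p pp op].
- by rewrite !jacobi1r mulr1.
- by rewrite !jacobiMr ?odd_gt0// mulrACA.
- have p2 : (p == 2%N) = false by apply/eqP => p2; move: op; rewrite p2.
  by rewrite !jacobi_prime// /kronecker_prime p2 legendreM.
Qed.

Lemma jacobi2 n : odd n -> jacobi 2 n = chi8 n.
Proof.
apply: jacobi_ind => // [m k om ok|p pp op]; first exact: chi8M.
exact: legendre2.
Qed.

Lemma jacobiN1 n : odd n -> jacobi (-1) n = chi4 n.
Proof.
apply: jacobi_ind => // [m k om ok|p pp op]; first exact: chi4M.
by rewrite legendreN1// chi4E.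
Qed.

Lemma jacobi_one n : odd n -> jacobi 1 n = 1.
Proof. by apply: (@jacobi_ind (fun=> 1)) => // p pp op; rewrite legendre1. Qed.

Lemma jacobi_odd_prime (p : nat) n : prime p -> odd p -> odd n ->
  jacobi p n = legendre n p * (if chi4 p == 1 then 1 else chi4 n).
Proof.
move=> pp op; apply: (@jacobi_ind (fun n : nat =>
   legendre n%:Z p * (if chi4 p == 1 then 1 else chi4 n))).
- by rewrite legendre1//; case: ifP.
- move=> m k om ok; rewrite PoszM legendreM//; case: ifP => _; first by rewrite !mulr1.
  by rewrite chi4M// mulrACA.
move=> q pq oq; have [->|npq] := eqVneq p q.
  by rewrite (_ : legendre q q = 0) ?mul0r//; apply/eqP; rewrite legendre_eq0.
rewrite [legendre q p](legendre_reciprocity p q)// legendreN1// -chi4E//.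
have q1 : legendre 1 q = 1 by rewrite legendre1.
rewrite /chi4; case: ifP => _ /=; first by rewrite mul1r mulr1.
rewrite legendreM// legendreN1// -chi4E// mulrAC -/(chi4 q).
by rewrite /chi4; case: ifP => _; rewrite ?mul1r// mulrN1 opprK mul1r.
Qed.

Definition opp_or_eq_mod (c m n : nat) :=
  (c %| m + n)%N || (m == n %[mod c])%N.

Lemma jacobi_periodic (c m n : nat) : (0 < c)%N -> odd m -> odd n ->
  opp_or_eq_mod (4 * c) m n -> jacobi c m = jacobi c n.
Proof.
move=> + om on; have [k] := ubnP c; elim: k c => // k IH c ck c0 mn.
have [c1|c1] := leqP c 1.
  by have -> : c = 1%N; [lia|rewrite !jacobi_one].
have pp := pdiv_prime c1; have := pdiv_dvd c; move: (pdiv c) pp => p pp dv.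
have cE := divnK dv.
have cp0 : (0 < c %/ p)%N by rewrite divn_gt0 ?(prime_gt0 pp)// (dvdn_leq c0 dv).
rewrite -cE PoszM !jacobiM//; congr (_ * _).
  have lt : (c %/ p < c)%N by rewrite ltn_Pdiv ?prime_gt1.
  apply: IH => //; first by lia.
  have d4 : (4 * (c %/ p) %| 4 * c)%N by rewrite dvdn_pmul2l// -{2}cE dvdn_mulr.
  move: mn => /orP[h|h]; apply/orP; [left|right]; first exact: dvdn_trans h.
  by apply/eqP; rewrite -(modn_dvdm m d4) (eqP h) modn_dvdm.
have d4 : (4 * p %| 4 * c)%N by rewrite dvdn_pmul2l.
have {}mn : opp_or_eq_mod (4 * p) m n.
  move: mn => /orP[h|h]; apply/orP; [left|right]; first exact: dvdn_trans h.
  by apply/eqP; rewrite -(modn_dvdm m d4) (eqP h) modn_dvdm.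
have [p2|p2] := eqVneq p 2%N.
  move: mn; rewrite p2 /opp_or_eq_mod !jacobi2// /chi8 => mn.
  by do 2 case: ifP => //; lia.
have op : odd p by case: (even_prime pp) p2 => [->|].
rewrite !jacobi_odd_prime//.
have d44 : (4 %| 4 * p)%N by rewrite dvdn_mulr.
have dp4 : (p %| 4 * p)%N by rewrite dvdn_mull.
move: mn => /orP[h|/eqP h]; last first.
  have -> : chi4 m = chi4 n.
    by rewrite /chi4 -(modn_dvdm m d44) h modn_dvdm.
  congr (_ * _); apply: legendre_mod => //.
  by rewrite -!pmulrn -(Fp_nat_mod pp m) -(modn_dvdm m dp4) h modn_dvdm// Fp_nat_mod.
have -> : legendre m p = legendre (-1) p * legendre n p.
  rewrite -legendreM// mulN1r; apply: legendre_mod => //.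
  rewrite rmorphN/= -!pmulrn; apply/eqP.
  rewrite -subr_eq0 opprK -natrD -(dvdn_pcharf (pchar_Fp pp)).
  exact: dvdn_trans h.
rewrite legendreN1// -chi4E//.
have h4 : (4 %| m + n)%N by exact: dvdn_trans h.
rewrite /chi4; case: ifP => _ /=; first by rewrite mul1r.
rewrite mulN1r mulNr -mulrN; congr (_ * _).
have -> : (n %% 4 == 1)%N = ~~ (m %% 4 == 1)%N by clear -om on h4; lia.
by case: ifP.
Qed.

Lemma kroneckerE (a : int) (n : nat) : (0 < n)%N -> kronecker a n = jacobi a n.
Proof. by case: n => // n _; rewrite /kronecker /= expr0 mul1r. Qed.

Lemma jacobi4 n : odd n -> jacobi 4 n = 1.
Proof.
move=> on; rewrite (_ : jacobi 4 n = jacobi (2 * 2) n)// jacobiM// jacobi2//.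
by rewrite /chi8; case: ifP.
Qed.

Lemma kronecker_pos_cell (c : nat) (e : int) : (0 < c)%N -> (e = 1 %[mod 4])%Z ->
  kronecker c e = kronecker (4 * c)%N `|(- e) %% (4 * c)%N|%Z%N.
Proof.
move=> c0 e1; have e0 : e <> 0 by move=> h; move: e1; rewrite h.
set r := `|_|%N.
have rE : r = ((- e) %% (4 * c)%N)%Z :> int by rewrite gez0_abs// modz_ge0//; lia.
have dvd : ((4 * c)%N %| r%:Z + e)%Z.
  by rewrite -[e]opprK -eqz_mod_dvd rE modz_mod.
have d4 : (4 %| r%:Z + e)%Z by apply: dvdz_trans dvd; rewrite PoszM dvdz_mulr.
have o_r : odd r by lia.
have oe : odd `|e|%N by lia.
have r0 : (0 < r)%N by rewrite odd_gt0.
rewrite (kroneckerE _ _ r0) PoszM jacobiM// jacobi4// mul1r.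
have -> : kronecker c e = jacobi c `|e|%N.
  by rewrite /kronecker /jacobi ifN ?andbF ?expr0 ?mul1r//; apply/eqP.
apply: jacobi_periodic => //; apply/orP.
have [e_ge|e_lt] := lerP 0 e.
  left; have : ((4 * c)%N%:Z %| (`|e| + r)%N%:Z)%Z by rewrite PoszD gez0_abs// addrC.
  by [].
right; have : (`|e|%N == r %[mod (4 * c)%N])%Z.
  by rewrite eq_sym eqz_mod_dvd ltz0_abs// opprK.
by rewrite !modz_nat eqz_nat.
Qed.

Lemma kronecker_neg_cell (c : nat) (e : int) : (0 < c)%N -> (e = 1 %[mod 4])%Z ->
  kronecker (- c%:Z) e = kronecker (4 * c)%N `|e %% (4 * c)%N|%Z%N.
Proof.
move=> c0 e1; have e0 : e <> 0 by move=> h; move: e1; rewrite h.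
set r := `|_|%N.
have rE : r = (e %% (4 * c)%N)%Z :> int by rewrite gez0_abs// modz_ge0//; lia.
have dvd : ((4 * c)%N %| r%:Z - e)%Z by rewrite -eqz_mod_dvd rE modz_mod.
have d4 : (4 %| r%:Z - e)%Z by apply: dvdz_trans dvd; rewrite PoszM dvdz_mulr.
have o_r : odd r by lia.
have oe : odd `|e|%N by lia.
have r0 : (0 < r)%N by rewrite odd_gt0.
rewrite (kroneckerE _ _ r0) PoszM jacobiM// jacobi4// mul1r.
have -> : kronecker (- c%:Z) e = jacobi c `|e|%N.
  rewrite /kronecker ifN; last by apply/eqP.
  rewrite -/(jacobi _ _) -[- c%:Z]mulN1r jacobiM// jacobiN1//.
  have -> : (-1 * c%:Z < 0) = true by lia.
  rewrite /chi4; have [e_ge|e_lt] := lerP 0 e.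
    by rewrite expr0 ifT ?mul1r//; lia.
  by rewrite ifF ?mulrA ?mulrNN ?mul1r//=; lia.
apply: jacobi_periodic => //; apply/orP.
have [e_ge|e_lt] := lerP 0 e.
  right; have : (`|e|%N == r %[mod (4 * c)%N])%Z.
    by rewrite eq_sym eqz_mod_dvd gez0_abs.
  by rewrite !modz_nat eqz_nat.
left; have : ((4 * c)%N%:Z %| (`|e| + r)%N%:Z)%Z by rewrite PoszD ltz0_abs// addrC.
by [].
Qed.

Lemma jacobi_sqr (a : int) (n : nat) : odd n ->
  jacobi a n ^+ 2 = (coprime `|a|%N n)%:R.
Proof.
move: n; apply: odd_prime_ind => [|p pp op|m k om ok em ek].
- by rewrite jacobi1r coprimen1.
- have p2 : (p == 2%N) = false by apply/eqP => p2; move: op; rewrite p2.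
  rewrite jacobi_prime// /kronecker_prime p2 coprime_sym prime_coprime//.
  have [dv|ndv] := boolP (p %| `|a|)%N; last exact: legendre_sqr.
  by have /eqP -> : legendre a p == 0 by rewrite legendre_eq0.
- by rewrite jacobiMr ?odd_gt0// exprMn em ek coprimeMr -mulnb natrM.
Qed.

(** * Absolutely summable families *)

Section RealSums.
Context {R : realType}.
Implicit Types (I J : choiceType).

Definition rsummable {I} (D : set I) (u : I -> R) :=
  summable D (fun i => (u i)%:E).

Definition esumR {I} (D : set I) (u : I -> R) : R := fine (\esum_(i in D) (u i)%:E).

Lemma rsummable_le {I} (D : set I) (u b : I -> R) :
  (forall i, D i -> `|u i| <= b i) -> rsummable D b -> rsummable D u.
Proof.
move=> ub; apply: le_lt_trans; apply: le_esum => i Di.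
by rewrite !abse_EFin lee_fin (le_trans (ub i Di))// ler_norm.
Qed.

Lemma rsummableD {I} (D : set I) (u v : I -> R) :
  rsummable D u -> rsummable D v -> rsummable D (fun i => u i + v i).
Proof. by move=> su sv; have := summableD su sv. Qed.

Lemma rsummableZ {I} (D : set I) (a : R) (u : I -> R) :
  rsummable D u -> rsummable D (fun i => a * u i).
Proof.
move=> su; have [n an] : exists n : nat, `|a| <= n%:R.
  by exists (Num.bound `|a|); rewrite ltW// archi_boundP.
suff sn : rsummable D (fun i => n%:R * `|u i|).
  by apply: rsummable_le sn => i _; rewrite normrM ler_wpM2r.
elim: n {an} => [|n IH].
  rewrite /rsummable /summable esum1//.
  by move=> i _; rewrite mul0r abse0.
have su' : rsummable D (fun i => `|u i|).
  by apply: le_lt_trans su; apply: le_esum => i _; rewrite !abse_EFin normr_id.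
have := rsummableD D _ _ IH su'.
by apply: rsummable_le => i _; rewrite -natr1 mulrDl mul1r ger0_norm ?addr_ge0 ?mulr_ge0.
Qed.

Lemma esum_fin {I} (D : set I) (u : I -> R) : rsummable D u ->
  (forall i, D i -> 0 <= u i) -> (esumR D u)%:E = \esum_(i in D) (u i)%:E.
Proof.
move=> su u0; rewrite fineK//; rewrite /rsummable summableE in su.
rewrite (@eq_esum _ _ _ _ (fun i => `|(u i)%:E|%E))// => i Di.
by rewrite abse_EFin ger0_norm// u0.
Qed.

Lemma esumRD {I} (D : set I) (u v : I -> R) : rsummable D u -> rsummable D v ->
  (forall i, D i -> 0 <= u i) -> (forall i, D i -> 0 <= v i) ->
  esumR D (fun i => u i + v i) = esumR D u + esumR D v.
Proof.
move=> su sv u0 v0; apply: EFin_inj; rewrite EFinD !esum_fin//.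
- by rewrite -esumD// => i Di; rewrite lee_fin ?u0 ?v0.
- exact: rsummableD.
- by move=> i Di; rewrite addr_ge0 ?u0 ?v0.
Qed.

Lemma rsum_posneg {I} (D : set I) (u p q : I -> R) :
  rsummable D p -> rsummable D q ->
  (forall i, D i -> 0 <= p i) -> (forall i, D i -> 0 <= q i) ->
  (forall i, D i -> u i = p i - q i) -> rsum D u = esumR D p - esumR D q.
Proof.
move=> sp sq p0 q0 upq.
have su : rsummable D u.
  apply: (rsummable_le D u (fun i => p i + q i)); last exact: rsummableD.
  by move=> i Di; rewrite upq// (le_trans (ler_normB _ _))// !ger0_norm ?p0 ?q0.
pose U (i : I) := (u i)%:E.
have P : \esum_(i in D) (Num.max (u i) 0)%:E = \esum_(i in D) U^\+%E i.
  by apply: eq_esum => i _; rewrite funeposE EFin_max.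
have N : \esum_(i in D) (Num.max (- u i) 0)%:E = \esum_(i in D) U^\-%E i.
  by apply: eq_esum => i _; rewrite funenegE EFin_max.
have eP : \esum_(i in D) U^\+%E i = \esum_(i in D) ((EFin \o p) \- (EFin \o q))^\+%E i.
  by apply: eq_esum => i Di; rewrite !funeposE /U upq.
have eN : \esum_(i in D) U^\-%E i = \esum_(i in D) ((EFin \o p) \- (EFin \o q))^\-%E i.
  by apply: eq_esum => i Di; rewrite !funenegE /U upq.
have fin (v : I -> R) : rsummable D v -> (forall i, D i -> 0 <= v i) ->
    \esum_(i in D) (v i)%:E \is a fin_num.
  by move=> sv v0; rewrite -esum_fin.
have sU : rsummable D (fun i => Num.max (u i) 0) /\ rsummable D (fun i => Num.max (- u i) 0).
  split; apply: (rsummable_le _ _ (fun i => `|u i|)).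
  - by move=> i _; rewrite ger0_norm ?le_max ?lexx ?orbT// ge_max ler_norm normr_ge0.
  - by apply: le_lt_trans su; apply: le_esum => i _; rewrite !abse_EFin normr_id.
  - move=> i _; rewrite ger0_norm ?le_max ?lexx ?orbT// ge_max normr_ge0 andbT.
    by rewrite -normrN ler_norm.
  - by apply: le_lt_trans su; apply: le_esum => i _; rewrite !abse_EFin normr_id.
rewrite /rsum /esumR; rewrite -[LHS]fineB ?fin//; last 4 first.
- exact: sU.1.
- by move=> i _; rewrite le_max lexx orbT.
- exact: sU.2.
- by move=> i _; rewrite le_max lexx orbT.
rewrite -fineB ?fin// P N eP eN.
by rewrite esumB// => i Di; rewrite lee_fin ?p0 ?q0.
Qed.

Lemma rsummable_norm {I} (D : set I) (u : I -> R) : rsummable D u ->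
  rsummable D (fun i => `|u i|).
Proof. by apply: le_lt_trans; apply: le_esum => i _; rewrite !abse_EFin normr_id. Qed.

Lemma rsummableN {I} (D : set I) (u : I -> R) : rsummable D u ->
  rsummable D (fun i => - u i).
Proof. by apply: le_lt_trans; apply: le_esum => i _; rewrite !abse_EFin normrN. Qed.

Lemma rsummable_pos {I} (D : set I) (u : I -> R) : rsummable D u ->
  rsummable D (fun i => Num.max (u i) 0).
Proof.
move=> /rsummable_norm; apply: rsummable_le => i _.
by rewrite ger0_norm ?le_max ?lexx ?orbT// ge_max ler_norm normr_ge0.
Qed.

Lemma rsummable_split {I} (D : set I) (u : I -> R) : rsummable D u ->
  exists p q : I -> R, [/\ rsummable D p, rsummable D q,
    (forall i, 0 <= p i), (forall i, 0 <= q i) & forall i, u i = p i - q i].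
Proof.
move=> su; exists (fun i => Num.max (u i) 0), (fun i => Num.max (- u i) 0).
split; [exact: rsummable_pos|exact/rsummable_pos/rsummableN|..] => i.
- by rewrite le_max lexx orbT.
- by rewrite le_max lexx orbT.
- by case: (lerP (u i) 0) => h; [rewrite max_l ?oppr_ge0// sub0r opprK|
    rewrite max_r ?oppr_le0 1?ltW// subr0].
Qed.

Lemma rsumD {I} (D : set I) (u v : I -> R) : rsummable D u -> rsummable D v ->
  rsum D (fun i => u i + v i) = rsum D u + rsum D v.
Proof.
move=> /rsummable_split[p [q [sp sq p0 q0 upq]]].
move=> /rsummable_split[p' [q' [sp' sq' p0' q0' upq']]].
rewrite (rsum_posneg _ u p q)// (rsum_posneg _ v p' q')//.
rewrite (rsum_posneg _ _ (fun i => p i + p' i) (fun i => q i + q' i)).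
- by rewrite !esumRD//; ring.
- exact: rsummableD.
- exact: rsummableD.
- by move=> i _; rewrite addr_ge0.
- by move=> i _; rewrite addr_ge0.
- by move=> i _; rewrite upq upq'; ring.
Qed.

Lemma rsumN {I} (D : set I) (u : I -> R) : rsummable D u ->
  rsum D (fun i => - u i) = - rsum D u.
Proof.
move=> /rsummable_split[p [q [sp sq p0 q0 upq]]].
rewrite (rsum_posneg _ u p q)// (rsum_posneg _ _ q p)// ?opprB// => i _.
by rewrite upq opprB.
Qed.

Lemma eq_rsum {I} (D : set I) (u v : I -> R) : (forall i, D i -> u i = v i) ->
  rsum D u = rsum D v.
Proof.
by move=> uv; rewrite /rsum; congr (fine _ - fine _); apply: eq_esum => i Di; rewrite uv.
Qed.

Lemma eq_rsummable {I} (D : set I) (u v : I -> R) : (forall i, D i -> u i = v i) ->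
  rsummable D u -> rsummable D v.
Proof.
by move=> uv; apply: le_lt_trans; apply: le_esum => i Di; rewrite uv.
Qed.

Lemma esumRZ_le {I} (D : set I) (b : R) (v : I -> R) : 0 <= b ->
  (\esum_(i in D) (b * v i)%:E <= b%:E * \esum_(i in D) (v i)%:E)%E.
Proof.
move=> b0; apply: ge_ereal_sup => _ [A [finA AD] <-].
rewrite fsbig_finite//= sumEFin -mulr_sumr EFinM lee_wpmul2l//.
by apply: ereal_sup_ubound; exists A => //; rewrite fsbig_finite//= sumEFin.
Qed.

Lemma esumRZ {I} (D : set I) (a : R) (u : I -> R) : 0 <= a ->
  esumR D (fun i => a * u i) = a * esumR D u.
Proof.
rewrite le_eqVlt => /predU1P[<-|a0].
  rewrite mul0r /esumR esum1// => i _; rewrite mul0r//.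
have -> : esumR D (fun i => a * u i) = fine (a%:E * \esum_(i in D) (u i)%:E)%E.
  congr fine; apply/eqP; rewrite eq_le (esumRZ_le _ _ _ (ltW a0))/=.
  have ai0 : 0 <= a^-1 by rewrite invr_ge0 ltW.
  have := esumRZ_le D a^-1 (fun i => a * u i) ai0.
  under eq_esum do rewrite mulrA mulVf ?gt_eqF// mul1r.
  move=> h; have -> : \esum_(i in D) (a * u i)%:E =
      (a%:E * (a^-1%:E * \esum_(i in D) (a * u i)%:E))%E.
    by rewrite muleA -EFinM mulfV ?gt_eqF// mul1e.
  by rewrite lee_wpmul2l// lee_fin ltW.
rewrite /esumR; case: esum => //= ; rewrite ?gt0_muley ?gt0_muleNy ?lte_fin ?mulr0//.
Qed.

Lemma rsumZ {I} (D : set I) (a : R) (u : I -> R) : rsummable D u ->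
  rsum D (fun i => a * u i) = a * rsum D u.
Proof.
have pos (b : R) (v : I -> R) : 0 <= b -> rsummable D v ->
    rsum D (fun i => b * v i) = b * rsum D v.
  move=> b0 /rsummable_split[p [q [sp sq p0 q0 upq]]].
  rewrite (rsum_posneg _ v p q)//.
  rewrite (rsum_posneg _ _ (fun i => b * p i) (fun i => b * q i)).
  - by rewrite !esumRZ// mulrBr.
  - exact: rsummableZ.
  - exact: rsummableZ.
  - by move=> i _; rewrite mulr_ge0.
  - by move=> i _; rewrite mulr_ge0.
  - by move=> i _; rewrite upq mulrBr.
move=> su; have [a0|a0] := leP 0 a; first exact: pos.
under eq_rsum do rewrite -mulrNN.
by rewrite pos ?oppr_ge0 1?ltW// ?rsumN ?mulrNN//; exact: rsummableN.
Qed.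

Lemma rsum_norm_le {I} (D : set I) (u b : I -> R) : rsummable D b ->
  (forall i, D i -> `|u i| <= b i) -> `|rsum D u| <= esumR D b.
Proof.
move=> sb ub; have b0 i : D i -> 0 <= b i by move=> Di; apply: le_trans (ub _ Di).
have su := rsummable_le _ _ _ ub sb.
have [p [q [sp sq p0 q0 upq]]] := rsummable_split _ _ su.
have mono (v w : I -> R) : rsummable D v -> rsummable D w -> (forall i, D i -> 0 <= v i) ->
    (forall i, D i -> v i <= w i) -> esumR D v <= esumR D w.
  move=> sv sw v0 vw; rewrite -lee_fin !esum_fin//; first exact: le_esum.
  by move=> i Di; apply: le_trans (vw _ Di); exact: v0.
have le1 (v : I -> R) : rsummable D v -> (forall i, D i -> v i <= b i) -> rsum D v <= esumR D b.
  move=> sv vb; have spv := rsummable_pos _ _ sv.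
  have snv := rsummable_pos _ _ (rsummableN _ _ sv).
  rewrite /rsum -[X in X - _]/(esumR D (fun i => Num.max (v i) 0)).
  rewrite -[X in _ - X]/(esumR D (fun i => Num.max (- v i) 0)).
  apply: (@le_trans _ _ (esumR D (fun i => Num.max (v i) 0))).
    rewrite gerBl fine_ge0// esum_ge0// => i _.
    by rewrite lee_fin le_max lexx orbT.
  apply: mono => // i Di; first by rewrite le_max lexx orbT.
  by rewrite ge_max vb// b0.
rewrite ler_norml lerNl -rsumN//; apply/andP; split; apply: le1 => //.
- exact: rsummableN.
- by move=> i Di; apply: le_trans (ub _ Di); rewrite -normrN ler_norm.
- by move=> i Di; apply: le_trans (ub _ Di); rewrite ler_norm.
Qed.

Lemma rsum_reindex {I J} (P : set I) (Q : set J) (e : I -> J) (u : J -> R) :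
  set_bij P Q e -> rsum Q u = rsum P (fun i => u (e i)).
Proof.
by move=> b; rewrite /rsum (reindex_esum _ _ _ _ b) [X in _ - fine X](reindex_esum _ _ _ _ b).
Qed.

Lemma rsummable_reindex {I J} (P : set I) (Q : set J) (e : I -> J) (u : J -> R) :
  set_bij P Q e -> rsummable Q u = rsummable P (fun i => u (e i)).
Proof. by move=> b; rewrite /rsummable /summable (reindex_esum _ _ _ _ b). Qed.

Lemma rsum_mkcond {I} (D E : set I) (u : I -> R) : D `<=` E ->
  (forall i, E i -> ~ D i -> u i = 0) -> rsum D u = rsum E u.
Proof.
move=> DE u0.
have key (g : R -> R) : g 0 = 0 ->
    \esum_(i in D) (g (u i))%:E = \esum_(i in E) (g (u i))%:E.
  move=> g0; rewrite [LHS]esum_mkcond [RHS]esum_mkcond; apply: eq_esum => i _.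
  case: ifPn => [|iD]; first by move=> /set_mem/DE/mem_set ->.
  case: ifPn => // /set_mem Ei; rewrite u0 ?g0// => Di.
  by move: iD; rewrite mem_set.
by rewrite /rsum (key (Num.max^~ 0)) ?(key (fun x => Num.max (- x) 0)) ?oppr0 ?maxxx.
Qed.

Lemma rsummable_mkcond {I} (D E : set I) (u : I -> R) : D `<=` E ->
  (forall i, E i -> ~ D i -> u i = 0) -> rsummable D u = rsummable E u.
Proof.
move=> DE u0; rewrite /rsummable /summable; congr (_ < _)%E.
rewrite [LHS]esum_mkcond [RHS]esum_mkcond; apply: eq_esum => i _.
case: ifPn => [|iD]; first by move=> /set_mem/DE/mem_set ->.
case: ifPn => // /set_mem Ei; rewrite u0 ?abse0// => Di.
by move: iD; rewrite mem_set.
Qed.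

Lemma rsummable_fiber {I J} (D : set I) (E : I -> set J) (u : I -> J -> R) i :
  rsummable (D `*`` E) (fun k => u k.1 k.2) -> D i -> rsummable (E i) (u i).
Proof.
move=> su Di; apply: le_lt_trans su.
rewrite -(@esum_esum _ _ _ D E (fun i j => `|(u i j)%:E|%E))//.
rewrite (@esumID _ _ [set i] D)//; last by move=> k _; rewrite esum_ge0.
rewrite setI1 mem_set// esum_set1; last by rewrite esum_ge0.
by rewrite leeDl// esum_ge0// => k _; rewrite esum_ge0.
Qed.

Lemma esumR_pair {I J} (D : set I) (E : I -> set J) (u : I -> J -> R) :
  rsummable (D `*`` E) (fun k => u k.1 k.2) -> (forall i j, 0 <= u i j) ->
  rsummable D (fun i => esumR (E i) (u i)) /\
  esumR D (fun i => esumR (E i) (u i)) = esumR (D `*`` E) (fun k => u k.1 k.2).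
Proof.
move=> su u0; have eqE : \esum_(i in D) (esumR (E i) (u i))%:E =
    \esum_(k in D `*`` E) (u k.1 k.2)%:E.
  rewrite -(@esum_esum _ _ _ D E (fun i j => (u i j)%:E)); last first.
    by move=> *; rewrite lee_fin.
  by apply: eq_esum => i Di; rewrite esum_fin//; exact: rsummable_fiber su Di.
split; last by rewrite /esumR -eqE.
have e0 i : 0 <= esumR (E i) (u i) by rewrite fine_ge0// esum_ge0// => j _; rewrite lee_fin.
rewrite /rsummable /summable.
under eq_esum do rewrite abse_EFin ger0_norm//.
rewrite eqE; apply: le_lt_trans su; apply: le_esum => i _.
by rewrite abse_EFin lee_fin ler_norm.
Qed.

Lemma rsum_pair {I J} (D : set I) (E : I -> set J) (u : I -> J -> R) :
  rsummable (D `*`` E) (fun k => u k.1 k.2) ->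
  rsummable D (fun i => rsum (E i) (u i)) /\
  rsum D (fun i => rsum (E i) (u i)) = rsum (D `*`` E) (fun k => u k.1 k.2).
Proof.
move=> su.
pose p i j := Num.max (u i j) 0; pose q i j := Num.max (- u i j) 0.
have p0 i j : 0 <= p i j by rewrite le_max lexx orbT.
have q0 i j : 0 <= q i j by rewrite le_max lexx orbT.
have upq i j : u i j = p i j - q i j.
  by rewrite /p /q; case: (lerP (u i j) 0) => h; [rewrite max_l ?oppr_ge0// sub0r opprK|
    rewrite max_r ?oppr_le0 1?ltW// subr0].
have sp : rsummable (D `*`` E) (fun k => p k.1 k.2) by exact: rsummable_pos.
have sq : rsummable (D `*`` E) (fun k => q k.1 k.2) by exact/rsummable_pos/rsummableN.
have [sP eP] := esumR_pair _ _ _ sp p0; have [sQ eQ] := esumR_pair _ _ _ sq q0.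
have rE i : D i -> rsum (E i) (u i) = esumR (E i) (p i) - esumR (E i) (q i).
  by move=> Di; apply: rsum_posneg => //; [exact: rsummable_fiber sp Di|
    exact: rsummable_fiber sq Di].
have e0 i (v : I -> J -> R) : (forall i j, 0 <= v i j) -> 0 <= esumR (E i) (v i).
  by move=> v0; rewrite fine_ge0// esum_ge0// => j _; rewrite lee_fin.
split.
  apply: (eq_rsummable D (fun i => esumR (E i) (p i) - esumR (E i) (q i))).
    by move=> i Di; rewrite rE.
  by apply: rsummableD => //; exact: rsummableN.
rewrite (rsum_posneg D _ (fun i => esumR (E i) (p i)) (fun i => esumR (E i) (q i)))//.
- by rewrite eP eQ; apply/esym; apply: rsum_posneg.
- by move=> i _; exact: e0.
- by move=> i _; exact: e0.
Qed.

Lemma rsum_ord (n : nat) (u : nat -> R) :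
  rsum [set i | (i < n)%N] u = \sum_(i < n) u i.
Proof.
have key (v : nat -> R) : (forall i, 0 <= v i) ->
    fine (\esum_(i in [set i | (i < n)%N]) (v i)%:E) = \sum_(i < n) v i.
  move=> v0; rewrite -(@nneseries_esum _ (fun i => (v i)%:E) (fun i => i < n)%N); last first.
    by move=> i _; rewrite lee_fin.
  rewrite (@nneseries_split_cond _ _ 0 n)// ?add0n; last by move=> i _; rewrite lee_fin.
  rewrite eseries0 ?adde0; last by move=> i; rewrite leqNgt => /negbTE ->.
  by rewrite sumEFin/= big_mkcond big_mkord; apply: eq_bigr => i _; rewrite ltn_ord.
rewrite /rsum !key; last 2 first.
- by move=> i; rewrite le_max lexx orbT.
- by move=> i; rewrite le_max lexx orbT.
rewrite -sumrB; apply: eq_bigr => i _.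
by case: (lerP (u i) 0) => h; [rewrite max_l ?oppr_ge0// sub0r opprK|
  rewrite max_r ?oppr_le0 1?ltW// subr0].
Qed.
End RealSums.

Section Exchange.
Context {R : realType}.

Lemma esum_pickle (I : countType) (D : set I) (a : I -> \bar R) :
  (forall i, D i -> (0 <= a i)%E) ->
  (\esum_(i in D) a i = \sum_(n <oo)
     oapp (fun i => if i \in D then a i else 0) 0 (pickle_inv n))%E.
Proof.
move=> a0.
pose F n := (oapp (fun i : I => if i \in D then a i else 0) 0 (pickle_inv n))%E.
rewrite -/F.
have F0 n : (0 <= F n)%E.
  by rewrite /F; case: (@pickle_inv I n) => //= i; case: ifP => // /set_mem/a0.
rewrite nneseries_esumT// esum_mkcond.
have b : set_bij [set: I] (range (@pickle I)) (@pickle I).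
  split=> [i _|i j _ _|n [i _ <-]]; first by exists i.
  - exact: (pcan_inj (@pickleK I)).
  - by exists i.
transitivity (\esum_(n in range (@pickle I)) F n)%E.
  rewrite (reindex_esum _ _ _ _ b); apply: eq_esum => i _.
  by rewrite /F pickleK_inv.
rewrite esum_mkcond; apply: eq_esum => n _; case: ifPn => // nr.
rewrite /F; case E: (pickle_inv n) => [i|]//=; case/negP: nr; apply/mem_set.
by exists i => //; have := @pickle_invK I n; rewrite [pickle_inv _]E.
Qed.

Context d (T : measurableType d) (mu : {measure set T -> \bar R}).

Lemma measurable_esum (I : countType) (D : set I) (A : set T) (mA : measurable A)
    (p : I -> T -> \bar R) :
  (forall i, D i -> measurable_fun A (p i)) ->
  (forall i x, D i -> A x -> (0 <= p i x)%E) ->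
  measurable_fun A (fun x => \esum_(i in D) p i x)%E /\
  (\int[mu]_(x in A) (\esum_(i in D) p i x) = \esum_(i in D) \int[mu]_(x in A) p i x)%E.
Proof.
move=> mp p0.
pose F n x := (oapp (fun i => if i \in D then p i x else 0) 0 (pickle_inv n))%E.
have eF x : A x -> (\esum_(i in D) p i x = \sum_(n <oo) F n x)%E.
  by move=> Ax; rewrite esum_pickle// => i Di; exact: p0.
have mF n : measurable_fun A (F n).
  rewrite /F; case: (@pickle_inv I n) => [i|]/=; last exact: measurable_cst.
  by have [/set_mem/mp//|_] := boolP (i \in D); exact: measurable_cst.
have F0 n x : A x -> (0 <= F n x)%E.
  by move=> Ax; rewrite /F; case: (@pickle_inv I n) => //= i; case: ifP => // /set_mem Di;
    exact: p0.
split.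
  apply: (eq_measurable_fun (fun x => \sum_(n <oo) F n x)%E).
    by move=> x /set_mem Ax; rewrite eF.
  by apply: (@ge0_emeasurable_sum _ _ _ _ _ xpredT) => // n x Ax _; exact: F0.
under eq_integral do [rewrite eF; last exact: set_mem].
rewrite integral_nneseries// esum_pickle; last first.
  by move=> i Di; apply: integral_ge0 => x Ax; exact: p0.
apply: eq_eseriesr => n _; rewrite /F; case: (@pickle_inv I n) => [i|]/=.
  by case: ifP => // _; rewrite integral0.
by rewrite integral0.
Qed.

Lemma bounded_integrable (A : set T) (f : T -> R) (b : R) : measurable A ->
  (mu A < +oo)%E -> measurable_fun A f -> (forall x, A x -> `|f x| <= b) ->
  mu.-integrable A (EFin \o f).
Proof.
move=> mA Afin mf fb; apply: measurable_bounded_integrable => //.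
by exists b; split=> [|M bM x Ax]; rewrite ?num_real//; apply: le_trans (fb x Ax) (ltW bM).
Qed.

Lemma Rintegral_norm_le (A : set T) (f : T -> R) (b : R) : measurable A ->
  (mu A < +oo)%E -> measurable_fun A f -> (forall x, A x -> `|f x| <= b) ->
  `|\int[mu]_(x in A) f x| <= b * fine (mu A).
Proof.
move=> mA Afin mf fb; have fi := bounded_integrable A f b mA Afin mf fb.
apply: le_trans (le_normr_Rintegral _ _) _ => //.
rewrite -Rintegral_cst//; apply: le_Rintegral => //.
- by have := integrable_norm fi.
- apply: (bounded_integrable _ _ `|b|) => //; exact: measurable_cst.
Qed.

Lemma Rintegral_rsum (I : countType) (D : set I) (A : set T) (u : I -> T -> R)
    (b : I -> R) : measurable A -> (mu A < +oo)%E ->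
  (forall i, D i -> measurable_fun A (u i)) ->
  (forall i x, D i -> A x -> `|u i x| <= b i) -> rsummable D b ->
  [/\ measurable_fun A (fun x => rsum D (u ^~ x)),
    (forall x, A x -> `|rsum D (u ^~ x)| <= esumR D b) &
    \int[mu]_(x in A) rsum D (u ^~ x) = rsum D (fun i => \int[mu]_(x in A) u i x)].
Proof.
move=> mA Afin mu_ ub sb.
pose p i x := Num.max (u i x) 0; pose q i x := Num.max (- u i x) 0.
have p0 i x : 0 <= p i x by rewrite le_max lexx orbT.
have q0 i x : 0 <= q i x by rewrite le_max lexx orbT.
have upq i x : u i x = p i x - q i x.
  by rewrite /p /q; case: (lerP (u i x) 0) => h; [rewrite max_l ?oppr_ge0// sub0r opprK|
    rewrite max_r ?oppr_le0 1?ltW// subr0].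
have pb i x : D i -> A x -> `|p i x| <= b i.
  move=> Di Ax; rewrite ger0_norm// ge_max (le_trans (ler_norm _) (ub _ _ Di Ax))/=.
  exact: le_trans (ub _ _ Di Ax).
have qb i x : D i -> A x -> `|q i x| <= b i.
  move=> Di Ax; rewrite ger0_norm// ge_max (le_trans _ (ub _ _ Di Ax))/=.
    exact: le_trans (ub _ _ Di Ax).
  by rewrite -normrN ler_norm.
have mp i : D i -> measurable_fun A (p i).
  by move=> Di; apply: measurable_maxr => //; exact: mu_.
have mq i : D i -> measurable_fun A (q i).
  by move=> Di; apply: measurable_maxr => //; apply: measurableT_comp => //; exact: mu_.
have main (v : I -> T -> R) : (forall i x, 0 <= v i x) ->
    (forall i x, D i -> A x -> `|v i x| <= b i) -> (forall i, D i -> measurable_fun A (v i)) ->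
    [/\ measurable_fun A (fun x => esumR D (v ^~ x)),
       rsummable D (fun i => \int[mu]_(x in A) v i x),
       (forall x, A x -> `|esumR D (v ^~ x)| <= esumR D b) &
       \int[mu]_(x in A) esumR D (v ^~ x) = esumR D (fun i => \int[mu]_(x in A) v i x)].
  move=> v0 vb mv.
  have sv x : A x -> rsummable D (v ^~ x).
    by move=> Ax; apply: rsummable_le sb => i Di; exact: vb.
  have [mE iE] := measurable_esum I D A mA (fun i x => (v i x)%:E)
    (fun i Di => (measurable_EFinP _ _).2 (mv i Di))
    (fun i x _ _ => v0 i x).
  have eE x : A x -> (esumR D (v ^~ x))%:E = \esum_(i in D) (v i x)%:E.
    by move=> Ax; apply: esum_fin => //; exact: sv.
  have fi i : D i -> mu.-integrable A (EFin \o v i).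
    by move=> Di; apply: bounded_integrable (vb i ^~ Di) => //; exact: mv.
  have Eb x : A x -> `|esumR D (v ^~ x)| <= esumR D b.
    move=> Ax; rewrite ger0_norm ?fine_ge0 ?esum_ge0//; last by move=> *; rewrite lee_fin.
    rewrite -lee_fin eE// esum_fin//; last first.
      by move=> i Di; apply: le_trans (vb i x Di Ax).
    by apply: le_esum => i Di; rewrite lee_fin (le_trans _ (vb i x Di Ax))// ler_norm.
  split=> //.
  - apply/measurable_EFinP; apply: eq_measurable_fun mE => x /set_mem Ax /=.
    by rewrite eE.
  - apply: (rsummable_le _ _ (fun i => fine (mu A) * b i)); last exact: rsummableZ.
    move=> i Di; rewrite mulrC; apply: Rintegral_norm_le => //; first exact: mv.
    by move=> x Ax; exact: vb.
  - rewrite /Rintegral /esumR; congr fine.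
    under eq_integral do [rewrite eE; last exact: set_mem].
    rewrite iE; apply: eq_esum => i Di; rewrite fineK//.
    by apply: integrable_fin_num => //; exact: fi.
have [mP sP bP iP] := main p p0 pb mp; have [mQ sQ bQ iQ] := main q q0 qb mq.
have rE x : A x -> rsum D (u ^~ x) = esumR D (p ^~ x) - esumR D (q ^~ x).
  move=> Ax; apply: rsum_posneg => //.
  - by apply: rsummable_le sb => i Di; exact: pb.
  - by apply: rsummable_le sb => i Di; exact: qb.
split.
- apply: (eq_measurable_fun (fun x => esumR D (p ^~ x) - esumR D (q ^~ x))).
    by move=> x /set_mem Ax; rewrite rE.
  exact: measurable_funB.
- move=> x Ax; apply: rsum_norm_le => // i Di; exact: ub.
rewrite (@eq_Rintegral _ _ _ _ _ (fun x => esumR D (p ^~ x) - esumR D (q ^~ x))); last first.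
  by move=> x /set_mem Ax; rewrite rE.
rewrite RintegralB//; last 2 first.
- exact: (bounded_integrable _ _ (esumR D b)).
- exact: (bounded_integrable _ _ (esumR D b)).
rewrite iP iQ; apply/esym; apply: rsum_posneg => //.
- by move=> i Di; apply: Rintegral_ge0 => x _.
- by move=> i Di; apply: Rintegral_ge0 => x _.
move=> i Di; rewrite -RintegralB//.
- by apply: eq_Rintegral => x _; rewrite upq.
- by apply: bounded_integrable (pb i ^~ Di) => //; exact: mp.
- by apply: bounded_integrable (qb i ^~ Di) => //; exact: mq.
Qed.
End Exchange.

Section ComplexSums.
Context {R : realType}.
Local Notation C := R[i].
Local Notation Re := (@complex.Re R).
Local Notation Im := (@complex.Im R).

Lemma ReD (x y : C) : Re (x + y) = Re x + Re y. Proof. by case: x; case: y. Qed.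

Lemma ImD (x y : C) : Im (x + y) = Im x + Im y. Proof. by case: x; case: y. Qed.

Lemma ReM (x y : C) : Re (x * y) = Re x * Re y - Im x * Im y.
Proof. by case: x; case: y. Qed.

Lemma ImM (x y : C) : Im (x * y) = Re x * Im y + Im x * Re y.
Proof. by case: x; case: y. Qed.

Lemma complex_eq (x y : C) : Re x = Re y -> Im x = Im y -> x = y.
Proof. by case: x y => [a b] [c d] /= -> ->. Qed.

Lemma Re_normc (z : C) : `|Re z| <= normc z.
Proof.
case: z => a b /=; rewrite -sqrtr_sqr ler_sqrt ?addr_ge0 ?sqr_ge0//.
by rewrite lerDl sqr_ge0.
Qed.

Lemma Im_normc (z : C) : `|Im z| <= normc z.
Proof.
case: z => a b /=; rewrite -sqrtr_sqr ler_sqrt ?addr_ge0 ?sqr_ge0//.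
by rewrite lerDr sqr_ge0.
Qed.

Lemma normc_ge0 (z : C) : 0 <= normc z.
Proof. by case: z => a b; exact: sqrtr_ge0. Qed.

Lemma normc_le (z : C) : normc z <= `|Re z| + `|Im z|.
Proof.
case: z => a b /=; rewrite -[X in _ <= X]ger0_norm ?addr_ge0// -[X in _ <= X]sqrtr_sqr.
rewrite ler_sqrt ?sqr_ge0// sqrrD !real_normK ?num_real// addrAC lerDl.
by rewrite mulrn_wge0 ?mulr_ge0.
Qed.

Section OneIndex.
Context {I : choiceType}.
Implicit Types (D : set I) (u v : I -> C).

Definition csumm D u := rsummable D (Re \o u) /\ rsummable D (Im \o u).

Lemma csumm_le D u (b : I -> R) : (forall i, D i -> normc (u i) <= b i) ->
  rsummable D b -> csumm D u.
Proof.
by move=> ub sb; split; apply: rsummable_le sb => i Di /=;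
  apply: le_trans (ub _ Di); [exact: Re_normc|exact: Im_normc].
Qed.

Lemma csumm_csummable D u : csumm D u -> csummable D u.
Proof.
move=> [su sv]; have := rsummableD D _ _ (rsummable_norm _ _ su) (rsummable_norm _ _ sv).
apply: (rsummable_le D (fun i => normc (u i))) => i Di.
by rewrite ger0_norm ?normc_ge0// normc_le.
Qed.

Lemma eq_csum D u v : (forall i, D i -> u i = v i) -> csum D u = csum D v.
Proof.
by move=> uv; rewrite /csum; congr Complex; apply: eq_rsum => i Di; rewrite uv.
Qed.

Lemma eq_csumm D u v : (forall i, D i -> u i = v i) -> csumm D u -> csumm D v.
Proof.
by move=> uv [su sv]; split; [move: su|move: sv];
  apply: eq_rsummable => i Di /=; rewrite uv.
Qed.

Lemma csumD D u v : csumm D u -> csumm D v ->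
  csum D (fun i => u i + v i) = csum D u + csum D v.
Proof.
move=> [su su'] [sv sv']; apply: complex_eq; rewrite ?ReD ?ImD/= -rsumD//.
  by apply: eq_rsum => i _; rewrite ReD.
by apply: eq_rsum => i _; rewrite ImD.
Qed.

Lemma csummZ D (c : C) u : csumm D u -> csumm D (fun i => c * u i).
Proof.
move=> [su su']; split.
  apply: eq_rsummable (rsummableD _ _ _ (rsummableZ _ (Re c) _ su)
    (rsummableZ _ (- Im c) _ su')) => i _ /=.
  by rewrite ReM mulNr.
apply: eq_rsummable (rsummableD _ _ _ (rsummableZ _ (Re c) _ su')
    (rsummableZ _ (Im c) _ su)) => i _ /=.
by rewrite ImM.
Qed.

Lemma csumZ D (c : C) u : csumm D u -> csum D (fun i => c * u i) = c * csum D u.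
Proof.
move=> [su su']; apply: complex_eq; rewrite ?ReM ?ImM/= -!rsumZ//.
  rewrite -rsumN; last exact: rsummableZ.
  rewrite -rsumD; [|exact: rsummableZ|apply: rsummableN; exact: rsummableZ].
  by apply: eq_rsum => i _; rewrite ReM.
rewrite -rsumD; [|exact: rsummableZ|exact: rsummableZ].
by apply: eq_rsum => i _; rewrite ImM.
Qed.

Lemma csumZr D (c : C) u : csumm D u -> csum D (fun i => u i * c) = csum D u * c.
Proof.
by move=> su; rewrite mulrC -csumZ//; apply: eq_csum => i _; rewrite mulrC.
Qed.

Lemma csum_mkcond D E u : D `<=` E -> (forall i, E i -> ~ D i -> u i = 0) ->
  csum D u = csum E u.
Proof.
by move=> DE u0; rewrite /csum; congr Complex;
  apply: rsum_mkcond => // i Ei nD; rewrite u0.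
Qed.

Lemma csumm_mkcond D E u : D `<=` E -> (forall i, E i -> ~ D i -> u i = 0) ->
  csumm E u -> csumm D u.
Proof.
move=> DE u0 [su sv]; split.
  by rewrite (rsummable_mkcond D E)// => i Ei nD /=; rewrite u0.
by rewrite (rsummable_mkcond D E)// => i Ei nD /=; rewrite u0.
Qed.

Lemma csum_normc_le D u (b : I -> R) : (forall i, D i -> normc (u i) <= b i) ->
  rsummable D b -> normc (csum D u) <= 2 * esumR D b.
Proof.
move=> ub sb; apply: le_trans (normc_le _) _.
rewrite mulr_natl mulr2n lerD//= rsum_norm_le// => i Di;
  apply: le_trans (ub _ Di); [exact: Re_normc|exact: Im_normc].
Qed.
End OneIndex.

Lemma csum_reindex {I J : choiceType} (P : set I) (Q : set J) (e : I -> J) (u : J -> C) :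
  set_bij P Q e -> csum Q u = csum P (fun i => u (e i)).
Proof. by move=> b; rewrite /csum; congr Complex; exact: rsum_reindex. Qed.

Lemma csumm_reindex {I J : choiceType} (P : set I) (Q : set J) (e : I -> J) (u : J -> C) :
  set_bij P Q e -> csumm P (fun i => u (e i)) -> csumm Q u.
Proof. by move=> b [s t]; split; rewrite (rsummable_reindex P Q e). Qed.

Lemma csumm_reindexV (I J : choiceType) (P : set I) (Q : set J) (e : I -> J) (u : J -> C) :
  set_bij P Q e -> csumm Q u -> csumm P (fun i => u (e i)).
Proof.
by move=> be [sR sI]; split; [move: sR|move: sI]; rewrite (rsummable_reindex _ _ _ _ be).
Qed.

Lemma csum_pair {I J : choiceType} (D : set I) (E : I -> set J) (u : I -> J -> C) :
  csumm (D `*`` E) (fun k => u k.1 k.2) ->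
  [/\ csumm D (fun i => csum (E i) (u i)),
    (forall i, D i -> csumm (E i) (u i)) &
    csum D (fun i => csum (E i) (u i)) = csum (D `*`` E) (fun k => u k.1 k.2)].
Proof.
move=> [su sv].
have [sU eU] := rsum_pair D E (fun i j => Re (u i j)) su.
have [sV eV] := rsum_pair D E (fun i j => Im (u i j)) sv.
split => //; last by rewrite /csum; congr Complex.
move=> i Di; split; first exact: (rsummable_fiber _ _ (fun i j => Re (u i j)) _ su Di).
exact: (rsummable_fiber _ _ (fun i j => Im (u i j)) _ sv Di).
Qed.

Lemma csum_ord (n : nat) (u : nat -> C) :
  csum [set i | (i < n)%N] u = \sum_(i < n) u i.
Proof.
rewrite /csum !rsum_ord.
have -> : \sum_(i < n) Re (u i) = Re (\sum_(i < n) u i).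
  by elim/big_rec2: _ => // i x y _ ->; rewrite ReD.
have -> : \sum_(i < n) Im (u i) = Im (\sum_(i < n) u i).
  by elim/big_rec2: _ => // i x y _ ->; rewrite ImD.
by case: (\sum_(i < n) u i).
Qed.

Section Integrals.
Context d (T : measurableType d) (mu : {measure set T -> \bar R}).
Implicit Types (A : set T) (f g : T -> C).

Definition cintegrable A f := mu.-integrable A (EFin \o (Re \o f)) /\
  mu.-integrable A (EFin \o (Im \o f)).

Lemma eq_cintegral A f g : (forall x, A x -> f x = g x) ->
  cintegral mu A f = cintegral mu A g.
Proof.
by move=> fg; rewrite /cintegral; congr Complex;
  apply: eq_Rintegral => x /set_mem Ax; rewrite fg.
Qed.

Lemma cintegralZ A (c : C) f : measurable A -> cintegrable A f ->
  cintegral mu A (fun x => c * f x) = c * cintegral mu A f.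
Proof.
move=> mA [fi fi']; apply: complex_eq; rewrite ?ReM ?ImM/= -!RintegralZl//.
  rewrite -RintegralB//.
  - by apply: eq_Rintegral => x _; rewrite ReM.
  - by have := integrableZl mA (Re c) fi.
  - by have := integrableZl mA (Im c) fi'.
rewrite -RintegralD//.
- by apply: eq_Rintegral => x _; rewrite ImM.
- by have := integrableZl mA (Re c) fi'.
- by have := integrableZl mA (Im c) fi.
Qed.

Lemma cintegral_csum (I : countType) (D : set I) A (u : I -> T -> C) (b : I -> R) :
  measurable A -> (mu A < +oo)%E ->
  (forall i, D i -> measurable_fun A (Re \o u i) /\ measurable_fun A (Im \o u i)) ->
  (forall i x, D i -> A x -> normc (u i x) <= b i) -> rsummable D b ->
  [/\ cintegrable A (fun x => csum D (u ^~ x)),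
    csumm D (fun i => cintegral mu A (u i)) &
    cintegral mu A (fun x => csum D (u ^~ x)) = csum D (fun i => cintegral mu A (u i))].
Proof.
move=> mA Afin mu_ ub sb.
have [||mR bR iR] := @Rintegral_rsum _ _ _ mu I D A (fun i => Re \o u i) b mA Afin _ _ sb.
- by move=> i Di; exact: (mu_ i Di).1.
- by move=> i x Di Ax; apply: le_trans (ub i x Di Ax); exact: Re_normc.
have [||mI bI iI] := @Rintegral_rsum _ _ _ mu I D A (fun i => Im \o u i) b mA Afin _ _ sb.
- by move=> i Di; exact: (mu_ i Di).2.
- by move=> i x Di Ax; apply: le_trans (ub i x Di Ax); exact: Im_normc.
split.
- split; apply: bounded_integrable => //; [exact: bR|exact: bI].
- have sb' := rsummableZ D (fine (mu A)) b sb.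
  split; apply: rsummable_le sb' => i Di; rewrite mulrC;
    apply: Rintegral_norm_le => //; try by have [] := mu_ i Di.
    by move=> x Ax; apply: le_trans (ub i x Di Ax); exact: Re_normc.
  by move=> x Ax; apply: le_trans (ub i x Di Ax); exact: Im_normc.
- by rewrite /cintegral /csum; congr Complex.
Qed.
End Integrals.
End ComplexSums.
Arguments cintegrable {R d T} mu A f.

(** * Integrals over the line and the unit cube *)

Section ProductIntegral.
Context {R : realType} d1 d2 (T1 : measurableType d1) (T2 : measurableType d2).
Variables (m1 : {sigma_finite_measure set T1 -> \bar R})
  (m2 : {sigma_finite_measure set T2 -> \bar R}).

Lemma integral_prodM (a : T1 -> R) (b : T2 -> R) :
  m1.-integrable setT (EFin \o a) -> m2.-integrable setT (EFin \o b) ->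
  (m1 \x m2)%E.-integrable setT (EFin \o (fun p => a p.1 * b p.2)) /\
  \int[(m1 \x m2)%E]_p (a p.1 * b p.2) = (\int[m1]_x a x) * (\int[m2]_y b y).
Proof.
move=> ia ib.
have mab : measurable_fun setT (fun p : T1 * T2 => (a p.1 * b p.2)%:E).
  apply/measurable_EFinP; apply: measurable_funM.
    by apply: measurableT_comp => //; apply/measurable_EFinP; case/integrableP : ia.
  by apply: measurableT_comp => //; apply/measurable_EFinP; case/integrableP : ib.
have fin (T : measurableType _) (m : {measure set T -> \bar R}) (c : T -> R) :
  m.-integrable setT (EFin \o c) -> (\int[m]_x (c x)%:E)%E = (\int[m]_x c x)%:E.
  move=> ic; rewrite fineK//; exact: integrable_fin_num ic.
have iab : (m1 \x m2)%E.-integrable setT (EFin \o (fun p => a p.1 * b p.2)).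
  apply/(integrable12ltyP m1 m2 mab) => /=.
  have mna : measurable_fun setT (fun x => `|a x|%:E).
    apply/measurable_EFinP; apply: measurableT_comp => //.
    by apply/measurable_EFinP; case/integrableP : ia.
  have mnb : measurable_fun setT (fun x => `|b x|%:E).
    apply/measurable_EFinP; apply: measurableT_comp => //.
    by apply/measurable_EFinP; case/integrableP : ib.
  have e1 x : (\int[m2]_y `|a x * b y|%:E = `|a x|%:E * \int[m2]_y `|b y|%:E)%E.
    rewrite -ge0_integralZl//.
    by apply: eq_integral => y _; rewrite normrM EFinM.
  under eq_integral do rewrite e1.
  rewrite ge0_integralZr//; last exact: integral_ge0.
  apply: lte_mul_pinfty; first exact: integral_ge0.
    by have [_] := integrableP _ _ _ ia; rewrite ge0_fin_numE// integral_ge0.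
  by have [_] := integrableP _ _ _ ib.
split=> //.
rewrite {1}/Rintegral -(integral12_prod_meas1 iab) /fubini_F/=.
have e2 x : (\int[m2]_y (a x * b y)%:E = (a x)%:E * (\int[m2]_y b y)%:E)%E.
  rewrite -fin// -integralZl//.
under eq_integral do rewrite e2.
under eq_integral do rewrite muleC.
by rewrite integralZl// fin// mulrC.
Qed.
End ProductIntegral.

Section Lebesgue.
Context {R : realType}.
Local Notation mu := (@lebesgue_measure R).
Definition lebesgue2 : set (measurableTypeR R * measurableTypeR R)%type -> \bar R :=
  (mu \x mu)%E.
HB.instance Definition _ := Measure.on lebesgue2.

Let lebesgue2_sigma_finite : sigma_finite setT lebesgue2.
Proof.
have /sigma_finiteP[F [TF ndF Foo]] := @sigma_finiteT _ _ _ mu.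
exists (fun n => F n `*` F n).
  rewrite -setXTT TF predeqE => -[x y]; split.
    move=> [/= [n _ Fnx] [k _ Gky]]; exists (maxn n k) => //; split.
    - by move: x Fnx; exact/subsetPset/ndF/leq_maxl.
    - by move: y Gky; exact/subsetPset/ndF/leq_maxr.
  by move=> [n _ []/= ? ?]; split; exists n.
move=> k; have [? ?] := Foo k; split; first exact: measurableX.
by rewrite /lebesgue2/= product_measure1E// lte_mul_pinfty// ge0_fin_numE.
Qed.
HB.instance Definition _ := Measure_isSigmaFinite.Build _ _ _ lebesgue2
  lebesgue2_sigma_finite.

Lemma continuous_measurable_on (A : set R) (g : R -> R) : measurable A ->
  continuous g -> measurable_fun A g.
Proof. by move=> mA cg; apply: measurable_funTS; exact: continuous_measurable_fun. Qed.

Lemma integral_reflect (g : R -> R) (c : R) : continuous g ->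
  (\int[mu]_(x in [set` `[0, 1[%R]) (g (c - x))%:E =
   \int[mu]_(x in [set` `]c - 1, c]%R]) (g x)%:E)%E.
Proof.
move=> cg; pose F x := c - x : R.
have DF : derive1 (F : R -> R^o) = cst (-1).
  by apply/funext => x; rewrite derive1E /F deriveB// derive_cst derive_id sub0r.
have cF : continuous F by move=> x; apply: cvgB; [exact: cvg_cst|exact: cvg_id].
rewrite integral_itv_bndo_bndc; last first.
  apply/measurable_EFinP; apply: continuous_measurable_on => //.
  by move=> x; apply: continuous_comp; [exact: cF|exact: cg].
rewrite integral_itv_obnd_cbnd; last first.
  by apply/measurable_EFinP; exact: continuous_measurable_on.
have := @integration_by_substitution_decreasing R F g 0 1 ler01.
have -> : F 0 = c by rewrite /F subr0.
have -> : F 1 = c - 1 by [].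
move=> ->.
- apply: eq_integral => x _ /=; rewrite DF; congr EFin.
  by rewrite /= !fctE/= opprK mulr1.
- by move=> x y _ _; rewrite /F ltrD2l ltrN2.
- by rewrite DF => x _; exact: cvg_cst.
- by rewrite DF; exact: is_cvg_cst.
- by rewrite DF; exact: is_cvg_cst.
- split.
  + by move=> x _; apply: derivableB => //.
  + apply: cvg_at_right_filter; exact: cF.
  + apply: cvg_at_left_filter; exact: cF.
- exact: continuous_subspaceT.
Qed.

Lemma unit_interval_cover (x t : R) :
  exists k : int, forall k' : int, (x \in `]t + k'%:~R - 1, t + k'%:~R]) = (k' == k).
Proof.
exists (Num.ceil (x - t)) => k'; rewrite in_itv/= -lerBlDl.
rewrite (_ : (t + k'%:~R - 1 < x) = ((k' - 1)%:~R < x - t)); last first.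
  by rewrite rmorphB/= ltrBrDl addrA.
by rewrite eq_sym -ceil_eq.
Qed.

Lemma integral_unit_intervals (p : R -> R) (t : R) : continuous p ->
  (forall x, 0 <= p x) ->
  (\int[mu]_x (p x)%:E = \esum_(k in [set: int])
     \int[mu]_(x in [set` `[0, 1[%R]) (p (t + k%:~R - x))%:E)%E.
Proof.
move=> cp p0.
pose I (k : int) : set R := [set` `]t + k%:~R - 1, t + k%:~R]%R].
have mI k : measurable (I k) by exact: measurable_itv.
under eq_esum do rewrite integral_reflect//.
have [||_ iE] := @measurable_esum _ _ _ mu int setT setT measurableT
  (fun k x => ((p \_ (I k)) x)%:E).
- move=> k _; apply/measurable_EFinP; apply/(measurable_restrictT _ (mI k)).
  exact: continuous_measurable_on.
- by move=> k x _ _; rewrite lee_fin patchE; case: ifP.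
under [RHS]eq_esum => k _ do rewrite integral_mkcond.
under [RHS]eq_esum => k _ do (under eq_integral => x _ do rewrite restrict_EFin).
rewrite -iE; apply: eq_integral => x _.
have [k kE] := unit_interval_cover x t.
rewrite (@esumID _ _ [set k] setT)//; last first.
  by move=> k' _; rewrite lee_fin patchE; case: ifP.
rewrite setTI esum_set1; last by rewrite lee_fin patchE; case: ifP.
rewrite esum1 ?adde0; last first.
  move=> k' [_ /= k'k]; rewrite patchE ifF//; apply/negbTE/negP => /set_mem.
  by rewrite /I/= kE => /eqP.
by rewrite patchE ifT//; apply/mem_set; rewrite /I/= kE.
Qed.

Lemma reflect_integrable (g : R -> R) (c : R) : continuous g ->
  mu.-integrable [set` `[0, 1[%R] (EFin \o (fun x => g (c - x))).
Proof.
move=> cg; apply: (@integrableS _ _ _ mu [set` `[0, 1]%R]) => //.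
  by apply: subset_itvl; rewrite bnd_simp.
apply: continuous_compact_integrable; first exact: segment_compact.
apply: continuous_subspaceT => x; apply: continuous_comp; last exact: cg.
by apply: cvgB; [exact: cvg_cst|exact: cvg_id].
Qed.

Lemma rsum_unit_intervals (g : R -> R) (t : R) : continuous g ->
  mu.-integrable setT (EFin \o g) ->
  rsummable [set: int]
    (fun k => \int[mu]_(x in [set` `[0, 1[%R]) g (t + k%:~R - x)) /\
  rsum [set: int]
    (fun k => \int[mu]_(x in [set` `[0, 1[%R]) g (t + k%:~R - x)) = \int[mu]_x g x.
Proof.
move=> cg ig.
pose p x := Num.max (g x) 0; pose q x := Num.max (- g x) 0.
have p0 x : 0 <= p x by rewrite le_max lexx orbT.
have q0 x : 0 <= q x by rewrite le_max lexx orbT.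
have gpq x : g x = p x - q x.
  by rewrite /p /q; case: (lerP (g x) 0) => h; [rewrite max_l ?oppr_ge0// sub0r opprK|
    rewrite max_r ?oppr_le0 1?ltW// subr0].
have cp : continuous p.
  by move=> x; apply: (@continuous_max _ _ g (cst 0)); [exact: cg|exact: cvg_cst].
have cq : continuous q.
  move=> x; apply: (@continuous_max _ _ (fun x => - g x) (cst 0)); last exact: cvg_cst.
  by apply: cvgN; exact: cg.
have le_int (f : R -> R) : continuous f -> (forall x, `|f x| <= `|g x|) ->
    mu.-integrable setT (EFin \o f).
  move=> cf fg; apply: (le_integrable measurableT) ig => //.
    by apply/measurable_EFinP; exact: continuous_measurable_on.
  by move=> x _; rewrite /= lee_fin.
have ip : mu.-integrable setT (EFin \o p).
  by apply: le_int => // x; rewrite ger0_norm// ge_max ler_norm normr_ge0.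
have iq : mu.-integrable setT (EFin \o q).
  by apply: le_int => // x; rewrite ger0_norm// ge_max -normrN ler_norm normr_ge0.
have main (f : R -> R) : continuous f -> (forall x, 0 <= f x) ->
    mu.-integrable setT (EFin \o f) ->
    rsummable [set: int] (fun k => \int[mu]_(x in [set` `[0, 1[%R]) f (t + k%:~R - x)) /\
    esumR [set: int] (fun k => \int[mu]_(x in [set` `[0, 1[%R]) f (t + k%:~R - x)) =
    \int[mu]_x f x.
  move=> cf f0 if_; have E := integral_unit_intervals f t cf f0.
  have fE (k : int) : (\int[mu]_(x in [set` `[0, 1[%R]) f (t + k%:~R - x))%:E =
      (\int[mu]_(x in [set` `[0, 1[%R]) (f (t + k%:~R - x))%:E)%E.
    rewrite fineK//; apply: integrable_fin_num => //; exact: reflect_integrable.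
  have E' : (\int[mu]_x (f x)%:E = \esum_(k in [set: int])
      (\int[mu]_(x in [set` `[0, 1[%R]) f (t + k%:~R - x))%:E)%E.
    by rewrite E; apply: eq_esum => k _; rewrite fE.
  split; last by rewrite /esumR -E'.
  rewrite /rsummable /summable.
  rewrite (@eq_esum _ _ _ _ (fun k : int =>
      (\int[mu]_(x in [set` `[0, 1[%R]) f (t + k%:~R - x))%:E)).
    rewrite -E'; have := integrable_fin_num measurableT if_.
    by rewrite ge0_fin_numE// integral_ge0// => x _; rewrite lee_fin.
  by move=> k _; rewrite abse_EFin ger0_norm// Rintegral_ge0.
have [sp ep] := main p cp p0 ip; have [sq eq] := main q cq q0 iq.
have gE (k : int) : \int[mu]_(x in [set` `[0, 1[%R]) g (t + k%:~R - x) =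
    \int[mu]_(x in [set` `[0, 1[%R]) p (t + k%:~R - x) -
    \int[mu]_(x in [set` `[0, 1[%R]) q (t + k%:~R - x).
  rewrite -RintegralB//; last 2 first.
  - exact: reflect_integrable.
  - exact: reflect_integrable.
  by apply: eq_Rintegral => x _; rewrite gpq.
split.
  apply: (eq_rsummable _ _ _ _ (rsummableD _ _ _ sp (rsummableN _ _ sq))) => k _.
  by rewrite gE.
rewrite (rsum_posneg _ _ _ _ sp sq); last 3 first.
- by move=> k _; exact: Rintegral_ge0.
- by move=> k _; exact: Rintegral_ge0.
- by move=> k _; exact: gE.
rewrite ep eq -RintegralB//.
by apply: eq_Rintegral => x _; rewrite gpq.
Qed.

Lemma csum_unit_intervals (g : R -> R[i]) (t : R) :
  continuous (@complex.Re R \o g) -> continuous (@complex.Im R \o g) ->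
  cintegrable mu setT g ->
  csumm [set: int]
    (fun k => cintegral mu [set` `[0, 1[%R] (fun x => g (t + k%:~R - x))) /\
  csum [set: int]
    (fun k => cintegral mu [set` `[0, 1[%R] (fun x => g (t + k%:~R - x))) =
  cintegral mu setT g.
Proof.
move=> cR cI [iR iI].
have [sR eR] := rsum_unit_intervals _ t cR iR.
have [sI eI] := rsum_unit_intervals _ t cI iI.
by split => //; rewrite /csum /cintegral; congr Complex.
Qed.

Local Notation A := ([set` `[0, 1[%R] : set R).

Lemma integral_cube (g h : R -> R) : mu.-integrable A (EFin \o g) ->
  mu.-integrable A (EFin \o h) ->
  (@lebesgue3 R).-integrable (A `*` A `*` A) (EFin \o (fun p => g p.1.1 * h p.1.2)) /\
  \int[@lebesgue3 R]_(p in A `*` A `*` A) (g p.1.1 * h p.1.2) =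
  (\int[mu]_(x in A) g x) * (\int[mu]_(x in A) h x).
Proof.
move=> ig ih.
have mA : measurable A by exact: measurable_itv.
pose one : R -> R := cst 1.
have iT (f : R -> R) : mu.-integrable A (EFin \o f) -> mu.-integrable setT (EFin \o (f \_ A)).
  move=> if_; rewrite (_ : EFin \o _ = (EFin \o f) \_ A); last first.
    by rewrite restrict_EFin.
  by rewrite -integrable_mkcond.
have mu1 : mu A = 1%E by rewrite lebesgue_measure_itv/= lte01 oppr0 adde0.
have i1 : mu.-integrable A (EFin \o one).
  have fin : (mu A < +oo)%E by rewrite mu1 ltry.
  apply: (@bounded_integrable R _ _ mu A one 1 mA fin) => [|x _].
    exact: measurable_cst.
  by rewrite /one normr1.
have [i2 e2] := @integral_prodM _ _ _ _ _ mu mu _ _ (iT g ig) (iT h ih).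
have [i3 e3] := @integral_prodM _ _ _ _ _ lebesgue2 mu
  (fun p => (g \_ A) p.1 * (h \_ A) p.2) _ i2 (iT one i1).
have E : (fun p : R * R * R => (g \_ A) p.1.1 * (h \_ A) p.1.2 * (one \_ A) p.2) =
    (fun p => g p.1.1 * h p.1.2) \_ (A `*` A `*` A).
  apply/funext => -[[x y] z]/=; rewrite !patchE !in_setX /=.
  by case: (x \in A); case: (y \in A); case: (z \in A); rewrite /= ?(mulr0, mul0r, mulr1).
have mD : measurable (A `*` A `*` A) by apply: measurableX => //; exact: measurableX.
split.
  rewrite integrable_mkcond// (_ : _ \_ _ = EFin \o
    ((fun p => g p.1.1 * h p.1.2) \_ (A `*` A `*` A))).
    by rewrite -E; exact: i3.
  by rewrite -restrict_EFin.
rewrite Rintegral_mkcond -E.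
transitivity ((\int[lebesgue2]_p ((g \_ A) p.1 * (h \_ A) p.2)) * \int[mu]_x (one \_ A) x).
  exact: e3.
rewrite -[X in _ * X]Rintegral_mkcond Rintegral_cst//.
rewrite [fine _](congr1 fine mu1) !mulr1.
rewrite [LHS]e2 -!Rintegral_mkcond//.
Qed.
End Lebesgue.

Section Circle.
Context {R : realType}.
Local Notation C := R[i].
Local Notation mu := (@lebesgue_measure R).
Local Notation A := ([set` `[0, 1[%R] : set R).
Local Notation normc := (@normc R).

Lemma expiD (s t : R) : expi (s + t) = expi s * expi t.
Proof. by rewrite /expi cosD sinD [sin s * _ + _]addrC; simpc. Qed.

Lemma normc_expi (t : R) : normc (expi t) = 1.
Proof. by rewrite /expi /= cos2Dsin2 sqrtr1. Qed.

Lemma expi0 : expi 0 = 1 :> C.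
Proof. by rewrite /expi cos0 sin0. Qed.

Lemma expi_int (m : int) : expi (2 * pi * m%:~R) = 1 :> C.
Proof.
have nat_case (n : nat) : expi (2 * pi * n%:R) = 1 :> C.
  elim: n => [|n IH]; first by rewrite mulr0 expi0.
  rewrite (mulrSr 1 n) mulrDr expiD IH mul1r mulr1 /expi mulr_natl.
  by rewrite cos2pi sin2pi.
case: m => n; first exact: nat_case.
have := expiD (2 * pi * n.+1%:R : R) (- (2 * pi * n.+1%:R)).
by rewrite subrr expi0 nat_case mul1r NegzE rmorphN/= mulrN => <-.
Qed.

Definition ccontinuous (g : R -> C) :=
  continuous (@complex.Re R \o g) /\ continuous (@complex.Im R \o g).

Lemma ccontinuous_expi : ccontinuous expi.
Proof. by split; [exact: continuous_cos|exact: continuous_sin]. Qed.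

Lemma ccontinuous_comp (g : R -> C) (h : R -> R) :
  continuous h -> ccontinuous g -> ccontinuous (fun x => g (h x)).
Proof.
move=> ch [cR cI]; split => x; [have c := cR (h x)|have c := cI (h x)];
  exact: (continuous_comp (ch x) c).
Qed.

Lemma ccontinuous_cst (c : C) : ccontinuous (fun=> c).
Proof. by split => x; exact: cvg_cst. Qed.

Lemma ccontinuousM (g h : R -> C) :
  ccontinuous g -> ccontinuous h -> ccontinuous (fun x => g x * h x).
Proof.
move=> [gR gI] [hR hI]; split.
  rewrite (_ : _ \o _ = (fun x => complex.Re (g x) * complex.Re (h x) -
    complex.Im (g x) * complex.Im (h x))); last by apply/funext => x; apply: ReM.
  move=> x; apply: cvgB; apply: cvgM; [exact: gR|exact: hR|exact: gI|exact: hI].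
rewrite (_ : _ \o _ = (fun x => complex.Re (g x) * complex.Im (h x) +
  complex.Im (g x) * complex.Re (h x))); last by apply/funext => x; apply: ImM.
move=> x; apply: cvgD; apply: cvgM; [exact: gR|exact: hI|exact: gI|exact: hR].
Qed.

Lemma ccontinuous_integrable (g : R -> C) : ccontinuous g -> cintegrable mu A g.
Proof.
have main (f : R -> R) : continuous f -> mu.-integrable A (EFin \o f).
  move=> cf; apply: (@integrableS _ _ _ mu [set` `[0, 1]%R]) => //.
    by apply: subset_itvl; rewrite bnd_simp.
  apply: continuous_compact_integrable; first exact: segment_compact.
  exact: continuous_subspaceT.
by move=> [cR cI]; split; exact: main.
Qed.

Lemma cintegral_cube (g h : R -> C) : cintegrable mu A g -> cintegrable mu A h ->
  cintegral lebesgue3 (A `*` A `*` A) (fun p => g p.1.1 * h p.1.2) =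
  cintegral mu A g * cintegral mu A h.
Proof.
move=> [gR gI] [hR hI].
have mD : measurable (A `*` A `*` A).
  by apply: measurableX => //; apply: measurableX.
have [i1 e1] := integral_cube _ _ gR hR; have [i2 e2] := integral_cube _ _ gI hI.
have [i3 e3] := integral_cube _ _ gR hI; have [i4 e4] := integral_cube _ _ gI hR.
rewrite /cintegral; apply: complex_eq; rewrite ?ReM ?ImM/=.
  rewrite -[X in X - _]e1 -[X in _ - X]e2 -[RHS]RintegralB//.
  by apply: eq_Rintegral => p _; rewrite ReM.
rewrite -[X in X + _]e3 -[X in _ + X]e4 -[RHS]RintegralD//.
by apply: eq_Rintegral => p _; rewrite ImM.
Qed.

Lemma integral_derive (F f : R -> R) : continuous f ->
  (forall x : R, is_derive x (1 : R) F (f x)) -> \int[mu]_(x in A) f x = F 1 - F 0.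
Proof.
move=> cf dF; rewrite Rintegral_itv_bndo_bndc; last first.
  by have [] := @ccontinuous_integrable (fun x => (f x)%:C%C)
    (conj cf (fun x => @cvg_cst _ _ _ _ _)).
have cF : continuous F by move=> x; apply: differentiable_continuous; apply/derivable1_diffP.
rewrite /Rintegral (@continuous_FTC2 _ f F 0 1)//.
- exact: continuous_subspaceT.
- split => [x _||]; first by [].
  + by apply: cvg_at_right_filter; exact: cF.
  + by apply: cvg_at_left_filter; exact: cF.
- by move=> x _; rewrite derive1E; exact: derive_val.
Qed.

Lemma cintegral_character (m : int) :
  cintegral mu A (fun y => expi (2 * pi * (m%:~R * y))) = (m == 0)%:R.
Proof.
have mu1 : mu A = 1%E by rewrite lebesgue_measure_itv/= lte01 oppr0 adde0.
have [->|m0] := eqVneq m 0.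
  rewrite /cintegral; apply: complex_eq => /=.
    transitivity (\int[mu]_(x in A) 1 : R).
      by apply: eq_Rintegral => y _; rewrite mul0r mulr0 cos0.
    by rewrite Rintegral_cst// [fine _](congr1 fine mu1) mulr1.
  transitivity (\int[mu]_(x in A) 0 : R); last by rewrite Rintegral_cst// mul0r.
  by apply: eq_Rintegral => y _; rewrite mul0r mulr0 sin0.
pose a : R := 2 * pi * m%:~R.
have a0 : a != 0 by rewrite !mulf_neq0 ?pnatr_eq0 ?intr_eq0// gt_eqF ?pi_gt0.
have aE y : 2 * pi * (m%:~R * y) = a * y by rewrite mulrA.
have [ca sa] : cos a = 1 /\ sin a = 0 by have [-> ->] := expi_int m.
have cl : continuous (fun y : R => a * y) by move=> y; exact: mulrl_continuous.
have dl (x : R) : is_derive x (1 : R) (fun y : R => a * y) a.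
  by have := @is_deriveZ R R R id a x 1 1 _; rewrite /GRing.scale /= mulr1; apply.
have dc (F G : R -> R) (k x : R) : is_derive (a * x) (1 : R) F (k * G (a * x)) -> k != 0 ->
    is_derive x (1 : R) (fun y => (k * a)^-1 * F (a * y)) (G (a * x)).
  move=> dF k0; have := is_deriveZ ((k * a)^-1) (is_derive1_comp dF (dl x)).
  by move=> /is_derive_eq; apply; rewrite /GRing.scale /=; field; rewrite a0.
have dS x : is_derive x (1 : R) (fun y => (1 * a)^-1 * sin (a * y)) (cos (a * x)).
  by apply: (dc sin cos) => //; rewrite mul1r; exact: is_derive_sin.
have dC x : is_derive x (1 : R) (fun y => (-1 * a)^-1 * cos (a * y)) (sin (a * x)).
  by apply: (dc cos sin); rewrite ?oppr_eq0// mulN1r; exact: is_derive_cos.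
rewrite /cintegral; apply: complex_eq => /=.
  under eq_Rintegral do rewrite aE.
  rewrite (integral_derive _ _ _ dS) ?mulr1 ?mulr0 ?sa ?sin0 ?subrr//.
  by move=> x; apply: continuous_comp; [exact: cl|exact: continuous_cos].
under eq_Rintegral do rewrite aE.
rewrite (integral_derive _ _ _ dC) ?mulr1 ?mulr0 ?ca ?cos0 ?subrr//.
by move=> x; apply: continuous_comp; [exact: cl|exact: continuous_sin].
Qed.
End Circle.

(** * The double cover *)

Section Mx3.
Variable T : comNzRingType.

Lemma mx3_mul (a b c d e f g h i a' b' c' d' e' f' g' h' i' : T) :
  mx3 a b c d e f g h i *m mx3 a' b' c' d' e' f' g' h' i' =
  mx3 (a * a' + b * d' + c * g') (a * b' + b * e' + c * h') (a * c' + b * f' + c * i')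
      (d * a' + e * d' + f * g') (d * b' + e * e' + f * h') (d * c' + e * f' + f * i')
      (g * a' + h * d' + i * g') (g * b' + h * e' + i * h') (g * c' + h * f' + i * i').
Proof.
apply/matrixP => r s; rewrite !mxE !big_ord_recl big_ord0 !mxE /= addr0 addrA.
by case: r => -[|[|[|//]]] ?; case: s => -[|[|[|//]]] ?.
Qed.

Lemma mx3_eta (M : 'M[T]_3) :
  M = mx3 (M 0 0) (M 0 1) (M 0 2) (M 1 0) (M 1 1) (M 1 2) (M 2 0) (M 2 1) (M 2 2).
Proof.
apply/matrixP => r s; rewrite mxE.
by case: r => -[|[|[|//]]] ?; case: s => -[|[|[|//]]] ? /=;
  congr (M _ _); apply: val_inj.
Qed.

Lemma mx3_1 : 1%:M = mx3 1 0 0 0 1 0 0 0 1 :> 'M[T]_3.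
Proof.
apply/matrixP => r s; rewrite !mxE.
by case: r => -[|[|[|//]]] ?; case: s => -[|[|[|//]]] ?.
Qed.

Lemma mx3_opp (a b c d e f g h i : T) : - mx3 a b c d e f g h i =
  mx3 (- a) (- b) (- c) (- d) (- e) (- f) (- g) (- h) (- i).
Proof.
apply/matrixP => r s; rewrite !mxE.
by case: r => -[|[|[|//]]] ?; case: s => -[|[|[|//]]] ?.
Qed.
End Mx3.

Section SL3lemmas.
Variable T : comUnitRingType.

Lemma SL3_eq (g h : SL3 T) : (g = h :> 'M[T]_3) -> g = h.
Proof. exact: val_inj. Qed.

Lemma matM (g h : SL3 T) : (g * h)%g = g *m h :> 'M[T]_3. Proof. by []. Qed.

Lemma mat1 : (1%g : SL3 T) = 1%:M :> 'M[T]_3. Proof. by []. Qed.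

Lemma unipM (x y z x' y' z' : T) :
  (unip x y z * unip x' y' z')%g = unip (x + x') (y + y') (z + z' + x * y').
Proof.
by apply: SL3_eq; rewrite matM /= mx3_mul; congr mx3; ring.
Qed.

Lemma unip0 : unip 0 0 0 = 1%g :> SL3 T.
Proof. by apply: SL3_eq; rewrite mat1 mx3_1. Qed.

Lemma unipV (x y z : T) : (unip x y z)^-1%g = unip (- x) (- y) (x * y - z).
Proof.
rewrite -[RHS]mul1g -(mulVg (unip x y z)) -mulgA unipM.
by rewrite !subrr addrCA subrr addr0 mulrN subrr unip0 mulg1.
Qed.

Lemma inN_unip (x y z : T) : inN (unip x y z). Proof. by exists x, y, z. Qed.

Lemma inN1 : @inN T 1%g. Proof. by rewrite -unip0; exact: inN_unip. Qed.

Lemma inN_mul (g h : SL3 T) : inN g -> inN h -> inN (g * h)%g.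
Proof. by move=> [x [y [z ->]]] [x' [y' [z' ->]]]; rewrite unipM; exact: inN_unip. Qed.

Lemma inN_inv (g : SL3 T) : inN g -> inN g^-1%g.
Proof. by move=> [x [y [z ->]]]; rewrite unipV; exact: inN_unip. Qed.
End SL3lemmas.

Section Cocycle.
Context {R : realType}.
Variable sigma : SL3 R -> SL3 R -> bool.
Hypothesis sigmaP : is_BLS_cocycle sigma.
Local Notation cmul := (cmul sigma).
Local Notation cinv := (cinv sigma).
Local Notation "g ∙ h" := (cmul g h) (at level 40, left associativity).
Local Notation "[ 'c' g ]" := (to_cover g%g) (format "[ 'c'  g ]").

Lemma sigma_diagE (a b c a' b' c' : R) :
  sigma_diag (diag3 a b c) (diag3 a' b' c') =
  hilbertR a b' (+) hilbertR a c' (+) hilbertR b c'.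
Proof. by rewrite /sigma_diag /diag3 !mxE. Qed.

Lemma sigma_diag1 (M : 'M[R]_3) : sigma_diag 1%:M M = false.
Proof. by rewrite /sigma_diag /hilbertR !mxE/= ltr10. Qed.

Lemma diag3_is_diag (a b c : R) : is_diag_mx (diag3 a b c).
Proof.
apply/is_diag_mxP => r s; rewrite mxE.
by case: r => -[|[|[|//]]] ?; case: s => -[|[|[|//]]] ?.
Qed.

Lemma sigma1g (h : SL3 R) : sigma 1%g h = false.
Proof.
by rewrite (BLS_diag sigmaP) ?sigma_diag1// mat1 mx3_1; exact: diag3_is_diag.
Qed.

Lemma sigmag1 (h : SL3 R) : sigma h 1%g = false.
Proof.
by have := BLS_cocycle sigmaP h 1%g 1%g; rewrite !mulg1 sigma1g addbb addbF => <-.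
Qed.

Lemma sigmaN (n h : SL3 R) : inN n -> sigma n h = false.
Proof.
move=> Nn; have := BLS_bruhat sigmaP (s := [::]) h Nn (_ : is_diag_mx (1%g : SL3 R)) isT (@inN1 R).
rewrite /word_prod big_nil !mulg1 /= addbF sigma1g => -> //.
Qed.

Lemma sigmaV (g : SL3 R) : sigma g^-1%g g = sigma g g^-1%g.
Proof.
by have := BLS_cocycle sigmaP g g^-1%g g; rewrite mulgV mulVg sigma1g sigmag1 addbF addFb.
Qed.

Lemma cmulA : associative cmul.
Proof.
move=> [g1 a] [g2 b] [g3 c]; congr pair; rewrite /= ?mulgA//.
move: (BLS_cocycle sigmaP g1 g2 g3).
move: (sigma g1 g2) (sigma (g1 * g2)%g g3) (sigma g1 (g2 * g3)%g) (sigma g2 g3).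
by case: a b c => -[] [] [] [] [] [].
Qed.

Lemma cmul1g (g : cover R) : [c 1] ∙ g = g.
Proof. by case: g => g b; rewrite /Defs.cmul/= mul1g sigma1g addbF. Qed.

Lemma cmulg1 (g : cover R) : g ∙ [c 1] = g.
Proof. by case: g => g b; rewrite /Defs.cmul/= mulg1 sigmag1 !addbF. Qed.

Lemma cmulgV (g : cover R) : g ∙ cinv g = [c 1].
Proof. by case: g => g b; rewrite /Defs.cmul/= mulgV addbA addbb addFb addbb. Qed.

Lemma cmulVg (g : cover R) : cinv g ∙ g = [c 1].
Proof.
case: g => g b; rewrite /Defs.cmul/= mulVg sigmaV.
by move: (sigma g g^-1%g); case: b => -[].
Qed.

Lemma cmulKg (g h : cover R) : cinv g ∙ (g ∙ h) = h.
Proof. by rewrite cmulA cmulVg cmul1g. Qed.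

Lemma cmulVKg (g h : cover R) : g ∙ (cinv g ∙ h) = h.
Proof. by rewrite cmulA cmulgV cmul1g. Qed.

Lemma cinvK : involutive cinv.
Proof. by move=> g; rewrite -[LHS]cmulg1 -(cmulVg g) cmulKg. Qed.

Lemma cinvM (g h : cover R) : cinv (g ∙ h) = cinv h ∙ cinv g.
Proof.
rewrite -[LHS]cmulg1 -(cmulgV g) -[cinv g in LHS](cmulVKg h).
by rewrite [g ∙ (h ∙ _)]cmulA cmulKg.
Qed.

Lemma cinv1 : cinv [c 1] = [c 1].
Proof. by rewrite -[LHS]cmul1g cmulgV. Qed.

Definition central (b : bool) : cover R := (1%g, b).

Lemma cmul_central (g : cover R) b : g ∙ central b = (g.1, g.2 (+) b).
Proof. by rewrite /Defs.cmul/= mulg1 sigmag1 addbF. Qed.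

Lemma central_mulC (g : cover R) b : central b ∙ g = g ∙ central b.
Proof. by rewrite cmul_central /Defs.cmul/= mul1g sigma1g addbF addbC. Qed.

Lemma cover_fiber (g h : cover R) : g.1 = h.1 -> g = h ∙ central (g.2 (+) h.2).
Proof. by case: g h => [g a] [h b] /= ->; rewrite cmul_central/= addbC addbK. Qed.

Lemma cNmul (n g : SL3 R) : inN n -> [c n] ∙ [c g] = [c n * g].
Proof. by move=> Nn; rewrite /Defs.cmul/= sigmaN. Qed.

End Cocycle.

Section Explicit.
Context {R : realType}.
Variable sigma : SL3 R -> SL3 R -> bool.
Hypothesis sigmaP : is_BLS_cocycle sigma.

Definition mkSL3 (M : 'M[R]_3) : SL3 R := insubd (1%g : SL3 R) M.

Lemma mkSL3E (M : 'M[R]_3) : \det M = 1 -> mkSL3 M = M :> 'M[R]_3.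
Proof. by move=> dM; rewrite -[LHS]/(val _) val_insubd dM eqxx. Qed.

Definition torus (a b c : R) : SL3 R := mkSL3 (diag3 a b c).

Lemma torusE (a b c : R) : a * b * c = 1 -> torus a b c = diag3 a b c :> 'M[R]_3.
Proof. by move=> abc; rewrite mkSL3E// det_mx3 !(mulr0, mul0r, subr0, addr0) mulrA. Qed.

Lemma torus_diag (a b c : R) : a * b * c = 1 -> is_diag_mx (torus a b c : 'M[R]_3).
Proof. by move=> abc; rewrite torusE//; exact: diag3_is_diag. Qed.

Lemma Delta_mx3 (a b c d e f g h i : R) : \det (mx3 a b c d e f g h i) = 1 ->
  Delta (mx3 a b c d e f g h i) =
  let X2 := first_nonzero (d * h - e * g) (d * i - f * g) (e * i - f * h) in
  let X3 := first_nonzero g h i in diag3 (X2^-1) (X2 / X3) X3.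
Proof.
move=> dM; rewrite /Delta dM /plA1 /plB1 /plC1 /plA2 /plB2 /plC2 !mxE /=.
by rewrite !opprK mul1r.
Qed.

Lemma diag3_mul (a b c a' b' c' : R) :
  diag3 a b c *m diag3 a' b' c' = diag3 (a * a') (b * b') (c * c').
Proof. by rewrite mx3_mul !(mulr0, mul0r, addr0, add0r). Qed.

Lemma diag3_opp (a b c : R) : - diag3 a b c = diag3 (- a) (- b) (- c).
Proof. by rewrite mx3_opp !oppr0. Qed.

Lemma sigma_tw1 (t g : SL3 R) : is_diag_mx (t : 'M[R]_3) ->
  sigma (t * w_alpha1)%g g = sigma_diag t (Delta (w_alpha1 * g)%g) (+)
    sigma_diag (Delta (w_alpha1 * g)%g *m Delta g) (- Delta g).
Proof.
move=> dt; have := BLS_bruhat sigmaP (s := [:: false]) g (@inN1 R) dt isT (@inN1 R).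
rewrite /word_prod big_seq1 /= /word_prod big_nil !mulg1 !mul1g addbF => ->.
by rewrite (BLS_diag sigmaP)// (BLS_weyl sigmaP false).
Qed.

Lemma sigma_tw21 (t g : SL3 R) : is_diag_mx (t : 'M[R]_3) ->
  sigma (t * (w_alpha2 * w_alpha1))%g g =
    sigma_diag t (Delta (w_alpha2 * w_alpha1 * g)%g) (+)
    (sigma_diag (Delta (w_alpha2 * w_alpha1 * g)%g *m Delta (w_alpha1 * g)%g)
        (- Delta (w_alpha1 * g)%g) (+)
     sigma_diag (Delta (w_alpha1 * g)%g *m Delta g) (- Delta g)).
Proof.
move=> dt; have := BLS_bruhat sigmaP (s := [:: true; false]) g (@inN1 R) dt isT (@inN1 R).
rewrite /word_prod /= !big_cons !big_nil /= /word_prod ?big_cons !big_nil !mulg1 !mul1g addbF => ->.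
rewrite (BLS_diag sigmaP)// (BLS_weyl sigmaP false) (BLS_weyl sigmaP true) /wgen.
by rewrite mulgA.
Qed.

Lemma w1_mx3 (a b c d e f g h i : R) : w_alpha1 *m mx3 a b c d e f g h i =
  mx3 (- d) (- e) (- f) a b c g h i.
Proof. by rewrite mx3_mul !(mul0r, mul1r, mulN1r, add0r, addr0). Qed.

Lemma w2_mx3 (a b c d e f g h i : R) : w_alpha2 *m mx3 a b c d e f g h i =
  mx3 a b c (- g) (- h) (- i) d e f.
Proof. by rewrite mx3_mul !(mul0r, mul1r, mulN1r, add0r, addr0). Qed.

Lemma diag3_mx3 (x y z a b c d e f g h i : R) : diag3 x y z *m mx3 a b c d e f g h i =
  mx3 (x * a) (x * b) (x * c) (y * d) (y * e) (y * f) (z * g) (z * h) (z * i).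
Proof. by rewrite mx3_mul !(mul0r, add0r, addr0). Qed.

Lemma w21_mat : w_alpha2 *m w_alpha1 = mx3 0 (-1) 0 0 0 (-1) 1 0 0 :> 'M[R]_3.
Proof. by rewrite w2_mx3 !oppr0. Qed.

Lemma Delta_diag (a b c : R) : a * b * c = 1 -> Delta (diag3 a b c) = diag3 a b c.
Proof.
move=> abc.
have c0 : c != 0 by apply: contra_eq_neq abc => ->; rewrite mulr0 eq_sym oner_eq0.
have b0 : b != 0.
  by apply: contra_eq_neq abc => ->; rewrite mulr0 mul0r eq_sym oner_eq0.
rewrite Delta_mx3; last by rewrite det_mx3 !(mulr0, mul0r, subr0, addr0) mulrA.
rewrite /first_nonzero !(mulr0, mul0r, subr0) eqxx /=.
congr diag3; last by rewrite mulfK.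
by rewrite -[LHS]mul1r -abc -mulrA mulfK// mulf_neq0.
Qed.

Lemma Delta_w1 (a b c : R) : a * b * c = -1 ->
  Delta (mx3 0 a 0 b 0 0 0 0 c) = diag3 (b * c)^-1 b c.
Proof.
move=> abc.
have c0 : c != 0.
  by apply: contra_eq_neq abc => ->; rewrite mulr0 eq_sym oppr_eq0 oner_eq0.
have b0 : b != 0.
  by apply: contra_eq_neq abc => ->; rewrite mulr0 mul0r eq_sym oppr_eq0 oner_eq0.
rewrite Delta_mx3; last first.
  by rewrite det_mx3 !(mulr0, mul0r, subr0, addr0, sub0r) mulrA abc opprK.
rewrite /first_nonzero !(mulr0, mul0r, subr0) eqxx /= mulf_neq0//= ?eqxx.
by rewrite mulfK.
Qed.

Lemma Delta_w21 (a b c : R) : a * b * c = 1 ->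
  Delta (mx3 0 a 0 0 0 b c 0 0) = diag3 (- b * c)^-1 (- b) c.
Proof.
move=> abc.
have c0 : c != 0 by apply: contra_eq_neq abc => ->; rewrite mulr0 eq_sym oner_eq0.
have b0 : b != 0.
  by apply: contra_eq_neq abc => ->; rewrite mulr0 mul0r eq_sym oner_eq0.
rewrite Delta_mx3; last first.
  by rewrite det_mx3 !(mulr0, mul0r, subr0, addr0, sub0r, mulrN, opprK) mulrA.
rewrite /first_nonzero !(mulr0, mul0r, subr0, sub0r, oppr0) eqxx /= oppr_eq0 mulf_neq0//= c0.
by rewrite -mulNr mulfK.
Qed.

Lemma Delta_wl (a b c : R) : a * b * c = -1 ->
  Delta (mx3 0 0 a 0 b 0 c 0 0) = diag3 (- b * c)^-1 (- b) c.
Proof.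
move=> abc.
have c0 : c != 0.
  by apply: contra_eq_neq abc => ->; rewrite mulr0 eq_sym oppr_eq0 oner_eq0.
have b0 : b != 0.
  by apply: contra_eq_neq abc => ->; rewrite mulr0 mul0r eq_sym oppr_eq0 oner_eq0.
rewrite Delta_mx3; last first.
  by rewrite det_mx3 -[RHS]opprK -abc; ring.
rewrite /first_nonzero !(mulr0, mul0r, subr0, sub0r, oppr0) oppr_eq0 mulf_neq0//= c0.
by rewrite -mulNr mulfK.
Qed.

Lemma hilbertR_pos (x y : R) : 0 < x -> hilbertR x y = false.
Proof. by move=> x0; rewrite /hilbertR ltNge (ltW x0). Qed.

Lemma hilbertR_posr (x y : R) : 0 < y -> hilbertR x y = false.
Proof. by move=> y0; rewrite /hilbertR [y < 0]ltNge (ltW y0) andbF. Qed.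

Lemma hilbertR_neg (x y : R) : 0 < x -> 0 < y -> hilbertR (- x) (- y) = true.
Proof. by move=> x0 y0; rewrite /hilbertR !oppr_lt0 x0 y0. Qed.

Lemma sigma_diag_pos (a b c a' b' c' : R) : 0 < a -> 0 < b ->
  sigma_diag (diag3 a b c) (diag3 a' b' c') = false.
Proof. by move=> a0 b0; rewrite sigma_diagE !hilbertR_pos. Qed.

Lemma sigma_diag_posr (a b c a' b' c' : R) : 0 < b' -> 0 < c' ->
  sigma_diag (diag3 a b c) (diag3 a' b' c') = false.
Proof. by move=> a0 b0; rewrite sigma_diagE !hilbertR_posr. Qed.

Lemma Delta_unip (x y z : R) : Delta (unip x y z) = diag3 1 1 1.
Proof.
rewrite Delta_mx3; last by rewrite det_mx3 !(mulr0, mul0r, subr0, addr0, mul1r).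
rewrite /first_nonzero !(mulr0, mul0r, subr0, mul1r, sub0r, oppr0) eqxx /=.
by rewrite ?addr0 ?divr1 ?invr1.
Qed.

Lemma Delta_w1_unip (x y z : R) : Delta (w_alpha1 * unip x y z)%g = diag3 1 1 1.
Proof.
have dt := eqP (det_mat (w_alpha1 * unip x y z)%g); move: dt.
rewrite matM /= w1_mx3 => dt; rewrite Delta_mx3//.
rewrite /first_nonzero !(mulr0, mul0r, subr0, mul1r, sub0r, oppr0) eqxx /= oner_eq0 /= ?eqxx.
by rewrite ?addr0 ?divr1 ?invr1.
Qed.

Lemma Delta_w21_unip (x y z : R) :
  Delta (w_alpha2 * w_alpha1 * unip x y z)%g = diag3 1 1 1.
Proof.
have dt := eqP (det_mat (w_alpha2 * w_alpha1 * unip x y z)%g); move: dt.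
rewrite -mulgA !matM /= w1_mx3 w2_mx3 => dt; rewrite Delta_mx3//.
rewrite /first_nonzero !(oppr0, mul0r, mulr0, mulr1, opprK, subr0, add0r) eqxx /= oner_eq0 /=.
by rewrite ?addr0 ?divr1 ?invr1.
Qed.

Lemma sigma_tw1_unip (t : SL3 R) (x y z : R) : is_diag_mx (t : 'M[R]_3) ->
  sigma (t * w_alpha1)%g (unip x y z) = false.
Proof.
move=> dt; rewrite sigma_tw1// Delta_w1_unip Delta_unip diag3_mul !mul1r.
have -> : diag3 1 1 1 = 1%:M :> 'M[R]_3 by rewrite mx3_1.
by rewrite sigma_diag1 /sigma_diag /hilbertR !mxE /= !ltr10 !andbF.
Qed.

Lemma sigma_tw21_unip (t : SL3 R) (x y z : R) : is_diag_mx (t : 'M[R]_3) ->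
  sigma (t * (w_alpha2 * w_alpha1))%g (unip x y z) = false.
Proof.
move=> dt; rewrite sigma_tw21// Delta_w21_unip Delta_w1_unip Delta_unip !diag3_mul !mul1r.
have -> : diag3 1 1 1 = 1%:M :> 'M[R]_3 by rewrite mx3_1.
by rewrite !sigma_diag1 /sigma_diag /hilbertR !mxE /= !ltr10 !andbF.
Qed.

Local Notation w21 := (w_alpha2 * w_alpha1)%g.

Lemma w1_torus (a b c : R) : a * b * c = 1 ->
  (w_alpha1 * torus a b c)%g = mx3 0 (- b) 0 a 0 0 0 0 c :> 'M[R]_3.
Proof. by move=> h; rewrite matM torusE// w1_mx3 !oppr0. Qed.

Lemma w21_torus (a b c : R) : a * b * c = 1 ->
  (w21 * torus a b c)%g = mx3 0 (- b) 0 0 0 (- c) a 0 0 :> 'M[R]_3.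
Proof. by move=> h; rewrite -mulgA matM w1_torus// w2_mx3 !oppr0. Qed.

(* sigma on monomial matrices; in each case the arguments are the values of
   Delta along the word. *)
Lemma sigma_w21_torus (x y z a b c : R) : x * y * z = 1 -> a * b * c = 1 ->
  sigma (torus x y z * w21)%g (torus a b c) =
    sigma_diag (diag3 x y z) (diag3 (c * a)^-1 c a) (+)
    (sigma_diag (diag3 ((c * a)^-1 * (a * c)^-1) (c * a) (a * c))
        (diag3 (- (a * c)^-1) (- a) (- c)) (+)
     sigma_diag (diag3 ((a * c)^-1 * a) (a * b) (c * c)) (diag3 (- a) (- b) (- c))).
Proof.
move=> xyz abc; rewrite sigma_tw21; last exact: torus_diag.
rewrite w21_torus// w1_torus// !torusE// Delta_diag// Delta_w1; last first.
  by rewrite mulNr -[RHS]/(- 1) -abc; ring.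
rewrite Delta_w21; last by rewrite mulrNN -abc; ring.
by rewrite !opprK !diag3_mul !diag3_opp.
Qed.

Lemma sigma_w1_w21_torus (x y z u v w a b c : R) :
  x * y * z = 1 -> u * v * w = 1 -> a * b * c = 1 ->
  sigma (torus x y z * w_alpha1)%g (torus u v w * w21 * torus a b c)%g =
    sigma_diag (diag3 x y z) (diag3 (u * b * (w * a))^-1 (u * b) (w * a)) (+)
    sigma_diag (diag3 ((u * b * (w * a))^-1 * (v * c * (w * a))^-1)
        (u * b * (v * c)) (w * a * (w * a)))
      (diag3 (- (v * c * (w * a))^-1) (- (v * c)) (- (w * a))).
Proof.
move=> xyz uvw abc; rewrite sigma_tw1; last exact: torus_diag.
have E : (torus u v w * w21 * torus a b c)%g =
    mx3 0 (- (u * b)) 0 0 0 (- (v * c)) (w * a) 0 0 :> 'M[R]_3.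
  by rewrite -mulgA matM w21_torus// torusE// diag3_mx3 !mulr0 !mulrN.
have E1 : (w_alpha1 * (torus u v w * w21 * torus a b c))%g =
    mx3 0 0 (v * c) 0 (- (u * b)) 0 (w * a) 0 0 :> 'M[R]_3.
  by rewrite matM E w1_mx3 !oppr0 opprK.
rewrite E1 E torusE//.
have uvwabc : (u * v * w) * (a * b * c) = 1 by rewrite uvw abc mulr1.
rewrite Delta_wl; last by rewrite -[RHS]/(- 1) -uvwabc; ring.
rewrite Delta_w21; last by rewrite mulrNN -uvwabc; ring.
by rewrite !opprK diag3_mul diag3_opp.
Qed.
End Explicit.

Section KeyIdentity.
Context {R : realType}.
Variable sigma : SL3 R -> SL3 R -> bool.
Hypothesis sigmaP : is_BLS_cocycle sigma.
Local Notation cmul := (cmul sigma).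
Local Notation cinv := (cinv sigma).
Local Notation "g ∙ h" := (cmul g h) (at level 40, left associativity).
Local Notation "[ 'c' g ]" := (to_cover g%g) (format "[ 'c'  g ]").
Local Notation w21 := (w_alpha2 * w_alpha1)%g.
Local Notation torus := (@torus R).

Definition sgn_torus (d : R) : SL3 R :=
  if 0 < d then torus (-1) (-1) 1 else torus (-1) 1 (-1).

Definition abs_torus (d : R) : SL3 R := torus 1 `|d|^-1 `|d|.

Lemma w_stat_torus : w_stat = (torus (-1) 1 (-1) * w21)%g.
Proof.
apply: SL3_eq; rewrite !matM w21_mat torusE; last by ring.
by rewrite diag3_mx3 !(mulr0, mulN1r, mul1r, mulr1, opprK).
Qed.

Lemma w_stat_sgn_torus (d : R) : (w_stat * sgn_torus d)%g =
  ((if 0 < d then torus 1 1 1 else torus (-1) (-1) 1) * w21)%g.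
Proof.
apply: SL3_eq; rewrite /sgn_torus.
by case: ifP => _; rewrite !matM w21_mat !torusE; try ring;
  rewrite diag3_mx3 mx3_mul;
  rewrite !(mulr0, mul0r, addr0, add0r, mulN1r, mulrN1, mul1r, mulr1, opprK, oppr0).
Qed.

Lemma sigma_w_stat_pos : sigma w_stat (torus (-1) (-1) 1) = false.
Proof.
rewrite w_stat_torus sigma_w21_torus//; try by ring.
rewrite !sigma_diagE /hilbertR !(mulN1r, mulrN1, mul1r, mulr1, opprK, invrN, invr1).
by rewrite !(ltrN10, ltr10).
Qed.

Lemma sigma_w_stat_neg : sigma w_stat (torus (-1) 1 (-1)) = true.
Proof.
rewrite w_stat_torus sigma_w21_torus//; try by ring.
rewrite !sigma_diagE /hilbertR !(mulN1r, mulrN1, mul1r, mulr1, opprK, invrN, invr1).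
by rewrite !(ltrN10, ltr10).
Qed.

Lemma sigma_w21_pos_torus (x y z p : R) : x * y * z = 1 -> 0 < p ->
  sigma (torus x y z * w21)%g (torus 1 p^-1 p) = false.
Proof.
move=> xyz p0; have q0 : 0 < p^-1 by rewrite invr_gt0.
rewrite sigma_w21_torus// ?mul1r ?mulVf ?gt_eqF// !mulr1.
by rewrite sigma_diag_posr// !sigma_diag_pos// ?mulr_gt0 ?invr_gt0.
Qed.

Lemma sigma_key_pos (p : R) : 0 < p ->
  sigma (torus p^-1 p 1 * w_alpha1)%g (torus 1 1 1 * w21 * torus 1 p^-1 p)%g = false.
Proof.
move=> p0; have q0 : 0 < p^-1 by rewrite invr_gt0.
rewrite sigma_w1_w21_torus// ?mul1r ?mulr1 ?mulVf ?gt_eqF//.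
by rewrite !sigma_diag_pos// ?mulr_gt0 ?invr_gt0.
Qed.

Lemma sigma_key_neg (p : R) : 0 < p ->
  sigma (torus (- p)^-1 (- p) 1 * w_alpha1)%g
    (torus (-1) (-1) 1 * w21 * torus 1 p^-1 p)%g = true.
Proof.
move=> p0; have q0 : 0 < p^-1 by rewrite invr_gt0.
have pn0 : p != 0 by rewrite gt_eqF.
rewrite sigma_w1_w21_torus//; last 3 first.
- by rewrite mulr1 mulVf// oppr_eq0.
- by ring.
- by rewrite mul1r mulVf.
rewrite !(mulN1r, mulr1) mulrNN sigma_diagE.
rewrite !(hilbertR_posr _ _ ltr01) invrN hilbertR_neg// sigma_diag_pos//.
  by rewrite invrN mulrNN mulr_gt0 ?invr_gt0.
by rewrite mulr_gt0.
Qed.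

Lemma sigma_key (d : R) : d != 0 ->
  sigma w_stat (sgn_torus d) (+) sigma (w_stat * sgn_torus d)%g (abs_torus d) (+)
  sigma (torus d^-1 d 1 * w_alpha1)%g (w_stat * sgn_torus d * abs_torus d)%g = false.
Proof.
move=> d0; rewrite w_stat_sgn_torus /abs_torus /sgn_torus.
have p0 : 0 < `|d| by rewrite normr_gt0.
have [dp|] := ltP 0 d.
  by rewrite gtr0_norm// sigma_w_stat_pos sigma_w21_pos_torus ?mulr1// sigma_key_pos.
rewrite le_eqVlt (negbTE d0)/= => dn.
have dE : d = - `|d| by rewrite ltr0_norm// opprK.
rewrite sigma_w_stat_neg sigma_w21_pos_torus//; last by ring.
by rewrite {1 2}dE sigma_key_neg.
Qed.

Lemma unipE (x y z : R) : (unip x y z : 'M[R]_3) = mx3 1 x z 0 1 y 0 0 1.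
Proof. by []. Qed.

Lemma w_longE : (w_long : 'M[R]_3) = mx3 0 0 1 0 (-1) 0 1 0 0.
Proof. by rewrite /w_long -mulgA !matM w2_mx3 w1_mx3 !oppr0 opprK. Qed.

Lemma key_identity (d : R) : d != 0 ->
  [c torus d^-1 d 1 * w_alpha1] ∙ ([c w_stat] ∙ [c sgn_torus d] ∙ [c abs_torus d]) =
  [c w_long].
Proof.
move=> d0; rewrite /Defs.cmul/=; congr pair; last first.
  by rewrite !addbF; exact: sigma_key.
rewrite w_stat_sgn_torus /sgn_torus.
have p0 : `|d| != 0 by rewrite normr_eq0.
have dV : d^-1 * d * 1 = 1 by rewrite mulr1 mulVf.
have pV : 1 * `|d|^-1 * `|d| = 1 by rewrite mul1r mulVf.
apply: SL3_eq; rewrite w_longE /abs_torus !matM (torusE _ _ _ dV) (torusE _ _ _ pV) w21_mat.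
have [dp|] := ltP 0 d.
  rewrite torusE; last by ring.
  rewrite gtr0_norm// !(diag3_mx3, mx3_mul).
  by congr mx3; field.
rewrite le_eqVlt (negbTE d0)/= => dn.
rewrite torusE; last by ring.
rewrite ltr0_norm// !(diag3_mx3, mx3_mul).
by congr mx3; field.
Qed.

(* gamma = N' t w_alpha1 n(e/d, 0, 0); the unipotent factor on the right cancels
   against n(x, y, z) n(- x - e/d, 0, 0), up to a factor that moves to the left. *)
Lemma cell_factorisation (g : SL3 R) (s : bool) (d e x y z : R) :
  g 2 0 = 0 -> g 2 1 = 0 -> g 2 2 = 1 -> g 1 0 = d -> g 1 1 = e -> d != 0 ->
  exists2 n, inN n & (g, s) ∙ [c unip x y z] ∙ [c unip (- (x + e / d)) 0 0] =
    [c n] ∙ [c torus d^-1 d 1 * w_alpha1] ∙ central s.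
Proof.
move=> g20 g21 g22 gd ge d0.
have dV : d^-1 * d * 1 = 1 by rewrite mulr1 mulVf.
have dt : is_diag_mx (torus d^-1 d 1 : 'M[R]_3) by exact: torus_diag.
set tw := (torus d^-1 d 1 * w_alpha1)%g.
have twE : (tw : 'M[R]_3) = mx3 0 (- d^-1) 0 d 0 0 0 0 1.
  by rewrite matM torusE// diag3_mx3 !(mulr0, mulr1) mulrN1.
have tw_unip (u v w : R) : [c tw] ∙ [c unip u v w] = [c tw * unip u v w].
  by rewrite /Defs.cmul/= sigma_tw1_unip.
pose n1 := unip (g 0 0 / d) (g 1 2) (g 0 2).
have N1 : inN n1 by exact: inN_unip.
have dg : g 0 0 * e - g 0 1 * d = 1.
  rewrite -(eqP (det_mat g)) [X in \det X]mx3_eta det_mx3 g20 g21 g22 gd ge.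
  by rewrite !(mulr0, mulr1, subr0, addr0).
have gE : g = (n1 * (tw * unip (e / d) 0 0))%g.
  apply: SL3_eq; rewrite (matM _ n1) (matM _ tw) twE !unipE [LHS]mx3_eta g20 g21 g22 gd ge !mx3_mul.
  have -> : g 0 1 = (g 0 0 * e - 1) / d by rewrite -dg opprB addrC subrK mulfK.
  by congr mx3; field.
have gsE : (g, s) = [c n1] ∙ ([c tw] ∙ [c unip (e / d) 0 0]) ∙ central s.
  rewrite tw_unip cNmul//; rewrite {1}gE cmul_central//.
pose n2 := unip 0 (d * (z + e / d * y)) (- (y / d)).
have N2 : inN n2 by exact: inN_unip.
exists (n1 * n2)%g; first exact: inN_mul.
rewrite -/tw.
have cen a b : a ∙ central s ∙ b = a ∙ b ∙ central s.
  by rewrite -!cmulA// central_mulC.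
rewrite gsE !cen; congr (_ ∙ _); rewrite -[RHS](congr1 (cmul^~ _) (cNmul sigma sigmaP _ _ N1)).
rewrite -!cmulA//; congr (_ ∙ _).
rewrite cNmul//; last exact: inN_unip.
rewrite cNmul//; last exact: inN_unip.
rewrite !unipM tw_unip cNmul//; congr to_cover.
apply: SL3_eq; rewrite (matM _ tw) (matM _ n2) twE !unipE !mx3_mul.
by congr mx3; field.
Qed.
End KeyIdentity.

(** * The principal series *)

Section Representation.
Context {R : realType}.
Local Notation C := R[i].

Definition mx2 (a b c d : C) : 'M[C]_2 :=
  \matrix_(r, s) nth 0 [:: a; b; c; d] (2 * r + s)%N.

Lemma mx2_mul (a b c d a' b' c' d' : C) : mx2 a b c d *m mx2 a' b' c' d' =
  mx2 (a * a' + b * c') (a * b' + b * d') (c * a' + d * c') (c * b' + d * d').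
Proof.
apply/matrixP => r s; rewrite !mxE !big_ord_recl big_ord0 !mxE /= addr0.
by case: r => -[|[|//]] ?; case: s => -[|[|//]] ?.
Qed.

Lemma mx2_1 : 1%:M = mx2 1 0 0 1.
Proof.
by apply/matrixP => r s; rewrite !mxE; case: r => -[|[|//]] ?; case: s => -[|[|//]] ?.
Qed.

Lemma mx2_scale (e a b c d : C) : e *: mx2 a b c d = mx2 (e * a) (e * b) (e * c) (e * d).
Proof.
by apply/matrixP => r s; rewrite !mxE; case: r => -[|[|//]] ?; case: s => -[|[|//]] ?.
Qed.

Lemma mx2_tr (a b c d : C) : (mx2 a b c d)^T = mx2 a c b d.
Proof.
by apply/matrixP => r s; rewrite !mxE; case: r => -[|[|//]] ?; case: s => -[|[|//]] ?.
Qed.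

Lemma mx2_col0 (a b c d : C) (v : 'cV[C]_2) :
  (mx2 a b c d *m v) 0 0 = a * v 0 0 + b * v 1 0.
Proof. by rewrite !mxE !big_ord_recl big_ord0 !mxE /= addr0; congr (_ + _ * v _ _); apply: val_inj. Qed.

Lemma mx2_col1 (a b c d : C) (v : 'cV[C]_2) :
  (mx2 a b c d *m v) 1 0 = c * v 0 0 + d * v 1 0.
Proof. by rewrite !mxE !big_ord_recl big_ord0 !mxE /= addr0; congr (_ + _ * v _ _); apply: val_inj. Qed.

Lemma invmx_eq (A B : 'M[C]_2) : A *m B = 1%:M -> invmx A = B.
Proof.
move=> AB; have [uA _] := mulmx1_unit AB.
by rewrite -[LHS]mulmx1 -AB mulmxA mulVmx// mul1mx.
Qed.

Lemma ii : 'i%C * 'i%C = -1 :> C. Proof. by rewrite -expr2 sqr_i. Qed.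

Lemma phiE (m : cover R) : phi m = (-1) ^+ m.2 *:
  ((if (m.1 0 0 < 0)%R then mx2 0 (-1) 1 0 else 1%:M) *m
   (if (m.1 1 1 < 0)%R then mx2 (- 'i%C) 0 0 'i%C else 1%:M)).
Proof. by rewrite /phi; congr (_ *: (_ *m _)); case: ifP => _; rewrite ?expr1 ?expr0. Qed.
End Representation.

Section Transform.
Context {R : realType}.
Local Notation C := R[i].
Variable sigma : SL3 R -> SL3 R -> bool.
Hypothesis sigmaP : is_BLS_cocycle sigma.
Local Notation cmul := (cmul sigma).
Local Notation cinv := (cinv sigma).
Local Notation "g ∙ h" := (cmul g h) (at level 40, left associativity).
Local Notation "[ 'c' g ]" := (to_cover g%g) (format "[ 'c'  g ]").
Local Notation torus := (@torus R).

Lemma inverse_cell (g : SL3 R) (s : bool) (d e x y z : R) :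
  g 2 0 = 0 -> g 2 1 = 0 -> g 2 2 = 1 -> g 1 0 = d -> g 1 1 = e -> d != 0 ->
  exists2 n, inN n & cinv ((g, s) ∙ [c unip x y z]) ∙ [c w_long] =
    [c unip (- (x + e / d)) 0 0] ∙ [c w_stat] ∙ (sgn_torus d, s) ∙ [c abs_torus d] ∙
    (cinv [c w_long] ∙ [c n] ∙ [c w_long]).
Proof.
move=> g20 g21 g22 gd ge d0.
have [n Nn nE] := cell_factorisation _ sigmaP g s d e x y z g20 g21 g22 gd ge d0.
exists n^-1%g; first exact: inN_inv.
set G := _ ∙ [c unip x y z] in nE *; set n2 := [c unip _ 0 0] in nE *.
have cen a b : a ∙ central s ∙ b = a ∙ b ∙ central s.
  by rewrite -!cmulA// central_mulC.
have ZZ a : a ∙ central s ∙ central s = a.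
  by rewrite -cmulA// [X in _ ∙ X]cmul_central// addbb cmulg1.
have core : G ∙ (n2 ∙ [c w_stat] ∙ (sgn_torus d, s) ∙ [c abs_torus d]) = [c n] ∙ [c w_long].
  have -> : (sgn_torus d, s) = [c sgn_torus d] ∙ central s by rewrite cmul_central.
  rewrite -(key_identity _ sigmaP d d0) !cmulA// nE !cen; apply: ZZ.
have -> : n2 ∙ [c w_stat] ∙ (sgn_torus d, s) ∙ [c abs_torus d] = cinv G ∙ ([c n] ∙ [c w_long]).
  by rewrite -core cmulKg.
rewrite -cmulA//; congr (_ ∙ _); rewrite -!cmulA// cmulVKg// [RHS]cmulA// cNmul//.
by rewrite mulgV cmul1g.
Qed.

Lemma abs_torus_inA (d : R) : d != 0 -> inA (abs_torus d).
Proof.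
move=> d0; have p0 : 0 < `|d| by rewrite normr_gt0.
have pV : 1 * `|d|^-1 * `|d| = 1 by rewrite mul1r mulVf// gt_eqF.
split; first exact: torus_diag.
move=> i; rewrite /abs_torus torusE// mxE.
by case: i => -[|[|[|//]]] ? /=; rewrite ?ltr01 ?invr_gt0.
Qed.

Lemma sgn_torusE (d : R) : (sgn_torus d : 'M[R]_3) =
  if 0 < d then diag3 (-1) (-1) 1 else diag3 (-1) 1 (-1).
Proof. by rewrite /sgn_torus; case: ifP => _; rewrite torusE//; ring. Qed.

Lemma sgn_torus_inMt (d : R) (s : bool) : in_Mt (sgn_torus d, s).
Proof.
exists true, (0 < d); rewrite /= sgn_torusE; case: ifP => _ /=.
  by rewrite mulrNN mulr1.
by rewrite expr0 mulr1.
Qed.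

Lemma cpow1 (s : C) : cpow 1 s = 1.
Proof. by rewrite /cpow ln1 !mulr0 expR0 /expi cos0 sin0 mul1r. Qed.

Lemma cpowD (a : R) (s t : C) : cpow a (s + t) = cpow a s * cpow a t.
Proof.
rewrite /cpow; case: s t => [s s'] [t t'] /=; rewrite !mulrDl expRD expiD.
by rewrite rmorphM/= mulrACA.
Qed.

Lemma cpowV (a : R) (s : C) : 0 < a -> cpow a^-1 s = cpow a (- s).
Proof. by move=> a0; rewrite /cpow lnV// !mulrN; case: s => s s' /=; rewrite !mulNr. Qed.

Lemma abs_torus_character (lam : 'rV[C]_3) (d : R) : d != 0 ->
  \prod_(i < 3) cpow (abs_torus d i i) (- ((- lam) 0 i - rho 0 i)) =
  cpow `|d| (-1 - lam 0 1 + lam 0 2).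
Proof.
move=> d0; have p0 : 0 < `|d| by rewrite normr_gt0.
have pV : 1 * `|d|^-1 * `|d| = 1 by rewrite mul1r mulVf// gt_eqF.
rewrite !big_ord_recl big_ord0 mulr1 /abs_torus torusE// !mxE /= cpow1 mul1r.
rewrite cpowV// -cpowD; congr cpow.
have -> : lift ord0 ord0 = 1 :> 'I_3 by apply: val_inj.
have -> : lift ord0 (lift ord0 ord0) = 2 :> 'I_3 by apply: val_inj.
have -> : bump 0 (bump 0 0) = 2%N by [].
have -> : bump 0 0 = 1%N by [].
by ring.
Qed.

(* The two entries of eta(m^-1) that occur: multiplication by -i when d > 0 and
   by 1 when d < 0, up to the sign of the fibre. *)
Lemma contragredient_sgn_torus (d : R) (s : bool) (v : 'cV[C]_2) :
  (contragredient phi (cinv (sgn_torus d, s)) *m v) 0 0 =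
  (-1) ^+ s * (if 0 < d then - 'i%C else 1) * v 1 0.
Proof.
have E : cinv (sgn_torus d, s) = (sgn_torus d, ~~ s).
  have V : (sgn_torus d)^-1%g = sgn_torus d.
    rewrite -[RHS]mulg1 -(mulgV (sgn_torus d)) mulgA.
    rewrite (_ : (sgn_torus d * sgn_torus d)%g = 1%g) ?mul1g//.
    apply: SL3_eq; rewrite matM mat1 sgn_torusE mx3_1.
    by case: ifP => _; rewrite diag3_mul !(mulrNN, mulr1).
  rewrite /Defs.cinv/= V; congr pair; rewrite (BLS_diag_diag sigmaP) sgn_torusE;
    try by case: ifP => _; exact: diag3_is_diag.
  rewrite -[RHS]addbT; congr (_ (+) _); case: ifP => _;
    by rewrite sigma_diagE /hilbertR !(ltrN10, ltr10).
rewrite E /contragredient phiE /= sgn_torusE {E}.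
have [u [-> uN uu]] : exists u : C,
    [/\ (-1) ^+ s = u, (-1) ^+ (~~ s) = - u & u * u = 1].
  by exists ((-1) ^+ s); split=> //; case: s; rewrite ?expr0 ?expr1 ?opprK ?mulrNN ?mulr1.
have d00 (a b c : R) : diag3 a b c 0 0 = a by rewrite mxE.
have d11 (a b c : R) : diag3 a b c 1 1 = b by rewrite mxE.
have [_|_] := boolP (0 < d); rewrite d00 d11 !(ltrN10, ltr10).
  rewrite mx2_mul mx2_scale.
  rewrite (invmx_eq _ (mx2 0 (- (u * 'i%C)) (- (u * 'i%C)) 0)); last first.
    rewrite mx2_mul mx2_1 uN; congr mx2; try by ring.
      by transitivity (- (u * u) * ('i%C * 'i%C)); [ring|rewrite uu ii; ring].
    by transitivity (- (u * u) * ('i%C * 'i%C)); [ring|rewrite uu ii; ring].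
  by rewrite mx2_tr mx2_col0; ring.
rewrite mulmx1 mx2_scale.
rewrite (invmx_eq _ (mx2 0 (- u) u 0)); last first.
  rewrite mx2_mul mx2_1 uN; congr mx2; try by ring.
    by transitivity (u * u); [ring|].
  by transitivity (u * u); [ring|].
by rewrite mx2_tr mx2_col0; ring.
Qed.

Lemma cell_value (lam : 'rV[C]_3) (f : section) (g : SL3 R) (s : bool)
    (d e x y z : R) : Vsmooth sigma (- lam) (contragredient phi) f ->
  g 2 0 = 0 -> g 2 1 = 0 -> g 2 2 = 1 -> g 1 0 = d -> g 1 1 = e -> d != 0 ->
  f (cinv ((g, s) ∙ [c unip x y z]) ∙ [c w_long]) 0 0 =
  cpow `|d| (-1 - lam 0 1 + lam 0 2) * ((-1) ^+ s * (if 0 < d then - 'i%C else 1)) *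
  f ([c unip (- (x + e / d)) 0 0] ∙ [c w_stat]) 1 0.
Proof.
move=> [_ fV] g20 g21 g22 gd ge d0.
have [n Nn ->] := inverse_cell g s d e x y z g20 g21 g22 gd ge d0.
rewrite fV; last 3 first.
- exact: sgn_torus_inMt.
- exact: abs_torus_inA.
- by exists [c n] => //; exists n.
by rewrite abs_torus_character// mxE contragredient_sgn_torus mulrA.
Qed.
End Transform.

Section Decay.
Context {R : realType}.
Local Notation C := R[i].
Variable sigma : SL3 R -> SL3 R -> bool.
Hypothesis sigmaP : is_BLS_cocycle sigma.
Local Notation cmul := (cmul sigma).
Local Notation cinv := (cinv sigma).
Local Notation "g ∙ h" := (cmul g h) (at level 40, left associativity).
Local Notation "[ 'c' g ]" := (to_cover g%g) (format "[ 'c'  g ]").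
Local Notation torus := (@torus R).
Local Notation normc := (@normc R).

Lemma chart_mul (h g : cover R) x : chart sigma (h ∙ g) x = h ∙ chart sigma g x.
Proof. by rewrite /chart !cmulA. Qed.

Lemma act_Vsmooth (mu : 'rV[C]_3) eta (h : cover R) (f : section) :
  Vsmooth sigma mu eta f -> Vsmooth sigma mu eta (act sigma h f).
Proof.
move=> [fs fV]; split; last first.
  by move=> g m a n mM aA nN; rewrite /act !cmulA// fV.
move=> g j; have [cR cI] := fs (cinv h ∙ g) j.
have -> : Re_in_chart sigma (act sigma h f) g j = Re_in_chart sigma f (cinv h ∙ g) j.
  by apply/funext => x; rewrite /Re_in_chart chart_mul.
have -> : Im_in_chart sigma (act sigma h f) g j = Im_in_chart sigma f (cinv h ∙ g) j.
  by apply/funext => x; rewrite /Im_in_chart chart_mul.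
by split.
Qed.

Definition line (v : R) : 'rV[R]_8 := v *: delta_mx 0 1.

Lemma chart_line (g : cover R) (v : R) : chart sigma g (line v) = g ∙ [c unip 0 v 0].
Proof.
have e (i : 'I_8) : line v 0 i = if i == 1 then v else 0.
  by rewrite !mxE eqxx /= ; case: eqP => _; rewrite ?mulr1 ?mulr0.
rewrite /chart !e /= unip0.
have -> : diag_exp 0 0 = 1%g :> SL3 R.
  by apply: SL3_eq; rewrite mat1 mx3_1 /= /diag3 !oppr0 addr0 expR0.
by rewrite !cmulg1// cmulVg// cmulg1.
Qed.

Lemma line_continuous : continuous line.
Proof. by move=> v; apply: cvgZr_tmp; exact: cvg_id. Qed.

Lemma smooth_line_continuous (f : section) (g : cover R) (j : 'I_2) :
  smooth sigma f ->
  continuous (fun v : R => complex.Re (f (g ∙ [c unip 0 v 0]) j 0)) /\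
  continuous (fun v : R => complex.Im (f (g ∙ [c unip 0 v 0]) j 0)).
Proof.
move=> fs; have [cR cI] := fs g j.
have [{}cR _] := cR [::]; have [{}cI _] := cI [::].
split.
  have -> : (fun v : R => complex.Re (f (g ∙ [c unip 0 v 0]) j 0)) = Re_in_chart sigma f g j \o line.
    by apply/funext => v; rewrite /= /Re_in_chart chart_line.
  by move=> v; apply: continuous_comp; [exact: line_continuous|exact: cR].
have -> : (fun v : R => complex.Im (f (g ∙ [c unip 0 v 0]) j 0)) = Im_in_chart sigma f g j \o line.
  by apply/funext => v; rewrite /= /Im_in_chart chart_line.
by move=> v; apply: continuous_comp; [exact: line_continuous|exact: cI].
Qed.

Lemma w_stat_unip (u : R) : [c unip u 0 0] ∙ [c w_stat] = [c w_stat] ∙ [c unip 0 (- u) 0].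
Proof.
rewrite cNmul//; last exact: inN_unip.
have sg : sigma w_stat (unip 0 (- u) 0) = false.
  by rewrite w_stat_torus sigma_tw21_unip//; apply: torus_diag; ring.
rewrite /Defs.cmul/= sg; congr pair; apply: SL3_eq; rewrite !matM !unipE
  -[mat w_stat]/(mx3 0 1 0 0 0 (-1) (-1) 0 0).
by rewrite !mx3_mul; congr mx3; ring.
Qed.

Definition w_stat' : SL3 R := (w_stat * w_alpha2^-1)%g.

Definition sgn_torus' (d : R) : SL3 R := if 0 < d then torus 1 1 1 else torus 1 (-1) (-1).

Lemma sgn_torus'E (d : R) : (sgn_torus' d : 'M[R]_3) =
  if 0 < d then diag3 1 1 1 else diag3 1 (-1) (-1).
Proof. by rewrite /sgn_torus'; case: ifP => _; rewrite torusE//; ring. Qed.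

(* The point at infinity of the circle: n(0, y, 0) is a translate of n(0, -1/y, 0)
   modulo M A N_-. The sign in the cover is irrelevant here. *)
Lemma line_inversion (y : R) : y != 0 -> exists b : bool,
  [c w_stat] ∙ [c unip 0 y 0] = [c w_stat'] ∙ [c unip 0 (- y^-1) 0] ∙
    (sgn_torus' y, b) ∙ [c abs_torus y] ∙
    (cinv [c w_long] ∙ [c unip (- y^-1) 0 0] ∙ [c w_long]).
Proof.
move=> y0.
pose X := [c w_stat'] ∙ [c unip 0 (- y^-1) 0] ∙ [c sgn_torus' y] ∙ [c abs_torus y] ∙
    (cinv [c w_long] ∙ [c unip (- y^-1) 0 0] ∙ [c w_long]).
exists (([c w_stat] ∙ [c unip 0 y 0]).2 (+) X.2); set b := _ (+) _.
have -> : (sgn_torus' y, b) = [c sgn_torus' y] ∙ central b by rewrite cmul_central.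
have cen g h : g ∙ central b ∙ h = g ∙ h ∙ central b.
  by rewrite -!cmulA// central_mulC.
rewrite [_ ∙ ([c sgn_torus' y] ∙ _)]cmulA// !cen -/X /b.
apply: cover_fiber => //; rewrite /X /=.
rewrite /w_stat' -!mulgA; congr (w_stat * _)%g.
suff -> : (w_long^-1 * (unip (- y^-1) 0 0 * w_long))%g =
    ((abs_torus y)^-1 * ((sgn_torus' y)^-1 * (unip 0 (y^-1) 0 * (w_alpha2 * unip 0 y 0))))%g.
  rewrite !mulVKg -[unip 0 (- y^-1) 0]invgK unipV mul0r subr0 oppr0 opprK.
  by rewrite mulKg mulKg.
apply: (mulgI (abs_torus y)); rewrite mulVKg; apply: (mulgI (sgn_torus' y)); rewrite mulVKg.
have wlV : (w_long^-1%g = w_long :> SL3 R).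
  rewrite -[RHS]mulg1 -(mulgV w_long) mulgA (_ : (w_long * w_long)%g = 1%g) ?mul1g//.
  apply: SL3_eq; rewrite (matM _ w_long) mat1 w_longE mx3_mul mx3_1.
  by congr mx3; ring.
rewrite wlV; apply: SL3_eq; rewrite (matM _ (sgn_torus' y)) (matM _ (abs_torus y)).
rewrite (matM _ w_long) (matM _ (unip _ _ _)) w_longE.
rewrite (matM _ (unip 0 y^-1 0)) (matM _ w_alpha2) !unipE sgn_torus'E.
have pV : 1 * `|y|^-1 * `|y| = 1 by rewrite mul1r mulVf// normr_eq0.
rewrite /abs_torus (torusE _ _ _ pV) -[mat w_alpha2]/(mx3 1 0 0 0 0 (-1) 0 1 0).
have [yp|] := ltP 0 y.
  by rewrite gtr0_norm// !mx3_mul; congr mx3; field.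
rewrite le_eqVlt (negbTE y0)/= => yn.
by rewrite ltr0_norm// !mx3_mul; congr mx3; field.
Qed.

Lemma normc_real (a : R) : normc a%:C%C = `|a|.
Proof. by rewrite /= expr0n addr0 sqrtr_sqr. Qed.

Lemma normc_cpow (a : R) (s : C) : normc (cpow a s) = expR (complex.Re s * ln a).
Proof. by rewrite /cpow normcM normc_expi normc_real mulr1 gtr0_norm// expR_gt0. Qed.

Lemma contragredient_sgn_torus' (d : R) (b : bool) (v : 'cV[C]_2) :
  normc ((contragredient phi (cinv (sgn_torus' d, b)) *m v) 1 0) = normc (v 1 0).
Proof.
have [b' ->] : exists b', cinv (sgn_torus' d, b) = (sgn_torus' d, b').
  have V : (sgn_torus' d)^-1%g = sgn_torus' d.
    rewrite -[RHS]mulg1 -(mulgV (sgn_torus' d)) mulgA.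
    rewrite (_ : (sgn_torus' d * sgn_torus' d)%g = 1%g) ?mul1g//.
    apply: SL3_eq; rewrite matM mat1 sgn_torus'E mx3_1.
    by case: ifP => _; rewrite diag3_mul !(mulrNN, mulr1).
  by rewrite /Defs.cinv/= V; eexists.
rewrite /contragredient phiE /= sgn_torus'E.
have d00 (x y z : R) : diag3 x y z 0 0 = x by rewrite mxE.
have d11 (x y z : R) : diag3 x y z 1 1 = y by rewrite mxE.
have [u [-> u1 uu]] : exists u : C, [/\ (-1) ^+ b' = u, normc u = 1 & u * u = 1].
  exists ((-1) ^+ b'); split=> //; case: b'; rewrite ?expr0 ?expr1 ?opprK ?mulrNN ?mulr1//.
    by rewrite normcN normc1.
  by rewrite normc1.
have [_|_] := boolP (0 < d); rewrite d00 d11 ltr10 ?ltrN10 mul1mx.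
  rewrite (invmx_eq _ (u *: 1%:M)); last by rewrite -scalemxAl -scalemxAr mulmx1 scalerA uu scale1r.
  by rewrite linearZ /= tr_scalar_mx -scalemxAl mul1mx mxE normcM u1 mul1r.
rewrite mx2_scale (invmx_eq _ (mx2 (u * 'i%C) 0 0 (- (u * 'i%C)))); last first.
  rewrite mx2_mul mx2_1; congr mx2; try by ring.
    by transitivity (- (u * u) * ('i%C * 'i%C)); [ring|rewrite uu ii; ring].
  by transitivity (- (u * u) * ('i%C * 'i%C)); [ring|rewrite uu ii; ring].
rewrite mx2_tr mx2_col1 mul0r add0r normcM normcN normcM u1 mul1r.
by rewrite /= expr0n add0r expr1n sqrtr1 mul1r.
Qed.

Lemma line_inversion_norm (lam : 'rV[C]_3) (f : section) (y : R) :
  Vsmooth sigma (- lam) (contragredient phi) f -> y != 0 ->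
  normc (f ([c w_stat] ∙ [c unip 0 y 0]) 1 0) =
  normc (cpow `|y| (-1 - lam 0 1 + lam 0 2)) *
  normc (f ([c w_stat'] ∙ [c unip 0 (- y^-1) 0]) 1 0).
Proof.
move=> [_ fV] y0; have [b ->] := line_inversion y y0.
rewrite fV; last 3 first.
- exists false, (~~ (0 < y)); rewrite /= sgn_torus'E; case: ifP => _ /=;
    by rewrite ?expr0 ?expr1 ?mul1r.
- exact: abs_torus_inA.
- by exists [c unip (- y^-1) 0 0] => //; exists (unip (- y^-1) 0 0) => //; exact: inN_unip.
by rewrite abs_torus_character// mxE normcM contragredient_sgn_torus'.
Qed.

Definition decay_weight (lam : 'rV[C]_3) : R := 1 + complex.Re (lam 0 1 - lam 0 2).

Lemma normc_cpow_weight (lam : 'rV[C]_3) (a : R) (n : nat) : n%:R <= decay_weight lam -> 1 <= a ->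
  normc (cpow a (-1 - lam 0 1 + lam 0 2)) <= (a ^+ n)^-1.
Proof.
move=> nw a1; have a0 : 0 < a by exact: lt_le_trans a1.
rewrite normc_cpow -[a in leRHS]lnK// -expRM_natl -expRN ler_expR.
have -> : complex.Re (-1 - lam 0 1 + lam 0 2) = - decay_weight lam.
  rewrite /decay_weight; case: (lam 0 1) (lam 0 2) => [x x'] [y y'] /=; ring.
rewrite mulNr lerN2 ler_wpM2r// ln_ge0//.
Qed.

Lemma flat_section_decay (lam : 'rV[C]_3) (f : section) (B : R) (u : R) :
  Vsmooth sigma (- lam) (contragredient phi) f -> 2 <= decay_weight lam ->
  (forall v, `|v| <= 1 -> normc (f ([c w_stat] ∙ [c unip 0 v 0]) 1 0) <= B) ->
  (forall v, `|v| <= 1 -> normc (f ([c w_stat'] ∙ [c unip 0 v 0]) 1 0) <= B) ->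
  normc (f ([c unip u 0 0] ∙ [c w_stat]) 1 0) <= 2 * B / (1 + u ^+ 2).
Proof.
move=> fV w2 B1 B2; rewrite w_stat_unip.
have B0 : 0 <= B by apply: le_trans (normc_ge0 _) (B1 0 _); rewrite normr0.
have u20 : 0 < 1 + u ^+ 2 by rewrite ltr_pwDl// sqr_ge0.
rewrite ler_pdivlMr//.
have [u1|u1] := leP `|u| 1.
  apply: le_trans (_ : B * (1 + u ^+ 2) <= _).
    by rewrite ler_wpM2r ?(ltW u20)// B1// normrN.
  rewrite [leRHS]mulrC ler_wpM2l//; have : u ^+ 2 <= 1 by rewrite -real_normK ?num_real// expr_le1.
  by lra.
have u0 : - u != 0 by rewrite oppr_eq0 -normr_gt0 (lt_trans _ u1).
rewrite (line_inversion_norm _ _ _ fV u0).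
have c1 := normc_cpow_weight lam `|- u| 2 w2; rewrite normrN in c1 *.
have := B2 (- (- u)^-1); rewrite normrN normfV normrN.
rewrite invf_le1 ?(lt_trans ltr01 u1)// => /(_ (ltW u1)) h.
have u2 : 1 <= u ^+ 2 by rewrite -real_normK ?num_real// exprn_ege1// ltW.
apply: le_trans (_ : (`|u| ^+ 2)^-1 * B * (1 + u ^+ 2) <= _).
  by rewrite ler_wpM2r ?(ltW u20)// ler_pM ?normc_ge0// c1// ltW.
rewrite real_normK ?num_real// -mulrA mulrCA [leRHS]mulrC ler_wpM2l//.
by rewrite mulrC ler_pdivrMr ?(lt_le_trans ltr01 u2)//; lra.
Qed.

Lemma exists_line_bound (lam : 'rV[C]_3) (f : section) (g : cover R) :
  smooth sigma f ->
  exists B, forall v, `|v| <= 1 -> normc (f (g ∙ [c unip 0 v 0]) 1 0) <= B.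
Proof.
move=> fs; have [cR cI] := smooth_line_continuous f g 1 fs.
have pair_bound (h : R -> R) : continuous h -> exists B, forall v, `|v| <= 1 -> `|h v| <= B.
  move=> ch; have cn : {within `[-1, 1], continuous (fun v => `|h v|)}.
    apply: continuous_subspaceT => v; apply: continuous_comp; first exact: ch.
    exact: norm_continuous.
  have n11 : -1 <= 1 :> R by lra.
  have [c _ cP] := EVT_max n11 cn.
  by exists `|h c| => v; rewrite ler_norml => v1; apply: cP; rewrite in_itv.
have [B1 h1] := pair_bound _ cR; have [B2 h2] := pair_bound _ cI.
by exists (B1 + B2) => v v1; apply: le_trans (normc_le _) _; rewrite lerD ?h1 ?h2.
Qed.
End Decay.

(** * Cosets in the cell *)

Lemma unip_mat (T : comUnitRingType) (x y z : T) :
  (unip x y z : 'M[T]_3) = mx3 1 x z 0 1 y 0 0 1.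
Proof. by []. Qed.

Section Cell.
Context {R : realType}.

Definition in_cell (d e : int) (g : SL3 int) : Prop :=
  [/\ g 2 0 = 0, g 2 1 = 0, g 2 2 = 1, g 1 0 = d & g 1 1 = e].

Lemma in_cell_det d e g : in_cell d e g -> g 0 0 * e - g 0 1 * d = 1.
Proof.
move=> [g20 g21 g22 gd ge]; rewrite -(eqP (det_mat g)) [X in \det X]mx3_eta det_mx3.
by rewrite g20 g21 g22 gd ge !(mulr0, mulr1, subr0, addr0).
Qed.

Lemma SL3_intrE (g : SL3 int) i j : SL3_intr R g i j = (g i j)%:~R.
Proof. by rewrite mxE. Qed.

Lemma cell_alpha1_in_cell (g : SL3 int) : cell_alpha1 (R := R) g ->
  exists d e, [/\ in_cell d e g, d != 0, (4 %| d)%Z & (e = 1 %[mod 4])%Z].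
Proof.
move=> [gG [n [b [[x [y [z ->]]] bB gE]]]].
have E i j : (g i j)%:~R = (unip x y z * w_alpha1 * b)%g i j :> R.
  by rewrite -gE SL3_intrE.
have bE : (b : 'M[R]_3) = mx3 (b 0 0) (b 0 1) (b 0 2) 0 (b 1 1) (b 1 2) 0 0 (b 2 2).
  by rewrite [LHS]mx3_eta (bB 1 0 isT) (bB 2 0 isT) (bB 2 1 isT).
have prodE : (unip x y z * w_alpha1 * b)%g =
    mx3 (x * b 0 0) (x * b 0 1 - b 1 1) (x * b 0 2 - b 1 2 + z * b 2 2)
        (b 0 0) (b 0 1) (b 0 2 + y * b 2 2) 0 0 (b 2 2) :> 'M[R]_3.
  by rewrite -mulgA !matM [mat b in LHS]bE w1_mx3 unipE mx3_mul; congr mx3; ring.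
have g20 : g 2 0 = 0 by apply/eqP; rewrite -(intr_eq0 R) E prodE mxE.
have g21 : g 2 1 = 0 by apply/eqP; rewrite -(intr_eq0 R) E prodE mxE.
have b00 : b 0 0 != 0.
  have db : b 0 0 * b 1 1 * b 2 2 = 1.
    by rewrite -(eqP (det_mat b)) [X in \det X]bE det_mx3; ring.
  by apply: contra_eq_neq db => ->; rewrite !mul0r eq_sym oner_eq0.
have d0 : g 1 0 != 0 by rewrite -(intr_eq0 R) E prodE mxE.
have g4 := gG 2 2 isT; have g4' := gG 1 0 isT; have g4'' := gG 1 1 isT.
have dg : (g 0 0 * g 1 1 - g 0 1 * g 1 0) * g 2 2 = 1.
  by rewrite -(eqP (det_mat g)) [X in \det X]mx3_eta det_mx3 g20 g21; ring.
have g22 : g 2 2 = 1.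
  have : g 2 2 \is a GRing.unit by apply/unitrPr; exists (g 0 0 * g 1 1 - g 0 1 * g 1 0); rewrite mulrC.
  rewrite qualifE/= => /orP[/eqP->//|/eqP gn]; move: g4; rewrite gn /=; lia.
exists (g 1 0), (g 1 1); split => //.
  by rewrite -[g 1 0]subr0 -eqz_mod_dvd.
by move: g4'' => /= /eqP ->.
Qed.

Lemma cell_bezout (d e : int) : coprimez d e -> exists a b, a * e - b * d = 1.
Proof.
move=> /coprimezP[[u v] /= uv]; exists v, (- u).
by rewrite mulNr opprK addrC.
Qed.

Lemma det_cell_rep (a b d e : int) : a * e - b * d = 1 ->
  \det (mx3 a b 0 d e 0 0 0 1) == 1.
Proof. by move=> h; rewrite det_mx3 !(mulr0, mulr1, subr0, addr0) h. Qed.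

Lemma cell_rep_exists (d e : int) : d != 0 -> (4 %| d)%Z -> (e = 1 %[mod 4])%Z ->
  coprimez d e -> exists2 g, in_cell d e g & cell_alpha1 (R := R) g.
Proof.
move=> d0 d4 e1 de; have [a [b ab]] := cell_bezout d e de.
pose g := MkSL3 (det_cell_rep a b d e ab).
have gE : (g : 'M[int]_3) = mx3 a b 0 d e 0 0 0 1 by [].
exists g; first by split; rewrite gE mxE.
have a1 : (a = 1 %[mod 4])%Z.
  have [k dk] : exists k, d = 4 * k by exists (d %/ 4)%Z; lia.
  have [j ej] : exists j, e = 1 + 4 * j by exists ((e - 1) %/ 4)%Z; lia.
  have -> : a = 1 + 4 * (b * k - a * j) by rewrite -[X in X + _]ab dk ej; ring.
  by move: (b * k - a * j) => m; lia.
split.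
  move=> i j; rewrite gE mxE.
  case: i => -[|[|[|//]]] ?; case: j => -[|[|[|//]]] ? //= _; apply/eqP;
    by rewrite ?a1 ?e1 //; lia.
have dR : d%:~R != 0 :> R by rewrite intr_eq0.
have bdet : \det (mx3 d%:~R e%:~R 0 0 d%:~R^-1 0 0 0 1 : 'M[R]_3) == 1.
  by rewrite det_mx3 !(mulr0, mul0r, mulr1, subr0, addr0) mulfV.
exists (unip (a%:~R / d%:~R) 0 0), (MkSL3 bdet); split; first exact: inN_unip.
  move=> i j; rewrite mxE.
  by case: i => -[|[|[|//]]] ?; case: j => -[|[|[|//]]] ?.
apply: SL3_eq; rewrite -mulgA !matM /= w1_mx3 mx3_mul.
have abR : a%:~R * e%:~R - b%:~R * d%:~R = 1 :> R by rewrite -!rmorphM -rmorphB ab.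
have -> : map_mx intr (mx3 a b 0 d e 0 0 0 1) =
    mx3 a%:~R b%:~R 0 d%:~R e%:~R 0 0 0 1 :> 'M[R]_3.
  apply/matrixP => i j; rewrite !mxE.
  by case: i => -[|[|[|//]]] ?; case: j => -[|[|[|//]]] ?.
have bd : b%:~R * d%:~R = a%:~R * e%:~R - 1 :> R by lra.
have -> : b%:~R = (a%:~R * e%:~R - 1) / d%:~R :> R by rewrite -bd mulfK.
by congr mx3; field.
Qed.

Lemma coset_same (d e : int) (g h : SL3 int) : in_cell d e g -> in_cell d e h ->
  Ginf_coset g = Ginf_coset h.
Proof.
have half (g' h' : SL3 int) : in_cell d e g' -> in_cell d e h' -> exists2 n, inN n & g' = (n * h')%g.
  move=> cg ch; have dg := in_cell_det _ _ _ cg; have dh := in_cell_det _ _ _ ch.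
  exists (unip (h' 0 0 * g' 0 1 - h' 0 1 * g' 0 0) (g' 1 2 - h' 1 2)
    (g' 0 2 - h' 0 2 - (h' 0 0 * g' 0 1 - h' 0 1 * g' 0 0) * h' 1 2)).
    exact: inN_unip.
  move: cg ch => [g20 g21 g22 gd ge] [h20 h21 h22 hd he].
  apply: SL3_eq; rewrite matM unip_mat [LHS]mx3_eta [X in _ *m X](mx3_eta _ h') mx3_mul.
  rewrite g20 g21 g22 gd ge h20 h21 h22 hd he.
  congr mx3; try by ring.
    transitivity (g' 0 0 * (h' 0 0 * e - h' 0 1 * d) -
        h' 0 0 * (g' 0 0 * e - g' 0 1 * d - 1)); first by rewrite dg dh; ring.
    by ring.
  transitivity (g' 0 1 * (h' 0 0 * e - h' 0 1 * d) -
      h' 0 1 * (g' 0 0 * e - g' 0 1 * d - 1)); first by rewrite dg dh; ring.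
  by ring.
move=> cg ch; apply/seteqP; split=> k [n Nn <-].
  have [m Nm ->] := half _ _ cg ch; exists (n * m)%g; rewrite ?mulgA//; exact: inN_mul.
have [m Nm ->] := half _ _ ch cg; exists (n * m)%g; rewrite ?mulgA//; exact: inN_mul.
Qed.

Lemma coset_rep (d e : int) (g h : SL3 int) : in_cell d e g -> Ginf_coset g h ->
  in_cell d e h.
Proof.
move=> [g20 g21 g22 gd ge] [n [x [y [z ->]]] <-].
have E : (unip x y z * g)%g = mx3 (g 0 0 + x * d) (g 0 1 + x * e) (g 0 2 + x * g 1 2 + z)
    d e (g 1 2 + y) 0 0 1 :> 'M[int]_3.
  rewrite matM unip_mat [X in _ *m X](mx3_eta _ g) mx3_mul g20 g21 g22 gd ge.
  by congr mx3; ring.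
by split; rewrite E mxE.
Qed.

Lemma coset_refl (g : SL3 int) : Ginf_coset g g.
Proof. by exists 1%g; [exact: inN1|rewrite mul1g]. Qed.
End Cell.

Section Index.
Context {R : realType}.

(* The pairs (d, e) with d = 4 B_2 and e = - C_2 = 1 mod 4 are (- 4c, r) for r = 1 and
   (4c, - r) for r = 3 mod 4, where c > 0. *)
Definition cell_index : set (nat * int) := [set k | [/\ (0 < k.1)%N, odd `|k.2|%N &
  coprime (4 * k.1) `|k.2|%N]].
Definition cell_index_d (k : nat * int) : int :=
  if (k.2 %% 4 == 3)%Z then (4 * k.1)%N%:Z else - (4 * k.1)%N%:Z.
Definition cell_index_e (k : nat * int) : int :=
  if (k.2 %% 4 == 3)%Z then - k.2 else k.2.

Definition cell_index_coset (k : nat * int) : set (SL3 int) :=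
  [set g | in_cell (cell_index_d k) (cell_index_e k) g].

Lemma Ginf_cosetE d e g : in_cell d e g -> Ginf_coset g = [set h | in_cell d e h].
Proof.
move=> cg; apply/seteqP; split=> h; first exact: coset_rep.
by move=> ch; rewrite (coset_same d e g h)//; exact: coset_refl.
Qed.

Lemma cell_index_rep k : cell_index k ->
  exists2 g, in_cell (cell_index_d k) (cell_index_e k) g & cell_alpha1 (R := R) g.
Proof.
move=> [c0 ok co]; apply: cell_rep_exists.
- by rewrite /cell_index_d; case: ifP; lia.
- by rewrite /cell_index_d; case: ifP; lia.
- by rewrite /cell_index_e; case: ifP; lia.
- by rewrite /coprimez /gcdz /cell_index_d /cell_index_e; case: ifP => _; rewrite ?abszN; exact/eqP/congr1/eqP.
Qed.

Lemma cell_index_bij :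
  set_bij cell_index [set Ginf_coset g | g in cell_alpha1 (R := R)] cell_index_coset.
Proof.
split.
- by move=> k /cell_index_rep [g cg gc]; exists g => //; exact: Ginf_cosetE.
- move=> [c r] [c' r'] /set_mem kI /set_mem kI' kk.
  have [g cg _] := cell_index_rep _ kI.
  have : cell_index_coset (c', r') g by rewrite -kk.
  case: cg => [_ _ _ gd ge] [_ _ _ gd' ge'].
  move: gd ge; rewrite gd' ge' => {gd' ge' kk}; move: kI kI' => [/= c0 _ _] [/= c0' _ _].
  rewrite /cell_index_d /cell_index_e /=.
  by case: (boolP (r %% 4 == 3)%Z) => ?; case: (boolP (r' %% 4 == 3)%Z) => ? ? ?;
    congr pair; lia.
move=> _ [g gc <-]; have [d [e [cg d0 d4 e1]]] := cell_alpha1_in_cell _ gc.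
have co : coprime `|d|%N `|e|%N.
  have := in_cell_det _ _ _ cg => dg.
  rewrite -/(coprimez d e); apply/coprimezP; exists (- g 0 1, g 0 0) => /=.
  by rewrite -dg; ring.
have oe : odd `|e|%N by lia.
exists ((`|d| %/ 4)%N, if 0 < d then - e else e).
  split=> /=; first by lia.
    by case: ifP; rewrite ?abszN.
  rewrite (_ : 4 * (`|d| %/ 4) = `|d|)%N; last by lia.
  by case: ifP => _; rewrite ?abszN.
rewrite (Ginf_cosetE _ _ _ cg) /cell_index_coset /cell_index_d /cell_index_e /=.
have [dp|dn] := ltP 0 d.
  have -> : ((- e) %% 4 == 3)%Z by lia.
  by rewrite opprK (_ : (4 * (`|d| %/ 4))%N%:Z = d)//; lia.
have -> : (e %% 4 == 3)%Z = false by lia.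
by rewrite (_ : - (4 * (`|d| %/ 4))%N%:Z = d)//; lia.
Qed.
End Index.

Section TermValue.
Context {R : realType}.
Local Notation C := R[i].
Variable sigma : SL3 R -> SL3 R -> bool.
Hypothesis sigmaP : is_BLS_cocycle sigma.
Local Notation cmul := (cmul sigma).
Local Notation cinv := (cinv sigma).
Local Notation "g ∙ h" := (cmul g h) (at level 40, left associativity).
Local Notation "[ 'c' g ]" := (to_cover g%g) (format "[ 'c'  g ]").

Definition kloosterman_coef (c r : nat) : C :=
  if odd r then eps r ^ (- 1) * (kronecker (4 * c)%N%:Z r%:Z)%:~R else 0.

Lemma kloosterman_coefE (m : int) (c : nat) : kloosterman 1 m c =
  \sum_(r < 4 * c) kloosterman_coef c r * expi (2 * pi * (m%:~R * r%:R / (4 * c)%N%:R)) :> C.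
Proof.
rewrite /kloosterman big_mkcond; apply: eq_bigr => r _; rewrite /kloosterman_coef.
by case: ifP => _; rewrite ?mul0r.
Qed.

Lemma kloosterman_coef_coprime (c r : nat) : (0 < c)%N -> ~~ coprime (4 * c) r ->
  kloosterman_coef c r = 0.
Proof.
move=> c0 nco; rewrite /kloosterman_coef; case: ifP => // or_.
have := jacobi_sqr (4 * c)%N%:Z r or_; rewrite absz_nat (negbTE nco) => /eqP.
by rewrite sqrf_eq0 kroneckerE ?odd_gt0// => /eqP->; rewrite mulr0.
Qed.

Lemma kloosterman_coef_mod (c : nat) (r : int) : (0 < c)%N -> ~ cell_index (c, r) ->
  kloosterman_coef c `|(r %% (4 * c)%N)%Z|%N = 0.
Proof.
move=> c0 nI; set r' := `|_|%N.
have c4 : (4 * c)%N%:Z != 0 by lia.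
have r'E : r'%:Z = (r %% (4 * c)%N)%Z by rewrite gez0_abs// modz_ge0.
have par : odd r' = odd `|r|%N.
  have := divz_eq r (4 * c)%N; rewrite -r'E => ->.
  by move: (r %/ _)%Z => q; rewrite PoszM; lia.
have cop : coprime (4 * c) r' = coprime (4 * c) `|r|%N.
  have := gcdz_modr (4 * c)%N r; rewrite -r'E /gcdz !absz_nat => -[E].
  by rewrite /coprime E.
have [or_|er] := boolP (odd r'); last by rewrite /kloosterman_coef (negbTE er).
apply: kloosterman_coef_coprime => //; rewrite cop; apply/negP => co.
by apply: nI; split => //=; rewrite -par.
Qed.

Lemma eisenstein_term_act (K : set (SL3 int)) (h : cover R) (f : section) :
  eisenstein_term sigma K (act sigma h f) =
  f (cinv (splitting_alpha1 (xget 1%g K) ∙ h) ∙ [c w_long]) 0 0.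
Proof.
rewrite /eisenstein_term /dact /tau /act cinvK//.
by rewrite cinvM// cmulA.
Qed.

Lemma term_value (lam : 'rV[C]_3) (f : section) (c : nat) (r : int) (x y z : R) :
  Vsmooth sigma (- lam) (contragredient phi) f -> cell_index (c, r) ->
  eisenstein_term sigma (cell_index_coset (c, r)) (act sigma [c unip x y z] f) =
  cpow (4 * c)%N%:R (-1 - lam 0 1 + lam 0 2) * kloosterman_coef c `|(r %% (4 * c)%N)%Z|%N *
  f ([c unip (r%:~R / (4 * c)%N%:R - x) 0 0] ∙ [c w_stat]) 1 0.
Proof.
move=> fV rI; have [c0 or_ co] := rI; rewrite /= in c0 or_ co.
rewrite eisenstein_term_act; set g := xget _ _.
have cg : in_cell (cell_index_d (c, r)) (cell_index_e (c, r)) g.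
  by have [h ch _] := @cell_index_rep R _ rI; exact: (@xgetI _ 1%g (cell_index_coset (c, r)) h ch).
set d := cell_index_d _ in cg *; set e := cell_index_e _ in cg *.
have [g20 g21 g22 gd ge] := cg.
have dR : d%:~R != 0 :> R by rewrite intr_eq0 /d /cell_index_d /=; case: ifP; lia.
have cR : (4 * c)%N%:R != 0 :> R by rewrite pnatr_eq0; lia.
rewrite /splitting_alpha1.
rewrite (cell_value _ sigmaP lam f (SL3_intr R g) _ d%:~R e%:~R x y z fV); last 6 first.
- by rewrite SL3_intrE g20.
- by rewrite SL3_intrE g21.
- by rewrite SL3_intrE g22.
- by rewrite SL3_intrE gd.
- by rewrite SL3_intrE ge.
- by [].
have -> : plB2 g = d by rewrite /plB2 g20 g22 gd mulr1 mulr0 subr0.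
have -> : - plC2 g = e by rewrite /plC2 g21 g22 ge opprK mulr1 mulr0 subr0.
have -> : `|d%:~R| = (4 * c)%N%:R :> R.
  by rewrite /d /cell_index_d /=; case: ifP => _; rewrite ?rmorphN/= ?normrN normr_nat.
have -> : - (x + e%:~R / d%:~R) = r%:~R / (4 * c)%N%:R - x :> R.
  rewrite opprD addrC; congr (_ - _); rewrite /d /e /cell_index_d /cell_index_e /=.
  case: ifP => _; rewrite rmorphN/= ?mulNr ?opprK//.
  by rewrite invrN mulrN opprK.
congr (_ * _); congr (_ * _).
set k := kronecker _ _.
have r4 : (r %% 4 == 1)%Z \/ (r %% 4 == 3)%Z by lia.
have c4 : (4 * c)%N%:Z != 0 by lia.
set r' := `|_|%N.
have r'E : r'%:Z = (r %% (4 * c)%N)%Z by rewrite gez0_abs// modz_ge0.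
have r'4 : (r' %% 4)%N%:Z = (r %% 4)%Z.
  rewrite -modz_nat r'E {2}(divz_eq r (4 * c)%N); move: (r %/ _)%Z (r %% _)%Z => q w.
  by rewrite PoszM; lia.
have or' : odd r' by lia.
have kE : k = kronecker (4 * c)%N%:Z r'%:Z.
  rewrite /k /d /e /cell_index_d /cell_index_e /=; case: ifP => h.
    rewrite (_ : ((4 * c)%N %/ 4)%Z = c); last by lia.
    by rewrite kronecker_pos_cell ?opprK//; lia.
  rewrite (_ : ((- (4 * c)%N%:Z) %/ 4)%Z = - c%:Z); last by lia.
  by rewrite kronecker_neg_cell//; lia.
have k1 : k = 1 \/ k = -1.
  have := jacobi_sqr (4 * c)%N%:Z r' or'; rewrite -kroneckerE ?odd_gt0// -kE absz_nat.
  have -> : coprime (4 * c) r'.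
    have := gcdz_modr (4 * c)%N r; rewrite -r'E /gcdz !absz_nat => -[E].
    by rewrite /coprime E; exact: co.
  by move=> /eqP; rewrite sqrf_eq1 => /orP[/eqP|/eqP]; [left|right].
have -> : (-1) ^+ (k == -1) = k%:~R :> C.
  by case: k1 => ->; rewrite ?eqxx ?expr1 ?mulrN1z ?mulr1z.
rewrite /kloosterman_coef or' -kE mulrC; congr (_ * _).
have dpos : (0 < d%:~R :> R) = (r %% 4 == 3)%Z.
  rewrite /d /cell_index_d /=; case: ifP => _; rewrite ltr0z; lia.
rewrite dpos /eps; have -> : (r' %% 4 == 1)%N = (r %% 4 == 1)%Z by rewrite -eqz_nat r'4.
case: r4 => /eqP ->; rewrite /= ?expr1z.
  by rewrite exprN1 invr1.
by rewrite exprN1; apply/eqP; rewrite eq_complex /=; apply/andP; split; apply/eqP; field.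
Qed.
End TermValue.

(** * The Eisenstein distribution *)

Section Bounds.
Context {R : realType}.

Lemma oneDsqr_gt0 (x : R) : 0 < 1 + x ^+ 2.
Proof. by rewrite ltr_pwDl// sqr_ge0. Qed.

(* Comparison with the telescoping series of 1/((n+1)(n+2)). *)
Lemma rsummable_nat : rsummable [set: nat] (fun n => (1 + n%:R ^+ 2)^-1 : R).
Proof.
rewrite /rsummable /summable -nneseries_esumT//.
apply: (@le_lt_trans _ _ 4%:E); last by rewrite ltry.
apply: lime_le; first exact: is_cvg_nneseries.
apply: nearW => n; rewrite /=.
rewrite sumEFin lee_fin big_mkord.
apply: (@le_trans _ _ (4 - 4 / (n.+1)%:R)); last first.
  by rewrite gerBl divr_ge0.
elim: n => [|n IH]; first by rewrite big_ord0 divr1 subrr.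
rewrite big_ord_recr /=; apply: le_trans (lerD IH (lexx _)) _.
rewrite ger0_norm; last by rewrite invr_ge0 ltW// oneDsqr_gt0.
rewrite -[n.+2%:R]natr1 -[n.+1%:R]natr1.
have n0 : 0 <= n%:R :> R by exact: ler0n.
move: (n%:R) n0 => t t0.
have -> : 4 / (t + 1 + 1) = 4 / (t + 1) - 4 / ((t + 1) * (t + 2)).
  by field; apply/andP; split; apply: lt0r_neq0; lra.
suff h : (1 + t ^+ 2)^-1 <= 4 / ((t + 1) * (t + 2)).
  by move: h; move: (_^-1) (4 / (t + 1)) (4 / (_ * _)) => a b c; lra.
rewrite invf_ple ?posrE ?oneDsqr_gt0//; last first.
  by rewrite divr_gt0// mulr_gt0//; lra.
by rewrite invf_div ler_pdivrMr//; nra.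
Qed.

Lemma rsummable_int : rsummable [set: int] (fun r => (1 + r%:~R ^+ 2)^-1 : R).
Proof.
rewrite /rsummable /summable.
rewrite (@esumID _ _ (range Posz) setT)// !setTI.
have nat_part (e : nat -> int) (S : set int) : set_bij [set: nat] S e ->
    (forall n, (n <= `|e n|)%N) ->
    (\esum_(r in S) `|(1 + r%:~R ^+ 2)^-1%:E : \bar R| < +oo)%E.
  move=> be en; rewrite (reindex_esum _ _ _ _ be).
  apply: le_lt_trans rsummable_nat; apply: le_esum => n _.
  rewrite !abse_EFin lee_fin !ger0_norm ?invr_ge0 ?(ltW (oneDsqr_gt0 _))//.
  rewrite lef_pV2 ?posrE ?oneDsqr_gt0// lerD2l -[_%:~R ^+ 2]real_normK ?num_real//.
  by rewrite -intr_norm -abszE /= -pmulrn lerXn2r ?nnegrE// ler_nat.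
apply: lte_add_pinfty.
  apply: (nat_part Posz) => //; split=> [n _|m n _ _ []//|r [n _ <-]]; by exists n.
apply: (nat_part Negz) => [|n]; last by rewrite NegzE abszN absz_nat.
split=> [n _ []//|m n _ _ []//|r /= rn].
by case: r rn => n rn; [case: rn; exists n|exists n].
Qed.

Lemma rsummable_prod {I J : choiceType} (D : set I) (E : I -> set J) (F : set J)
    (u : I -> R) (v : J -> R) : (forall i, E i = F) ->
  rsummable D u -> rsummable F v -> rsummable (D `*`` E) (fun k => u k.1 * v k.2).
Proof.
move=> EF su sv.
have su' := rsummable_norm _ _ su; have sv' := rsummable_norm _ _ sv.
rewrite /rsummable /summable.
rewrite -(@esum_esum _ _ _ D E (fun i j => `|(u i * v j)%:E|%E))//.
pose V := esumR F (fun j => `|v j|).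
have VE : (V%:E = \esum_(j in F) `|v j|%:E)%E by apply: esum_fin => // j _.
apply: le_lt_trans (rsummableZ _ V _ su').
apply: le_esum => i _; rewrite EF.
have V0 : 0 <= V by rewrite fine_ge0// esum_ge0// => j _; rewrite lee_fin.
rewrite abse_EFin normrM normr_id (ger0_norm V0) mulrC EFinM VE.
rewrite (@eq_esum _ _ _ _ (fun j => (`|u i| * `|v j|)%:E)); last first.
  by move=> j _; rewrite abse_EFin normrM.
exact: esumRZ_le.
Qed.

Lemma poly_domination (D r x B : R) : 1 <= D -> 0 <= B -> `|x| <= 1 ->
  (D ^+ 4)^-1 * (2 * B / (1 + (r / D - x) ^+ 2)) <= 6 * B * ((D ^+ 2)^-1 * (1 + r ^+ 2)^-1).
Proof.
move=> D1 B0 x1; have D0 : 0 < D by lra.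
set t := r / D; have rE : r = t * D by rewrite /t mulfVK// gt_eqF.
have x2 : x ^+ 2 <= 1 by rewrite -real_normK ?num_real// expr_le1.
have -> : (D ^+ 4)^-1 = (D ^+ 2)^-1 * (D ^+ 2)^-1 by rewrite -invfM -exprD.
rewrite -[leLHS]mulrA [leRHS]mulrCA ler_wpM2l ?invr_ge0 ?sqr_ge0//.
have -> : 6 * B * (1 + r ^+ 2)^-1 = 2 * B * (3 * (1 + r ^+ 2)^-1) by ring.
rewrite mulrCA; apply: ler_wpM2l; first by lra.
rewrite -invfM ler_pdivlMr ?oneDsqr_gt0// mulrC ler_pdivrMr ?mulr_gt0 ?oneDsqr_gt0 ?exprn_gt0//.
have key : (1 + t ^+ 2) / 3 <= 1 + (t - x) ^+ 2.
  have := sqr_ge0 (2 * t - 3 * x); have := sqr_ge0 x.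
  move: (t) => s h1 h2; rewrite ler_pdivrMr//.
  have -> : (1 + (s - x) ^+ 2) * 3 = (1 + s ^+ 2) +
    ((2 * s - 3 * x) ^+ 2 / 2 + x ^+ 2 / 2 + 2 * (1 - x ^+ 2)) by field.
  lra.
have h : (1 + r ^+ 2) <= D ^+ 2 * (1 + t ^+ 2).
  rewrite rE exprMn; have : 1 <= D ^+ 2 by rewrite exprn_ege1.
  by nra.
have := ler_wpM2l (sqr_ge0 D) key; move: h; lra.
Qed.
End Bounds.

Section Eisenstein.
Context {R : realType}.
Local Notation C := R[i].
Variable sigma : SL3 R -> SL3 R -> bool.
Hypothesis sigmaP : is_BLS_cocycle sigma.
Local Notation cmul := (cmul sigma).
Local Notation cinv := (cinv sigma).
Local Notation "g ∙ h" := (cmul g h) (at level 40, left associativity).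
Local Notation "[ 'c' g ]" := (to_cover g%g) (format "[ 'c'  g ]").
Local Notation normc := (@normc R).
Variable lam : 'rV[C]_3.
Hypothesis lamP : 4 <= decay_weight lam.
Local Notation V := (Vsmooth sigma (- lam) (contragredient phi)).
Local Notation cosets := [set Ginf_coset g | g in cell_alpha1 (R := R)].

Definition pairs : set (nat * int) := [set c | (0 < c)%N] `*`` (fun=> [set: int]).

Definition pair_bound (k : nat * int) : R := (1 + k.1%:R ^+ 2)^-1 * (1 + k.2%:~R ^+ 2)^-1.

Lemma pair_bound_summable : rsummable pairs pair_bound.
Proof.
apply: (@rsummable_prod R _ _ [set c | (0 < c)%N] (fun=> [set: int]) [set: int]
  (fun c => (1 + c%:R ^+ 2)^-1) (fun r => (1 + r%:~R ^+ 2)^-1)) => //.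
  apply: le_lt_trans (@rsummable_nat R).
  rewrite [leLHS]esum_mkcond; apply: le_esum => c _; case: ifP => _//.
exact: rsummable_int.
Qed.

Definition stat_line (f : section) (u : R) : C := f ([c unip u 0 0] ∙ [c w_stat]) 1 0.

Definition cell_term (f : section) (x : R) (k : nat * int) : C :=
  cpow (4 * k.1)%N%:R (-1 - lam 0 1 + lam 0 2) * kloosterman_coef k.1 `|(k.2 %% (4 * k.1)%N)%Z|%N *
  stat_line f (k.2%:~R / (4 * k.1)%N%:R - x).

Lemma normc_kloosterman_coef (c r : nat) : (0 < c)%N -> normc (kloosterman_coef c r) <= 1.
Proof.
move=> c0; rewrite /kloosterman_coef; case: ifP => [or_|_]; last by rewrite normc0.
rewrite normcM kroneckerE ?odd_gt0//.
have -> : normc (eps r ^ (- 1)) = 1.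
  rewrite exprN1 normcV; have -> : normc (eps r) = 1; last by rewrite invr1.
  by rewrite /eps; case: ifP => _; rewrite ?normc1//= expr0n add0r expr1n sqrtr1.
have := jacobi_sqr (4 * c)%N%:Z r or_; move: (jacobi _ _) => j.
have [_ /eqP|_ /eqP] := boolP (coprime _ _).
  rewrite sqrf_eq1 => /orP[/eqP->|/eqP->]; rewrite mul1r ?mulrN1z ?normcN normc1//.
by rewrite sqrf_eq0 => /eqP->; rewrite mul1r normc0.
Qed.

Definition line_bound (f : section) (B : R) := forall v, `|v| <= 1 ->
  normc (f ([c w_stat] ∙ [c unip 0 v 0]) 1 0) <= B /\
  normc (f ([c w_stat'] ∙ [c unip 0 v 0]) 1 0) <= B.

Lemma line_bound_exists f : V f -> exists2 B, 0 <= B & line_bound f B.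
Proof.
move=> [fs _]; have [B1 h1] := exists_line_bound sigma sigmaP lam f [c w_stat] fs.
have [B2 h2] := exists_line_bound sigma sigmaP lam f [c w_stat'] fs.
exists (Num.max B1 B2).
  by rewrite le_max (le_trans (normc_ge0 _) (h1 0 _))// normr0.
by move=> v v1; split; rewrite le_max ?h1// h2// orbT.
Qed.

Lemma line_bound_ge0 f B : line_bound f B -> 0 <= B.
Proof. by move=> /(_ 0); rewrite normr0 => /(_ ler01)[+ _]; apply: le_trans; exact: normc_ge0. Qed.

Lemma cell_term_bound f B x k : V f -> line_bound f B -> `|x| <= 1 -> pairs k ->
  normc (cell_term f x k) <= 6 * B * pair_bound k.
Proof.
move=> fV fB x1 [/= c0 _]; have B0 := line_bound_ge0 _ _ fB.
case: k c0 => c r /= c0.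
have D1 : 1 <= (4 * c)%N%:R :> R by rewrite ler1n; lia.
have w2 : 2 <= decay_weight lam by apply: le_trans lamP; lra.
rewrite /cell_term /= normcM [normc (_ * kloosterman_coef _ _)]normcM.
have h1 := normc_cpow_weight lam _ 4 lamP D1.
have h2 := normc_kloosterman_coef c `|(r %% (4 * c)%N)%Z|%N c0.
have h3 := flat_section_decay sigma sigmaP lam f B (r%:~R / (4 * c)%N%:R - x) fV w2
  (fun v v1 => (fB v v1).1) (fun v v1 => (fB v v1).2).
apply: (@le_trans _ _ (((4 * c)%N%:R ^+ 4)^-1 *
    (2 * B / (1 + (r%:~R / (4 * c)%N%:R - x) ^+ 2)))).
  apply: ler_pM => //; rewrite ?mulr_ge0 ?normc_ge0//.
  by rewrite -[leRHS]mulr1; apply: ler_pM => //; exact: normc_ge0.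
apply: le_trans (poly_domination _ _ _ _ D1 B0 x1) _.
rewrite ler_wpM2l ?mulr_ge0// /pair_bound /= ler_wpM2r ?invr_ge0 ?(ltW (oneDsqr_gt0 _))//.
rewrite lef_pV2 ?posrE ?oneDsqr_gt0 ?exprn_gt0 ?(lt_le_trans ltr01 D1)//.
have c1 : 1 <= c%:R :> R by rewrite ler1n.
rewrite natrM exprMn; nra.
Qed.

Lemma cell_term_summable f x : V f -> `|x| <= 1 -> csumm pairs (cell_term f x).
Proof.
move=> fV x1; have [B _ fB] := line_bound_exists _ fV.
apply: csumm_le (rsummableZ _ (6 * B) _ pair_bound_summable) => k kP.
exact: cell_term_bound.
Qed.

Lemma cell_index_pairs : cell_index `<=` pairs.
Proof. by move=> [c r] [/= c0 _ _]. Qed.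

Lemma cell_term_out f x k : pairs k -> ~ cell_index k -> cell_term f x k = 0.
Proof.
case: k => c r [/= c0 _] nI; rewrite /cell_term /= (kloosterman_coef_mod c r c0 nI).
by rewrite mulr0 mul0r.
Qed.

Lemma eisenstein_sum f (x y z : R) : V f -> `|x| <= 1 ->
  csumm cosets (fun K => eisenstein_term sigma K (act sigma [c unip x y z] f)) /\
  csum cosets (fun K => eisenstein_term sigma K (act sigma [c unip x y z] f)) =
  csum pairs (cell_term f x).
Proof.
move=> fV x1; have st := cell_term_summable f x fV x1.
have E k : cell_index k -> cell_term f x k =
    eisenstein_term sigma (cell_index_coset k) (act sigma [c unip x y z] f).
  by case: k => c r kI; rewrite (term_value sigma sigmaP lam f c r x y z fV kI).
split.
  apply: csumm_reindex (@cell_index_bij R) _; apply: eq_csumm E _.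
  by apply: csumm_mkcond st => //; [exact: cell_index_pairs|exact: cell_term_out].
rewrite (csum_reindex _ _ _ _ (@cell_index_bij R)) -(eq_csum _ _ _ E).
by apply: csum_mkcond; [exact: cell_index_pairs|exact: cell_term_out].
Qed.

Lemma act_unip0 f : act sigma [c unip 0 0 0] f = f.
Proof. by apply/funext => g; rewrite /act unip0 cinv1// cmul1g. Qed.

Definition esum_distr : distr := fun f =>
  csum cosets (fun K => eisenstein_term sigma K f).

Lemma esum_distrE f : V f -> csumm cosets (fun K => eisenstein_term sigma K f) /\
  esum_distr f = csum pairs (cell_term f 0).
Proof.
move=> fV; have := eisenstein_sum f 0 0 0 fV; rewrite normr0 => /(_ ler01).
by rewrite act_unip0.
Qed.

Lemma norm_line (v : R) : `|v| <= 1 -> `|line v| <= 1.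
Proof.
move=> v1; rewrite /Num.norm /= mx_normrE.
apply: bigmax_le => // -[i j] _ /=; rewrite !mxE.
by case: (_ && _); rewrite ?mulr1 ?mulr0 ?normr0.
Qed.

Lemma esum_distr_Vdistr : Vdistr sigma lam phi esum_distr.
Proof.
split.
  move=> c f h fV hV; have [sf _] := esum_distrE f fV; have [sh _] := esum_distrE h hV.
  rewrite /esum_distr -csumZ// -csumD//; last exact: csummZ.
  by apply: eq_csum => K _; rewrite /eisenstein_term /dact /tau /act !mxE.
exists (2 * (6 * 2 * esumR pairs pair_bound)), 1, 0%N, [:: [c w_stat]; [c w_stat']].
move=> f B fV B0 fB.
have lb : line_bound f (2 * B).
  have main g v : g \in [:: [c w_stat]; [c w_stat']] -> `|v| <= 1 ->
      normc (f (g ∙ [c unip 0 v 0]) 1 0) <= 2 * B.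
    move=> gs v1; have := fB g 1 [::] (line v) gs isT (norm_line v v1).
    rewrite /= /Re_in_chart /Im_in_chart chart_line// => -[h1 h2].
    by apply: le_trans (normc_le _) _; rewrite mulr_natl mulr2n lerD.
  by move=> v v1; split; apply: main => //; rewrite !inE eqxx ?orbT.
rewrite -[complex.Re `|_|]/(normc _) (esum_distrE f fV).2.
have zle : `|0 : R| <= 1 by rewrite normr0.
apply: le_trans (csum_normc_le _ _ _ (fun k kP => cell_term_bound f _ 0 k fV lb zle kP)
  (rsummableZ _ _ _ pair_bound_summable)) _.
rewrite esumRZ; last by rewrite !mulr_ge0.
by rewrite le_eqVlt; apply/orP; left; apply/eqP; ring.
Qed.

Lemma eisenstein_alpha1E f : V f ->
  eisenstein_alpha1 sigma lam f = csum cosets (fun K => eisenstein_term sigma K f).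
Proof.
move=> fV; rewrite /eisenstein_alpha1.
case: xgetP => [E _ [_ /(_ f fV)[_]]//|/(_ esum_distr)[]].
split; first exact: esum_distr_Vdistr.
move=> h hV; have [sh _] := esum_distrE h hV; split => //.
exact: csumm_csummable.
Qed.
End Eisenstein.

(** * Unfolding *)

Section Unfolding.
Context {R : realType}.
Local Notation C := R[i].
Local Notation mu := (@lebesgue_measure R).
Local Notation A := ([set` `[0, 1[%R] : set R).
Local Notation normc := (@normc R).
Variable sigma : SL3 R -> SL3 R -> bool.
Hypothesis sigmaP : is_BLS_cocycle sigma.
Local Notation cmul := (cmul sigma).
Local Notation cinv := (cinv sigma).
Local Notation "g ∙ h" := (cmul g h) (at level 40, left associativity).
Local Notation "[ 'c' g ]" := (to_cover g%g) (format "[ 'c'  g ]").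
Variable lam : 'rV[C]_3.
Hypothesis lamP : 4 <= decay_weight lam.
Local Notation V := (Vsmooth sigma (- lam) (contragredient phi)).
Variables (f : @section R) (m : int).
Hypothesis fV : V f.
Local Notation stat_line := (stat_line sigma).
Local Notation cell_term := (cell_term sigma lam).

Definition twisted_line (u : R) : C := stat_line f u * expi (- (2 * pi * (m%:~R * u))).

Lemma stat_line_continuous : ccontinuous (stat_line f).
Proof.
have [fs _] := fV; have [cR cI] := smooth_line_continuous sigma sigmaP f [c w_stat] 1 fs.
rewrite /stat_line; under eq_fun do rewrite w_stat_unip//.
apply: (@ccontinuous_comp _ (fun v => f ([c w_stat] ∙ [c unip 0 v 0]) 1 0) (fun u => - u)).
  by move=> x; apply: cvgN; exact: cvg_id.
by split.
Qed.

Lemma ccontinuous_character (n : int) : ccontinuous (fun x : R => expi (2 * pi * (n%:~R * x))).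
Proof.
apply: (@ccontinuous_comp _ expi (fun x : R => 2 * pi * (n%:~R * x))) => [x|].
  by do 2!apply: cvgM; (exact: cvg_cst || exact: cvg_id).
exact: ccontinuous_expi.
Qed.

Lemma twisted_line_continuous : ccontinuous twisted_line.
Proof.
apply: ccontinuousM; first exact: stat_line_continuous.
apply: (@ccontinuous_comp _ expi (fun x : R => - (2 * pi * (m%:~R * x)))) => [x|].
  by apply: cvgN; do 2!apply: cvgM; (exact: cvg_cst || exact: cvg_id).
exact: ccontinuous_expi.
Qed.

Lemma twisted_line_decay :
  exists2 B, 0 <= B & forall u, normc (twisted_line u) <= 2 * B / (1 + u ^+ 2).
Proof.
have [B B0 fB] := line_bound_exists sigma sigmaP lam f fV; exists B => // u.
rewrite /twisted_line normcM normc_expi mulr1.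
apply: (flat_section_decay sigma sigmaP lam) => //; last by move=> v /fB[].
  by apply: le_trans lamP; lra.
by move=> v /fB[].
Qed.

Lemma decay_integrable (h : R -> R) (B : R) : 0 <= B -> continuous h ->
  (forall u, `|h u| <= 2 * B / (1 + u ^+ 2)) -> mu.-integrable setT (EFin \o h).
Proof.
move=> B0 ch hB; apply/integrableP; split.
  by apply/measurable_EFinP; exact: continuous_measurable_on.
pose b (k : int) : R := 6 * B * (1 + k%:~R ^+ 2)^-1.
have ck : continuous (fun x => `|h x|).
  by move=> x; apply: continuous_comp; [exact: ch|exact: norm_continuous].
have mA : measurable A by exact: measurable_itv.
have mu1 : mu A = 1%E by rewrite lebesgue_measure_itv/= lte01 oppr0 adde0.
under eq_integral do rewrite /=.
rewrite (@integral_unit_intervals _ (fun x => `|h x|) 0)//.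
have : rsummable [set: int] b by apply: rsummableZ; exact: rsummable_int.
apply: le_lt_trans; apply: le_esum => k _.
apply: (@le_trans _ _ (\int[mu]_(x in A) (cst (b k)%:E x))%E); last first.
  by rewrite integral_cst// [X in (_ * X)%E]mu1 mule1 lee_fin ler_norm.
apply: ge0_le_integral => //.
- have cr : continuous (fun x : R => 0 + k%:~R - x).
    by move=> x; apply: cvgB; [exact: cvg_cst|exact: cvg_id].
  apply/measurable_EFinP; apply: continuous_measurable_on => // x.
  exact: (continuous_comp (cr x) (ck _)).
- move=> x; rewrite /= in_itv/= => /andP[x0 x1]; rewrite lee_fin add0r.
  apply: le_trans (hB _) _.
  have := poly_domination 1 k%:~R x B (lexx _) B0.
  rewrite ger0_norm// (ltW x1) => /(_ isT).
  by rewrite !expr1n invr1 !mul1r mulr1.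
Qed.

Lemma twisted_line_integrable : cintegrable mu setT twisted_line.
Proof.
have [B B0 hB] := twisted_line_decay; have [cR cI] := twisted_line_continuous.
split; apply: decay_integrable B0 _ _ => // u; apply: le_trans (hB u).
  exact: Re_normc.
exact: Im_normc.
Qed.

Definition cell_coef (k : nat * int) : C := cpow (4 * k.1)%N%:R (-1 - lam 0 1 + lam 0 2) *
  (kloosterman_coef k.1 `|(k.2 %% (4 * k.1)%N)%Z|%N *
   expi (2 * pi * (m%:~R * k.2%:~R / (4 * k.1)%N%:R))).

Lemma cell_term_twisted x k : cell_term f x k * expi (2 * pi * (m%:~R * x)) =
  cell_coef k * twisted_line (k.2%:~R / (4 * k.1)%N%:R - x).
Proof.
rewrite /cell_term /cell_coef /twisted_line.
set u := k.2%:~R / _; have -> : m%:~R * k.2%:~R / (4 * k.1)%N%:R = m%:~R * u :> R by rewrite mulrA.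
have -> : expi (2 * pi * (m%:~R * x)) =
    expi (2 * pi * (m%:~R * u)) * expi (- (2 * pi * (m%:~R * (u - x)))) :> C.
  by rewrite -expiD; congr expi; ring.
ring.
Qed.

Definition cell_integral (k : nat * int) : C :=
  cintegral mu A (fun x => cell_term f x k * expi (2 * pi * (m%:~R * x))).

Lemma cell_integralE k : cell_integral k = cell_coef k *
  cintegral mu A (fun x => twisted_line (k.2%:~R / (4 * k.1)%N%:R - x)).
Proof.
rewrite /cell_integral -cintegralZ//; first by apply: eq_cintegral => x _; exact: cell_term_twisted.
have [cR cI] := twisted_line_continuous.
by split; exact: (@reflect_integrable _ (_ \o _)).
Qed.

Lemma cintegral_csum_pairs :
  [/\ cintegrable mu A (fun x => csum pairs (cell_term f x) * expi (2 * pi * (m%:~R * x))),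
      csumm pairs cell_integral &
      cintegral mu A (fun x => csum pairs (cell_term f x) * expi (2 * pi * (m%:~R * x))) =
  csum pairs cell_integral].
Proof.
have [B B0 fB] := line_bound_exists sigma sigmaP lam f fV.
have mu1 : (mu A < +oo)%E by rewrite lebesgue_measure_itv/= lte01 oppr0 adde0 ltry.
have [] := @cintegral_csum R _ _ mu _ pairs A
  (fun k x => cell_term f x k * expi (2 * pi * (m%:~R * x))) (fun k => 6 * B * pair_bound k).
- exact: measurable_itv.
- exact: mu1.
- move=> k _.
  have [] : ccontinuous (fun x => cell_term f x k * expi (2 * pi * (m%:~R * x))).
    under eq_fun do rewrite cell_term_twisted.
    apply: ccontinuousM; first exact: ccontinuous_cst.
    apply: ccontinuous_comp twisted_line_continuous => x.
    by apply: cvgB; [exact: cvg_cst|exact: cvg_id].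
  by move=> cR cI; split; apply: continuous_measurable_on.
- move=> k x kP; rewrite /= in_itv/= => /andP[x0 x1].
  rewrite normcM normc_expi mulr1; apply: (cell_term_bound sigma sigmaP lam) => //.
  by rewrite ger0_norm// ltW.
- exact: rsummableZ pair_bound_summable.
have E x : A x -> csum pairs (fun k => cell_term f x k * expi (2 * pi * (m%:~R * x))) =
    csum pairs (cell_term f x) * expi (2 * pi * (m%:~R * x)).
  rewrite /= in_itv/= => /andP[x0 x1]; rewrite csumZr//.
  apply: (cell_term_summable sigma sigmaP lam) => //.
  by rewrite ger0_norm// ltW.
move=> [iR iI] s e; split => //; last first.
  by rewrite -e; apply: eq_cintegral => x /E.
have mA : measurable A by exact: measurable_itv.
split; [move: iR|move: iI]; apply: eq_integrable => // x /set_mem /E e'.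
  by congr ((complex.Re _)%:E).
by congr ((complex.Im _)%:E).
Qed.

Lemma euclid_bij (n : nat) : (0 < n)%N ->
  set_bij (`I_n `*`` (fun=> [set: int])) [set: int] (fun k => k.1%:Z + n%:Z * k.2).
Proof.
move=> n0; split => //.
- move=> [r k] [r' k'] /set_mem[/= rn _] /set_mem[/= rn' _] e.
  have kk : k = k' by nia.
  by move: e; rewrite kk => /addIr[->].
- move=> z _; exists (`|(z %% n)%Z|%N, (z %/ n)%Z) => /=; last first.
    by rewrite gez0_abs ?modz_ge0; lia.
  by split => //=; lia.
Qed.

Lemma cell_coef_period (c r : nat) (k : int) : (0 < c)%N -> (r < 4 * c)%N ->
  cell_coef (c, r%:Z + (4 * c)%N%:Z * k) = cell_coef (c, r%:Z).
Proof.
move=> c0 rc; rewrite /cell_coef /= (addrC r%:Z) (mulrC _ k) modzMDl; congr (_ * (_ * _)).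
have D0 : (4 * c)%N%:R != 0 :> R by rewrite pnatr_eq0; lia.
rewrite rmorphD rmorphM /= (_ : 2 * pi * _ = 2 * pi * (m * k)%:~R +
  2 * pi * (m%:~R * r%:R / (4 * c)%N%:R)); first by rewrite expiD expi_int mul1r.
rewrite rmorphM /= -!pmulrn; move: (4 * c)%N%:R D0 => D D0; by field.
Qed.

Lemma modulus_sum (c : nat) : (0 < c)%N -> csumm [set: int] (fun r => cell_integral (c, r)) ->
  csum [set: int] (fun r => cell_integral (c, r)) =
  cpow (4 * c)%N%:R (-1 - lam 0 1 + lam 0 2) * kloosterman 1 m c * cintegral mu setT twisted_line.
Proof.
move=> c0; set D := (4 * c)%N; have D0 : (0 < D)%N by rewrite /D; lia.
have D1 : D%:R != 0 :> R by rewrite pnatr_eq0 -lt0n.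
move=> s; have be := euclid_bij _ D0.
rewrite (csum_reindex _ _ _ _ be).
have {}s := csumm_reindexV _ _ _ _ _ _ be s.
have E (r : nat) (k : int) : (r < D)%N -> cell_integral (c, r%:Z + D%:Z * k) =
    cell_coef (c, r%:Z) * cintegral mu A (fun x => twisted_line (r%:R / D%:R + k%:~R - x)).
  move=> rD; rewrite cell_integralE cell_coef_period//=; congr (_ * _).
  apply: eq_cintegral => x _; congr (twisted_line (_ - _)).
  by rewrite -/D rmorphD rmorphM /=; field.
have [_ _ <-] := csum_pair _ _ (fun r k => cell_integral (c, r%:Z + D%:Z * k)) s.
rewrite csum_ord kloosterman_coefE -/D mulr_sumr mulr_suml.
apply: eq_bigr => r _; have [cR cI] := twisted_line_continuous.
have [sP eP] := csum_unit_intervals twisted_line (r%:R / D%:R) cR cI twisted_line_integrable.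
rewrite (eq_csum _ _ _ (fun k _ => E r k (ltn_ord r))) csumZ// eP.
congr (_ * _); rewrite /cell_coef /= -/D modz_small ?absz_nat ?mulrA//.
by rewrite /= ltz_nat ltn_ord.
Qed.

End Unfolding.

Section FourierCoefficient.
Context {R : realType}.
Local Notation C := R[i].
Local Notation mu := (@lebesgue_measure R).
Local Notation A := ([set` `[0, 1[%R] : set R).
Local Notation normc := (@normc R).
Variable sigma : SL3 R -> SL3 R -> bool.
Hypothesis sigmaP : is_BLS_cocycle sigma.
Variable lam : 'rV[C]_3.
Hypothesis lamP : 4 <= decay_weight lam.
Local Notation V := (Vsmooth sigma (- lam) (contragredient phi)).

Lemma normc_kloosterman (m : int) (c : nat) : (0 < c)%N ->
  normc (kloosterman 1 m c) <= (4 * c)%N%:R.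
Proof.
move=> c0; rewrite kloosterman_coefE -[X in _ <= X%:R]card_ord -sumr_const.
elim/big_ind2: _ => [|x1 x2 y1 y2 h1 h2|r _]; first by rewrite normc0.
  by apply: le_trans (lerD h1 h2); exact: le_normcD.
by rewrite normcM normc_expi mulr1; exact: normc_kloosterman_coef.
Qed.

Lemma kloosterman_summable (m : int) : csumm [set c : nat | (0 < c)%N]
  (fun c => cpow (4 * c)%N%:R (-1 - lam 0 1 + lam 0 2) * kloosterman 1 m c).
Proof.
apply: (@csumm_le _ _ _ _ (fun c => (1 + c%:R ^+ 2)^-1)) => [c c0|]; last first.
  apply: le_lt_trans (@rsummable_nat R).
  by rewrite [leLHS]esum_mkcond; apply: le_esum => c _; case: ifP.
have D1 : 1 <= (4 * c)%N%:R :> R by rewrite ler1n muln_gt0.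
have D0 := lt_le_trans ltr01 D1.
rewrite normcM; apply: (@le_trans _ _ (((4 * c)%N%:R ^+ 4)^-1 * (4 * c)%N%:R)).
  apply: ler_pM (normc_kloosterman m c c0); try exact: normc_ge0.
  exact: (normc_cpow_weight lam _ 4 lamP D1).
rewrite exprSr invfM -mulrA mulVf ?gt_eqF// mulr1.
rewrite lef_pV2 ?posrE ?oneDsqr_gt0 ?exprn_gt0//.
have c1 : 1 <= c%:R :> R by rewrite ler1n.
rewrite natrM exprMn; nra.
Qed.

Lemma fourier_coefficientE (m1 m2 : int) f : V f ->
  fourier_coefficient sigma m1 m2 (eisenstein_alpha1 sigma lam) f =
  cintegral mu A (fun x => csum pairs (cell_term sigma lam f x) * expi (2 * pi * (m1%:~R * x))) *
  cintegral mu A (fun y => expi (2 * pi * (m2%:~R * y))).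
Proof.
move=> fV; have [iW _ _] := cintegral_csum_pairs sigma sigmaP lam lamP f m1 fV.
rewrite -cintegral_cube//; last exact: ccontinuous_integrable (ccontinuous_character m2).
apply: eq_cintegral => -[[x y] z] [[/= + _] _]; rewrite in_itv/= => /andP[x0 x1].
rewrite /pairing /dact cinvK//.
rewrite eisenstein_alpha1E//; last exact: act_Vsmooth.
have xle : `|x : R| <= 1 by rewrite ger0_norm// ltW.
have [_ ->] := eisenstein_sum sigma sigmaP lam lamP f x y z fV xle.
rewrite -mulrA -expiD /psi; congr (_ * expi _).
by rewrite !mxE /=; ring.
Qed.

Lemma csum_pairs_kloosterman f (m : int) : V f ->
  cintegral mu A (fun x => csum pairs (cell_term sigma lam f x) * expi (2 * pi * (m%:~R * x))) =
  csum [set c : nat | (0 < c)%N]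
    (fun c => cpow (4 * c)%N%:R (-1 - lam 0 1 + lam 0 2) * kloosterman 1 m c) *
  cintegral mu setT (twisted_line sigma f m).
Proof.
move=> fV; have [_ s ->] := cintegral_csum_pairs sigma sigmaP lam lamP f m fV.
have [_ sc] := csum_pair _ _ (fun c r => cell_integral sigma lam f m (c, r)) s.
have -> : csum pairs (cell_integral sigma lam f m) =
  csum ([set c | (0 < c)%N] `*`` (fun=> [set: int]))
  (fun k => cell_integral sigma lam f m (k.1, k.2)) by apply: eq_csum => -[].
move=> <-; rewrite -csumZr; last exact: kloosterman_summable.
by apply: eq_csum => c c0; apply: modulus_sum => //; exact: sc.
Qed.
End FourierCoefficient.

Theorem proposition36 (R : realType) (sigma : SL3 R -> SL3 R -> bool)
    (Hsigma : is_BLS_cocycle sigma) :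
  exists L : R, forall lam : 'rV[R[i]]_3,
    \sum_i lam 0 i = 0 ->
    L < complex.Re (lam 0 0 - lam 0 1) ->
    L < complex.Re (lam 0 1 - lam 0 2) ->
  forall (m1 m2 : int) (f : section),
    Vsmooth sigma (- lam) (contragredient phi) f ->
    let coeff := fourier_coefficient sigma m1 m2 (eisenstein_alpha1 sigma lam) in
    (m2 != 0 -> pairing f coeff = 0) /\
    (m2 = 0 ->
     pairing f coeff =
     csum [set B2 : nat | (0 < B2)%N]
       (fun B2 => cpow (4 * B2)%N%:R (-1 - lam 0 1 + lam 0 2)
                  * kloosterman 1 m1 B2)
     * cintegral (@lebesgue_measure R) setT
         (fun x => f (cmul sigma (to_cover (unip x 0 0)) (to_cover w_stat)) 1 0
                   * expi (- (2 * pi * (m1%:~R * x))))).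
Proof.
exists 3 => lam _ _ lamP m1 m2 f fV coeff.
have wP : 4 <= decay_weight lam by rewrite /decay_weight; lra.
rewrite /coeff /pairing fourier_coefficientE// cintegral_character.
split=> [/negbTE->|->]; first by rewrite mulr0.
by rewrite eqxx mulr1 csum_pairs_kloosterman.
Qed.
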